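(* There is a constant $c$ such that every simple 3-connected graph $G$ with $n$ vertices in which every vertex has degree at most $4$ has an orthogonal drawing of area at most $\frac{9}{16}n^2 + c\,n$.
   Context: A graph is 3-connected if it has more than $3$ vertices and, for any two vertices $u,v$, the graph $G-\{u,v\}$ is connected. An orthogonal drawing of a graph assigns: - to each vertex a distinct point with integer coordinates, and - to each edge a polygonal line connecting the points of its endpoints, all of whose segments are horizontal or vertical and whose bends lie at integer points. Edges may intersect, but only in single points that are not bends of the polygonal lines. If exactly $H$ horizontal lines and $W$ vertical lines of the integer grid intersect the drawing, the drawing has width $W$, height $H$, and area $H\cdot W$. *)

(* Defs.v *)
From mathcomp Require Import all_boot all_order all_algebra.
Set Implicit Arguments. Unset Strict Implicit. Unset Printing Implicit Defensive.
Import Order.TTheory GRing.Theory Num.Theory.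
Local Open Scope ring_scope.

Definition simple_graph (V : finType) (e : rel V) : Prop :=
  irreflexive e /\ symmetric e.

Definition max_degree_le (V : finType) (e : rel V) (k : nat) : Prop :=
  forall v : V, (#|[set w | e v w]| <= k)%N.

Definition connected_without (V : finType) (e : rel V) (S : {set V}) : Prop :=
  forall x y : V, x \notin S -> y \notin S ->
    connect [rel a b | e a b && (a \notin S) && (b \notin S)] x y.

Definition three_connected (V : finType) (e : rel V) : Prop :=
  (3 < #|V|)%N /\ forall u v : V, connected_without e [set u; v].

Definition pt := (int * int)%type.
Definition qpt := (rat * rat)%type.
Definition i2q (z : int) : rat := z%:~R.
Definition qp (p : pt) : qpt := (i2q p.1, i2q p.2).

Definition segments (l : seq pt) : seq (pt * pt) := zip l (behead l).

Definition horiz (s : pt * pt) : bool := (s.1.2 == s.2.2) && (s.1.1 != s.2.1).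
Definition vert (s : pt * pt) : bool := (s.1.1 == s.2.1) && (s.1.2 != s.2.2).
Definition axis_seg (s : pt * pt) : bool := horiz s || vert s.

Definition on_seg (p : qpt) (s : pt * pt) : bool :=
  (i2q (Num.min s.1.1 s.2.1) <= p.1 <= i2q (Num.max s.1.1 s.2.1)) &&
  (i2q (Num.min s.1.2 s.2.2) <= p.2 <= i2q (Num.max s.1.2 s.2.2)).

Definition overlap (s t : pt * pt) : bool :=
  (horiz s && horiz t && (s.1.2 == t.1.2) &&
    (Num.max (Num.min s.1.1 s.2.1) (Num.min t.1.1 t.2.1)
       < Num.min (Num.max s.1.1 s.2.1) (Num.max t.1.1 t.2.1)))
  ||
  (vert s && vert t && (s.1.1 == t.1.1) &&
    (Num.max (Num.min s.1.2 s.2.2) (Num.min t.1.2 t.2.2)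
       < Num.min (Num.max s.1.2 s.2.2) (Num.max t.1.2 t.2.2))).

Definition on_polyline (p : qpt) (l : seq pt) : bool := has (on_seg p) (segments l).

(* An orthogonal polygonal line given by its sequence of corner points:
   every segment is horizontal or vertical (nondegenerate), and the line is
   simple (consecutive segments meet only in their common point, other
   segments are disjoint). *)
Definition orth_polyline (l : seq pt) : Prop :=
  all axis_seg (segments l) /\
  forall i j : nat, (i < j < size (segments l))%N ->
    let si := nth (0, 0, (0, 0)) (segments l) i in
    let sj := nth (0, 0, (0, 0)) (segments l) j in
    (j = i.+1 -> ~~ overlap si sj) /\
    ((i.+1 < j)%N -> forall p : qpt, ~~ (on_seg p si && on_seg p sj)).

(* A drawing: vertex positions [pos], and for each ordered pair (u,v) the
   list [route u v] of bends of the polygonal line drawn for edge uv,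
   going from pos u to pos v. *)
Definition polyline (V : Type) (pos : V -> pt) (route : V -> V -> seq pt)
  (u v : V) : seq pt := pos u :: rcons (route u v) (pos v).

Definition is_bend (V : Type) (route : V -> V -> seq pt) (u v : V) (p : qpt) : Prop :=
  exists2 b, b \in route u v & p = qp b.

Definition orthogonal_drawing (V : finType) (e : rel V)
  (pos : V -> pt) (route : V -> V -> seq pt) : Prop :=
  injective pos /\
  (forall u v, e u v -> route v u = rev (route u v)) /\
  (forall u v, e u v -> orth_polyline (polyline pos route u v)) /\
  (forall u v w, e u v -> w != u -> w != v ->
     ~~ on_polyline (qp (pos w)) (polyline pos route u v)) /\
  (forall u v x y, e u v -> e x y -> ~ ((u = x /\ v = y) \/ (u = y /\ v = x)) ->
     (forall s t, s \in segments (polyline pos route u v) ->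
                  t \in segments (polyline pos route x y) -> ~~ overlap s t) /\
     (forall p : qpt, on_polyline p (polyline pos route u v) ->
                      on_polyline p (polyline pos route x y) ->
                      ~ is_bend route u v p /\ ~ is_bend route x y p)).

Definition on_drawing (V : finType) (e : rel V)
  (pos : V -> pt) (route : V -> V -> seq pt) (p : qpt) : Prop :=
  (exists v, p = qp (pos v)) \/
  (exists u v, e u v /\ on_polyline p (polyline pos route u v)).

Definition drawing_height (V : finType) (e : rel V)
  (pos : V -> pt) (route : V -> V -> seq pt) (H : nat) : Prop :=
  exists s : seq int, [/\ uniq s, size s = H &
    forall y : int, y \in s <-> exists p, on_drawing e pos route p /\ p.2 = i2q y].

Definition drawing_width (V : finType) (e : rel V)
  (pos : V -> pt) (route : V -> V -> seq pt) (W : nat) : Prop :=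
  exists s : seq int, [/\ uniq s, size s = W &
    forall x : int, x \in s <-> exists p, on_drawing e pos route p /\ p.1 = i2q x].

(* Main.v *)
Require Import Defs.
From mathcomp Require Import all_boot all_order all_algebra zify lra.
From Stdlib Require Import Classical.
Set Implicit Arguments. Unset Strict Implicit. Unset Printing Implicit Defensive.

(* The vertices are ordered into chains: after an initial edge, each step adds
   either one vertex with two or three earlier neighbours or an induced path
   whose two ends have one earlier neighbour each, these being distinct, and
   whose interior has none; the not yet added vertices stay connected, and a
   last vertex [t] is added alone.  The drawing grows upwards along this order.
   Each edge to a later vertex is pending: it ends in a vertical ray on a
   column of its own.  A chain of [k] vertices takes one new row and [2k - 2]
   new columns: its inner vertices get a fresh pair of adjacent columns each,
   the left one running down to level 0 and back up the right one.  A single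
   vertex takes one new row and no column: it sits on a column of an incoming
   edge, and a vertex with two edges each way borrows a free column from a pool
   of constant size [K + 2], which costs an auxiliary row once per [K + 1]
   borrowings.  With [J] the sum of the [k - 1], the width is [2J + O(1)] and
   the height at most [(1 + 2/(K + 1)) (n - J) + O(1)], so the area is at most
   [(1/2 + eps) n^2 + O(n)]. *)

(** * Chain orderings *)

(** The delicate point is the inner vertices of chains. The chain edges take both sides of such a
    vertex, so its second outgoing edge has to loop below, and loops can share level 0 only if their
    column ranges are disjoint; this is why a pair stays adjacent for ever. A later chain with an
    inner vertex then fails if the edges to its two ends wait on the two columns of one pair, since
    no room can be made between them. The remedy lies in the choice of columns when edges start:
    such an end has one mate and one predecessor, so a target is forbidden on at most one column and
    a column to at most one target, and exchanging two columns always helps. Only a vertex with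
    three predecessors has no choice, its one free side being the top. If its successor is an end of
    such a chain, that end is split off and drawn at once, on the columns that the two side edges
    have just released. Since [2 J (n - J)] is at most [n^2 / 2], the gap between 1/2 and 9/16
    absorbs the auxiliary rows. *)

Section Connected.
Variables (V : finType) (e : rel V).
Hypothesis esym : symmetric e.

Definition rin (A : {set V}) := [rel a b | [&& e a b, a \in A & b \in A]].
Definition conn (A : {set V}) := [forall x in A, forall y in A, connect (rin A) x y].
Definition comp (A : {set V}) (x : V) := [set y in A | connect (rin A) x y].

Lemma connP (A : {set V}) :
  reflect (forall x y, x \in A -> y \in A -> connect (rin A) x y) (conn A).
Proof.
apply: (iffP forall_inP) => [H x y xA yA|H x xA]; first exact: (forall_inP (H x xA)).
by apply/forall_inP => y yA; apply: H.
Qed.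

Lemma rin_sym (A : {set V}) : symmetric (rin A).
Proof. by move=> x y /=; rewrite esym [X in _ && X]andbC. Qed.

Lemma closed_sub (A B : {set V}) x y :
  x \in B -> (forall a b, a \in B -> a \in A -> b \in A -> e a b -> b \in B) ->
  connect (rin A) x y -> y \in B.
Proof.
move=> xB cl /connectP[p]; elim: p x xB => [|z p IH] x xB /=; first by move=> _ ->.
by case/andP => /and3P[exz xA zA] pp yl; apply: (IH z) => //; exact: (cl x z).
Qed.

(** Connectivity is used throughout in the form that a subset closed under the edges inside [A] is
    empty or everything; [connE] and [connI] are the two directions, and they avoid handling
    paths. *)
Lemma connE (A B : {set V}) x :
  conn A -> x \in A -> x \in B ->
  (forall a b, a \in B -> a \in A -> b \in A -> e a b -> b \in B) -> A \subset B.
Proof.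
move=> /connP cA xA xB cl; apply/subsetP => y yA.
by apply: (closed_sub xB cl); apply: cA.
Qed.

Lemma connI (A : {set V}) :
  (forall (B : {set V}) x, x \in B -> x \in A ->
     (forall a b, a \in B -> a \in A -> b \in A -> e a b -> b \in B) -> A \subset B) ->
  conn A.
Proof.
move=> H; apply/connP => x y xA yA.
have /subsetP/(_ y yA) : A \subset [set y | connect (rin A) x y].
  apply: (H _ x) => //; rewrite ?inE // => a b; rewrite !inE => xa aA bA eab.
  by apply: connect_trans xa _; apply: connect1; rewrite /= eab aA bA.
by rewrite inE.
Qed.

Lemma comp_sub (A : {set V}) x : comp A x \subset A.
Proof. by apply/subsetP => y; rewrite inE => /andP[]. Qed.

Lemma mem_comp (A : {set V}) x : x \in A -> x \in comp A x.
Proof. by move=> xA; rewrite inE xA connect0. Qed.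

Lemma comp_closed (A : {set V}) x a b : a \in comp A x -> b \in A -> e a b -> b \in comp A x.
Proof.
rewrite !inE => /andP[aA xa] bA eab; rewrite bA /=.
by apply: connect_trans xa _; apply: connect1; rewrite /= eab aA bA.
Qed.

Lemma conn_comp (A : {set V}) x : conn (comp A x).
Proof.
apply: connI => B y yB yC cl; apply/subsetP => z; rewrite inE => /andP[zA xz].
have xy : connect (rin A) y x.
  by rewrite (sym_connect_sym (@rin_sym A)); move: yC; rewrite inE => /andP[].
have: z \in B :&: comp A x.
  apply: (@closed_sub A _ y); rewrite ?inE ?yB //=.
  - by move: yC; rewrite inE.
  - move=> a b /setIP[aB aC] _ bA eab.
    have bC := comp_closed aC bA eab.
    by rewrite in_setI bC (cl a b) //.
  - exact: connect_trans xy xz.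
by case/setIP.
Qed.

Lemma sub_comp (A B : {set V}) x y :
  conn B -> B \subset A -> y \in B -> y \in comp A x -> B \subset comp A x.
Proof.
move=> cB sBA yB yC; apply: (connE cB yB yC) => a b aC aB bB eab.
by apply: comp_closed aC _ eab; apply: (subsetP sBA).
Qed.

Lemma conn1 x : conn [set x].
Proof.
apply: connI => B y yB /set1P yx _; apply/subsetP => z /set1P ->.
by rewrite -yx.
Qed.

Lemma connU (A B : {set V}) a b :
  conn A -> conn B -> a \in A -> b \in B -> e a b -> conn (A :|: B).
Proof.
move=> cA cB aA bB eab; apply: connI => X x xX xAB cl.
have clA : forall u v, u \in X -> u \in A -> v \in A -> e u v -> v \in X.
  by move=> u v uX uA vA; apply: cl => //; rewrite inE ?uA ?vA.
have clB : forall u v, u \in X -> u \in B -> v \in B -> e u v -> v \in X.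
  by move=> u v uX uA vA; apply: cl => //; rewrite inE ?uA ?vA orbT.
case/setUP: xAB => xA.
  have sA := connE cA xA xX clA.
  have bX : b \in X.
    by apply: (cl a) => //; rewrite ?inE ?aA ?bB ?orbT //; apply: (subsetP sA).
  by rewrite subUset sA (connE cB bB bX clB).
have sB := connE cB xA xX clB.
have aX : a \in X.
  apply: (cl b) => //; rewrite ?inE ?aA ?bB ?orbT //; last by rewrite esym.
  by apply: (subsetP sB).
by rewrite subUset sB (connE cA aA aX clA).
Qed.

(** Every component of [A :\: B] is joined to [B] because [A] is connected, so deleting one
    component leaves the others attached to [B]. This keeps the undrawn part connected whenever
    something is split off. *)
Lemma conn_setD_comp (A B : {set V}) x b :
  conn A -> conn B -> B \subset A -> b \in B ->
  conn (A :\: comp (A :\: B) x).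
Proof.
move=> cA cB sBA bB; set D := comp _ _.
have sD : forall z, z \in D -> (z \in A) && (z \notin B).
  by move=> z /(subsetP (comp_sub _ _)); rewrite inE andbC.
have sBD : forall z, z \in B -> z \in A :\: D.
  move=> z zB; rewrite inE (subsetP sBA) // andbT.
  by apply/negP => /sD /andP[_]; rewrite zB.
apply: connI => X y yX yAD cl.
have [z zB zX] : exists2 z, z \in B & z \in X.
  have [/exists_inP //|/exists_inPn no] := boolP [exists z in B, z \in X].
  have: A \subset X :&: (A :\: D).
    apply: (@connE _ _ y) => //; first by case/setDP: yAD.
      by rewrite in_setI yX.
    move=> u v /setIP[uX uAD] uA vA euv.
    have vD : v \notin D.
      apply/negP => vD.
      have: u \in D.
        apply: (comp_closed vD); rewrite ?(esym v) // inE uA andbT.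
        by apply/negP => /no; rewrite uX.
      by case/setDP: uAD => _ /negP.
    have vAD : v \in A :\: D by rewrite inE vA vD.
    by rewrite in_setI vAD (cl u v).
  move/subsetP/(_ b (subsetP sBA _ bB)) => /setIP[bX _].
  by have := no b bB; rewrite bX.
have sBX : B \subset X.
  apply: (connE cB zB zX) => u v uX uB vB euv.
  by apply: (cl u v) => //; apply: sBD.
have: A \subset X :|: D.
  apply: (@connE _ _ y) => //; first by case/setDP: yAD.
    by rewrite inE yX.
  move=> u v uXD uA vA euv; rewrite inE.
  have [vD|vD] := boolP (v \in D); first by rewrite orbT.
  have vAD : v \in A :\: D by rewrite inE vA vD.
  rewrite orbF.
  have [vB|vB] := boolP (v \in B); first by apply: (subsetP sBX).
  have uD : u \notin D.
    apply: contra vD => uD; apply: (comp_closed uD) => //.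
    by rewrite inE vB.
  case/setUP: uXD => [uX|]; last by rewrite (negPf uD).
  by apply: (cl u v) => //; rewrite inE uA uD.
move=> sA; apply/subsetP => w /setDP[wA wD].
by have /setUP[//|] := subsetP sA _ wA; rewrite (negPf wD).
Qed.

Lemma conn_sorted (C : seq V) : sorted e C -> conn [set x in C].
Proof.
elim: C => [|x [|y C] IH].
- by move=> _; apply/connP => x y; rewrite inE.
- by move=> _; rewrite set_cons set_nil setU0; exact: conn1.
- move=> /= /andP[exy sC]; rewrite set_cons.
  apply: (@connU _ _ x y) => //; rewrite ?inE ?eqxx //; first exact: conn1.
  exact: IH.
Qed.


Lemma sorted_connect_path (A : {set V}) x p :
  path (rin A) x p -> sorted e (x :: p) /\ {subset p <= A}.
Proof.
elim: p x => [|y p IH] x //= /andP[/and3P[exy _ yA] pp].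
case: (IH y pp) => sp sub; split; first by rewrite exy.
by move=> z; rewrite inE => /predU1P[->|/sub].
Qed.

Definition nS (S : {set V}) (v : V) := [set s in S | e v s].
Definition NS (S Z : {set V}) := [set s in S | [exists z in Z, e z s]].

Lemma NSP (S Z : {set V}) s :
  reflect (s \in S /\ exists2 z, z \in Z & e z s) (s \in NS S Z).
Proof.
by rewrite inE; apply: (iffP andP) => [] [sS /exists_inP].
Qed.

Lemma NS_sub (S Y Z : {set V}) : Y \subset Z -> NS S Y \subset NS S Z.
Proof.
move=> /subsetP sYZ; apply/subsetP => s /NSP[sS [z zY ezs]].
by apply/NSP; split=> //; exists z => //; apply: sYZ.
Qed.

Lemma NS1 (S : {set V}) v : NS S [set v] = nS S v.
Proof.
apply/setP => s; rewrite [RHS]inE; apply/NSP/andP => [[sS [z /set1P -> //]]|[sS evs]].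
by split=> //; exists v => //; apply/set1P.
Qed.

(* The pieces of an ordering in which every initial segment can be extended:
   either one vertex with two earlier neighbours, or an induced path attached
   to the earlier vertices exactly at its two ends and to distinct vertices. *)
Definition chain_ok (S : {set V}) (C : seq V) : Prop :=
  (exists2 v, C = [:: v] & 1 < #|nS S v| <= 3) \/
  [/\ 1 < size C, sorted e C,
      forall p x q y r, C = p ++ x :: q ++ y :: r -> q != [::] -> ~~ e x y,
      forall p x q, C = p ++ x :: q -> p != [::] -> q != [::] -> nS S x = set0 &
      forall z C', C = z :: C' ->
        exists s s', [/\ s != s', nS S z = [set s] & nS S (last z C') = [set s']]].

Hypothesis eirr : irreflexive e.
Hypothesis e3 : three_connected e.
Hypothesis e4 : max_degree_le e 4.

(** This is the form in which 3-connectivity serves the ordering: no set is cut off from a further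
    vertex by two vertices. The case [u = v] is included and covers cuts by a single vertex. *)
Lemma separation (D : {set V}) d t u v :
  d \in D -> u \notin D -> v \notin D -> t \notin D -> t != u -> t != v ->
  (forall x w, x \in D -> e x w -> [|| w \in D, w == u | w == v]) -> False.
Proof.
move=> dD uD vD tD tu tv cl; have [_ /(_ u v d t)] := e3.
have -> : d \notin [set u; v].
  by rewrite !inE negb_or; apply/andP; split; apply: contraTN dD => /eqP ->.
have -> : t \notin [set u; v] by rewrite !inE negb_or tu.
move=> /(_ isT isT) /connectP[p]; elim: p d dD => [|w p IH] d dD /=.
  by move=> _ tE; rewrite tE dD in tD.
case/andP => /andP[/andP[edw dn] wn] pp tl; apply: (IH w) => //.
case/or3P: (cl _ _ dD edw) => // /eqP wE; move: wn; rewrite wE !inE eqxx ?orbT //.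
Qed.

(** * One step of the ordering: a minimal admissible extension *)

Section Step.
Variables (S : {set V}) (t : V).
Hypotheses (S2 : 1 < #|S|) (tS : t \notin S) (cR : conn (~: S)) (Rt : ~: S != [set t]).

Definition good (Z : {set V}) :=
  [&& Z \subset ~: S :\ t, conn Z, 1 < #|NS S Z| & conn (~: S :\: Z)].

Lemma tR : t \in ~: S. Proof. by rewrite inE. Qed.

(** A component of the undrawn part without [t] is good. If it saw at most one vertex [s] of [S],
    then [s] and [t] would cut it off from a second vertex of [S], which exists as [S] has two
    elements. *)
Lemma good_ex : exists Z, good Z.
Proof.
have [x xR xt] : exists2 x, x \in ~: S & x != t.
  have : ~: S :\ t != set0.
    apply: contraNneq Rt => R0; rewrite -(setD1K tR) R0 setU0.
    by [].
  by case/set0Pn => x /setD1P[xt xR]; exists x.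
have xRt : x \in ~: S :\ t by rewrite in_setD1 xt.
have sC : comp (~: S :\ t) x \subset ~: S :\ t by apply: comp_sub.
exists (comp (~: S :\ t) x); apply/and4P; split=> //.
- exact: conn_comp.
- rewrite ltnNge; apply/negP => le1.
  have [s NSs] : exists s, NS S (comp (~: S :\ t) x) \subset [set s].
    have [->|/set0Pn[s sN]] := eqVneq (NS S (comp (~: S :\ t) x)) set0.
      by exists t; apply: sub0set.
    exists s; apply/subsetP => s' s'N; apply/set1P.
    by apply/eqP; move/card_le1_eqP: le1 => /(_ s' s s'N sN)->.
  have [s' s'S s's] : exists2 s', s' \in S & s' != s.
    have : S :\ s != set0.
      by apply: contraTneq S2 => S0; rewrite (cardsD1 s) S0 cards0; case: (s \in S).
    by case/set0Pn => s' /setD1P[? ?]; exists s'.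
  have notS : forall z, z \in comp (~: S :\ t) x -> z \notin S.
    by move=> z /(subsetP sC) /setD1P[_]; rewrite inE.
  have tC : t \notin comp (~: S :\ t) x.
    by apply/negP => /(subsetP sC); rewrite !inE eqxx.
  have [sC'|sC'] := boolP (s \in comp (~: S :\ t) x).
    apply: (@separation _ x s' t t (mem_comp xRt)) => //.
    + by apply/negP => /notS; rewrite s'S.
    + by apply: contraNneq tS => <-.
    + by apply: contraNneq tS => <-.
    + move=> a w aC eaw; have [wS|wS] := boolP (w \in S).
        have /(subsetP NSs) /set1P ws : w \in NS S (comp (~: S :\ t) x).
          by apply/NSP; split=> //; exists a.
        by move: (notS _ sC'); rewrite -ws wS.
      have [->|wt] := eqVneq w t; first by rewrite /= ?orbT.
      by rewrite (comp_closed aC _ eaw) // !inE wt.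
  apply: (@separation _ x s' s t (mem_comp xRt)) => //.
  + by apply/negP => /notS; rewrite s'S.
  + by apply: contraNneq tS => <-.
  + move=> a w aC eaw; have [wS|wS] := boolP (w \in S).
      have /(subsetP NSs) /set1P -> : w \in NS S (comp (~: S :\ t) x).
        by apply/NSP; split=> //; exists a.
      by rewrite eqxx !orbT.
    have [->|wt] := eqVneq w t; first by rewrite /= ?orbT.
    by rewrite (comp_closed aC _ eaw) // !inE wt.
- apply: (conn_setD_comp x cR (conn1 t) _ (set11 t)).
  by rewrite sub1set tR.
Qed.

Variable Z : {set V}.
Hypothesis Zmin : minset good Z.

Lemma Zgood : good Z. Proof. exact: minsetp Zmin. Qed.
Lemma ZR z : z \in Z -> z \notin S.
Proof. by case/and4P: Zgood => /subsetP H _ _ _ /H /setD1P[_]; rewrite inE. Qed.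
Lemma Zt : t \notin Z.
Proof. by apply/negP; case/and4P: Zgood => /subsetP H _ _ _ /H; rewrite !inE eqxx. Qed.
Lemma ZsubR : Z \subset ~: S.
Proof. by apply/subsetP => z /ZR; rewrite inE. Qed.
Lemma cZ : conn Z. Proof. by case/and4P: Zgood. Qed.
Lemma NSZ : 1 < #|NS S Z|. Proof. by case/and4P: Zgood. Qed.
Lemma tRZ : t \in ~: S :\: Z. Proof. by rewrite inE Zt tR. Qed.

(** The contact vertices of [Z] with what remains undrawn afterwards. The aim of the next lemmas is
    that all of [Z] consists of contact vertices. *)
Definition Q := [set z in Z | [exists w in ~: S :\: Z, e z w]].

Lemma NS_pair (Y : {set V}) : 1 < #|NS S Y| -> exists2 y, y \in Y & y \in Y.
Proof.
case: (set_0Vmem (NS S Y)) => [->|[s /NSP[_ [y yY _]] _]]; first by rewrite cards0.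
by exists y.
Qed.

(** Let [K] be the component of [t] after removing [Y]. The set [~: S :\: K] contains [Y], is good
    and lies in [Z], hence equals [Z] by minimality. A contact vertex outside [Y] would be adjacent
    to [K], so in [K], a contradiction. *)
Lemma Q_in (Y : {set V}) : Y \subset Z -> conn Y -> 1 < #|NS S Y| -> Q \subset Y.
Proof.
move=> sYZ cY NY; apply/subsetP => z; rewrite inE => /andP[zZ /exists_inP[w wK ezw]].
apply/negPn/negP => zY; have [y yY _] := NS_pair NY.
have sYR : Y \subset ~: S by apply: subset_trans sYZ ZsubR.
pose K := comp (~: S :\: Y) t.
have tRY : t \in ~: S :\: Y.
  by rewrite inE tR andbT; apply: contra Zt; apply: (subsetP sYZ).
have sK : ~: S :\: Z \subset K.
  apply: (@sub_comp _ _ t t) => //; first by case/and4P: Zgood.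
  - exact: setDS.
  - exact: tRZ.
  - exact: mem_comp.
have zK : z \in K.
  apply: (@comp_closed _ _ w); [exact: (subsetP sK)| |by rewrite esym].
  by rewrite inE zY (subsetP ZsubR).
have sYK : Y \subset ~: S :\: K.
  apply/subsetP => a aY; rewrite inE (subsetP sYR) // andbT.
  by apply/negP => /(subsetP (comp_sub _ _)); rewrite inE aY.
have gZ' : good (~: S :\: K).
  apply/and4P; split.
  - apply/subsetP => a /setDP[aR aK]; rewrite in_setD1 aR andbT.
    by apply: contraNneq aK => ->; exact: mem_comp.
  - exact: (conn_setD_comp t cR cY sYR yY).
  - exact: leq_trans NY (subset_leq_card (NS_sub _ sYK)).
  - rewrite setDDr setDv set0U (setIidPr _); first exact: conn_comp.
    by apply: subset_trans (comp_sub _ _) (subsetDl _ _).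
have sZ' : ~: S :\: K \subset Z.
  apply/subsetP => a /setDP[aR aK]; apply/negPn/negP => aZ.
  by move/negP: aK; apply; apply: (subsetP sK); rewrite inE aZ aR.
have := minsetinf Zmin gZ' sZ' => ZE.
by move: zZ; rewrite -ZE inE zK.
Qed.

Lemma Q_sub : Q \subset Z.
Proof. by apply/subsetP => z; rewrite inE => /andP[]. Qed.

Lemma Q_comp q x : q \in Q -> #|NS S (comp (Z :\ q) x)| <= 1.
Proof.
move=> qQ; rewrite leqNgt; apply/negP => H.
have /subsetP/(_ q qQ) : Q \subset comp (Z :\ q) x.
  apply: Q_in => //; last exact: conn_comp.
  by apply: subset_trans (comp_sub _ _) (subsetDl _ _).
by move/(subsetP (comp_sub _ _)); rewrite !inE eqxx.
Qed.

Lemma le1_sub1 (A : {set V}) : #|A| <= 1 -> exists s, A \subset [set s] /\ (A != set0 -> s \in A).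
Proof.
move=> le1; have [A0|/set0Pn[s sA]] := eqVneq A set0.
  by exists t; rewrite A0 sub0set.
exists s; split=> //; apply/subsetP => s' s'A; apply/set1P/eqP.
by move/card_le1_eqP: le1 => /(_ s' s s'A sA) ->.
Qed.

Lemma Q_neq0 : exists q, q \in Q.
Proof.
have [z zZ _] := NS_pair NSZ.
have [/set0Pn//|/negPn/eqP Q0] := boolP (Q != set0).
suff /subsetP/(_ t tR) : ~: S \subset Z by rewrite (negPf Zt).
apply: (connE cR (subsetP ZsubR _ zZ) zZ) => a b aZ _ bR eab.
apply/negPn/negP => bZ; have : a \in Q.
  by rewrite inE aZ; apply/exists_inP; exists b => //; rewrite inE bZ.
by rewrite Q0 inE.
Qed.

(* If the neighbours of [D] inside [Z] are at most [a] and [b] and those in [S]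
   are covered as well, then [a], [b] separate [D] from [t]. *)
Lemma Z_separation (D : {set V}) d a b :
  d \in D -> D \subset Z -> a \notin D -> b \notin D -> a != t -> b != t ->
  (forall x, x \in D -> x \notin Q) ->
  (forall x w, x \in D -> e x w -> w \in Z -> [|| w \in D, w == a | w == b]) ->
  (forall s, s \in NS S D -> (s == a) || (s == b)) -> False.
Proof.
move=> dD sDZ aD bD at' bt DQ clZ clS.
apply: (@separation D d t a b) => //; rewrite ?(eq_sym t) //.
  by apply: contra Zt; apply: (subsetP sDZ).
move=> x w xD exw; have [wS|wS] := boolP (w \in S).
  have /clS : w \in NS S D by apply/NSP; split=> //; exists x.
  by move=> ->; rewrite orbT.
have [wZ|wZ] := boolP (w \in Z); first exact: clZ exw wZ.
case/negP: (DQ x xD); rewrite inE (subsetP sDZ) //=.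
by apply/exists_inP; exists w => //; rewrite inE wZ inE.
Qed.

Lemma NS_uniq (A : {set V}) s s' :
  #|NS S A| <= 1 -> s \in NS S A -> s' \in NS S A -> s = s'.
Proof. by move/card_le1_eqP => H sA s'A; apply: H. Qed.

Lemma NS_sep (A : {set V}) : #|NS S A| <= 1 -> exists2 s, s \in NS S Z & s \notin NS S A.
Proof.
move=> le1; have [/subset_leq_card le2|/subsetPn[s sZ sA]] := boolP (NS S Z \subset NS S A).
  by have := leq_trans NSZ (leq_trans le2 le1).
by exists s.
Qed.

(** Induction on the size of the component [D]. By 3-connectivity [D] contains a contact vertex
    [q'], otherwise [q] and the only neighbour of [D] in [S] would cut it off. If [Z :\ q'] is
    connected it sees at most one vertex of [S], so [q'] sees another one alone; if not, a component
    of [Z :\ q'] avoiding [q] is a smaller set inside [D]. *)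
Lemma comp_private q x : q \in Q -> x \in Z :\ q ->
  exists2 s, s \in NS S (comp (Z :\ q) x) & s \notin NS S (Z :\: comp (Z :\ q) x).
Proof.
have [n] := ubnP #|comp (Z :\ q) x|.
elim: n q x => // n IH q x; rewrite ltnS; set D := comp _ x => Dn qQ xZq.
have qZ : q \in Z := subsetP Q_sub _ qQ.
have le1 : #|NS S D| <= 1 := Q_comp x qQ.
have sDZq : D \subset Z :\ q := comp_sub _ _.
have sDZ : D \subset Z := subset_trans sDZq (subsetDl _ _).
have qD : q \notin D by apply/negP => /(subsetP sDZq); rewrite !inE eqxx.
have xD : x \in D := mem_comp xZq.
have qt : q != t by apply: contraNneq Zt => <-.
have cZD : conn (Z :\: D).
  by apply: (conn_setD_comp x cZ (conn1 q) _ (set11 q)); rewrite sub1set.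
have [q' q'Q q'D] : exists2 q', q' \in Q & q' \in D.
  have [/exists_inP//|/exists_inPn no] := boolP [exists z in Q, z \in D].
  have [s [NSs sN]] := le1_sub1 le1.
  have DQ z : z \in D -> z \notin Q.
    by move=> zD; apply/negP => /no; rewrite zD.
  have clD z w : z \in D -> e z w -> w \in Z -> w != q -> w \in D.
    by move=> zD ezw wZ wq; apply: (comp_closed zD _ ezw); rewrite !inE wq.
  exfalso; have [N0|/sN sND] := eqVneq (NS S D) set0.
    apply: (@Z_separation D x q q) => //.
      move=> z w zD ezw wZ; have [->|wq] := eqVneq w q; first by rewrite /= ?orbT.
      by rewrite (clD z).
    by move=> s'; rewrite N0 inE.
  have sS : s \in S by case/NSP: sND.
  apply: (@Z_separation D x q s) => //.
  - by apply/negP => /(subsetP sDZ) /ZR; rewrite sS.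
  - by apply: contraNneq tS => <-.
  - move=> z w zD ezw wZ; have [->|wq] := eqVneq w q; first by rewrite /= ?orbT.
    by rewrite (clD z).
  - by move=> s' /(subsetP NSs) /set1P ->; rewrite eqxx orbT.
have q'q : q != q' by apply: contraNneq qD => ->.
have qZq' : q \in Z :\ q' by rewrite in_setD1 q'q.
have q'Z : q' \in Z := subsetP Q_sub _ q'Q.
have sZDq' : Z :\: D \subset Z :\ q'.
  apply/subsetP => z /setDP[zZ zD]; rewrite in_setD1 zZ andbT.
  by apply: contraNneq zD => ->.
have [sub|/subsetPn[x2 x2Z x2q]] := boolP (Z :\ q' \subset comp (Z :\ q') q).
  have cE : comp (Z :\ q') q = Z :\ q'.
    by apply/eqP; rewrite eqEsubset sub comp_sub.
  have le1' : #|NS S (Z :\ q')| <= 1 by rewrite -cE Q_comp.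
  have [s sZ sq'] := NS_sep le1'.
  exists s; last by apply: contra sq'; apply: (subsetP (NS_sub _ sZDq')).
  case/NSP: sZ => sS [z zZ ezs]; apply/NSP; split=> //; exists q' => //.
  have [<-//|zq'] := eqVneq z q'.
  by case/negP: sq'; apply/NSP; split=> //; exists z => //; rewrite !inE zq'.
pose D2 := comp (Z :\ q') x2.
have x2D2 : x2 \in D2 := mem_comp x2Z.
have qD2 : q \notin D2.
  apply: contra x2q => qD2.
  have: D2 \subset comp (Z :\ q') q.
    apply: (@sub_comp _ _ _ q) => //; [exact: conn_comp|exact: comp_sub|exact: mem_comp].
  by move/subsetP; apply.
have x2D : x2 \in D.
  apply/negPn/negP => x2D; move/negP: qD2; apply.
  have sub: Z :\: D \subset D2.
    apply: (@sub_comp _ _ _ x2) => //.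
    by rewrite in_setD x2D; case/setD1P: x2Z.
  by apply: (subsetP sub); rewrite in_setD qD.
have sD2D : D2 \subset D.
  apply: (@sub_comp _ _ _ x2) => //; first exact: conn_comp.
  apply/subsetP => z zD2; rewrite in_setD1; apply/andP; split.
    by apply: contraNneq qD2 => <-.
  by move/(subsetP (comp_sub _ _)): zD2 => /setD1P[].
have cD2 : #|D2| < n.
  apply: leq_trans Dn; apply: proper_card; apply/properP; split=> //.
  by exists q' => //; apply/negP => /(subsetP (comp_sub _ _)); rewrite !inE eqxx.
have [s sD2 sZD2] := IH q' x2 cD2 q'Q x2Z.
exists s; first by apply: (subsetP (NS_sub _ sD2D)).
by apply: contra sZD2; apply: (subsetP (NS_sub _ (setDS _ sD2D))).
Qed.

(** Either the component is all of [Z :\ a], and then [a] sees a vertex of [S] that the component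
    misses, or another component of [Z :\ a] has a private neighbour. *)
Lemma far_private a x : a \in Q -> x \in Z :\ a ->
  exists2 s, s \in NS S (Z :\: comp (Z :\ a) x) & s \notin NS S (comp (Z :\ a) x).
Proof.
move=> aQ xZ; set D := comp _ x; have aZ := subsetP Q_sub _ aQ.
have aD : a \notin D by apply/negP => /(subsetP (comp_sub _ _)); rewrite !inE eqxx.
have [sub|/subsetPn[y yZ yD]] := boolP (Z :\ a \subset D).
  have [s sZ sD] := NS_sep (Q_comp x aQ); exists s => //.
  case/NSP: sZ => sS [z zZ ezs]; apply/NSP; split=> //; exists z => //.
  rewrite in_setD zZ andbT; apply: contra sD => zD.
  by apply/NSP; split=> //; exists z.
have [s sD' sN] := comp_private aQ yZ.
have disj z : z \in comp (Z :\ a) y -> z \notin D.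
  move=> zy; apply: contra yD => zD; have: comp (Z :\ a) y \subset D.
    apply: (@sub_comp _ _ _ z) => //; [exact: conn_comp | exact: comp_sub].
  by move/subsetP; apply; apply: mem_comp.
exists s.
  apply: (subsetP (NS_sub _ _)) sD'; apply/subsetP => z zy.
  rewrite in_setD (disj _ zy).
  by move/(subsetP (comp_sub _ _)): zy => /setD1P[].
apply: contra sN; apply: (subsetP (NS_sub _ _)); apply/subsetP => z zD.
rewrite in_setD; apply/andP; split; first by apply: contraL zD => /disj.
by move/(subsetP (comp_sub _ _)): zD => /setD1P[].
Qed.

(** Take a component [D] of the non-contact vertices; inside [Z] it borders only contact vertices.
    If two of these exist, a third one or a neighbour of [D] in [S] contradicts the private
    neighbours of the far sides, so the two cut [D] off from [t]. If there is just one, it does so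
    together with the at most one neighbour of [D] in [S]. *)
Lemma Z_eq_Q : Z \subset Q.
Proof.
apply/subsetP => w wZ; apply/negPn/negP => wQ.
pose D := comp (Z :\: Q) w.
have wD : w \in D by apply: mem_comp; rewrite in_setD wQ.
have sDZQ : D \subset Z :\: Q := comp_sub _ _.
have DZ z : z \in D -> z \in Z by move/(subsetP sDZQ) => /setDP[].
have DQ z : z \in D -> z \notin Q by move/(subsetP sDZQ) => /setDP[].
have Dcl z v : z \in D -> e z v -> v \in Z -> v \notin Q -> v \in D.
  by move=> zD ezv vZ vQ; apply: (comp_closed zD _ ezv); rewrite in_setD vQ.
pose adj a := (a \in Q) && [exists z in D, e z a].
have [a aadj] : exists a, adj a.
  have [/existsP//|/existsPn no] := boolP [exists a, adj a].
  have [q qQ] := Q_neq0.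
  suff /subsetP/(_ q (subsetP Q_sub _ qQ))/DQ : Z \subset D by rewrite qQ.
  apply: (connE cZ wZ wD) => u v uD uZ vZ euv.
  apply: (Dcl u) => //; apply/negP => vQ; case/negP: (no v).
  by rewrite /adj vQ; apply/exists_inP; exists u.
have Qw b : b \in Q -> w \in Z :\ b.
  by move=> bQ; rewrite in_setD1 wZ andbT; apply: contraNneq wQ => ->.
pose D0 b := comp (Z :\ b) w.
have D0b b : b \in Q -> b \notin D0 b.
  by move=> _; apply/negP => /(subsetP (comp_sub _ _)); rewrite !inE eqxx.
have sDD0 b : b \in Q -> D \subset D0 b.
  move=> bQ; apply: (@sub_comp _ _ _ w) => //; first exact: conn_comp.
    apply/subsetP => z zD; rewrite in_setD1 (DZ z zD) andbT.
    by apply: contraTneq bQ => <-; apply: DQ.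
  exact: mem_comp (Qw b bQ).
have adjD0 b c : b \in Q -> adj c -> c != b -> c \in D0 b.
  move=> bQ /andP[cQ /exists_inP[z zD ezc]] cb.
  apply: (@comp_closed _ _ z) => //; first exact: (subsetP (sDD0 b bQ)).
  by rewrite in_setD1 cb (subsetP Q_sub).
(* Seen from [w], the parts of [Z] behind two different border vertices are disjoint, so the private
   neighbour of one part is seen by the component belonging to the other vertex, which sees at most
   one vertex of [S]. *)
have sF b c : adj b -> adj c -> b != c -> Z :\: D0 b \subset D0 c.
  move=> ab ac bc; have [/andP[bQ _] /andP[cQ _]] := (ab, ac).
  have bZ := subsetP Q_sub _ bQ.
  apply: (@sub_comp _ _ _ b).
  - by apply: (conn_setD_comp w cZ (conn1 b) _ (set11 b)); rewrite sub1set.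
  - apply/subsetP => z /setDP[zZ zD0]; rewrite in_setD1 zZ andbT.
    by apply: contraNneq zD0 => ->; apply: adjD0; rewrite // eq_sym.
  - by rewrite in_setD bZ D0b.
  - exact: adjD0.
have fp b : adj b -> exists s, s \in NS S (Z :\: D0 b) /\ s \notin NS S (D0 b).
  by case/andP=> bQ _; have [s ? ?] := far_private bQ (Qw b bQ); exists s.
have aQ : a \in Q by case/andP: aadj.
have nt b : b \in Q -> b != t.
  by move=> bQ; apply: contraNneq Zt => <-; apply: (subsetP Q_sub).
have nD b : b \in Q -> b \notin D by apply: contraL => /DQ.
have sDZ : D \subset Z by apply/subsetP.
have [/existsP[b /andP[badj ba]]|/existsPn no] := boolP [exists b, adj b && (b != a)].
  have bQ : b \in Q by case/andP: badj.
  have [sb [sbF sbD0]] := fp b badj.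
  have sba : sb \in NS S (D0 a) by apply: (subsetP (NS_sub _ (sF b a badj aadj ba))).
  apply: (@Z_separation D w a b) => //; rewrite ?nt ?nD //.
    move=> z c zD ezc cZ; have [//|/= cD] := boolP (c \in D).
    have cQ : c \in Q by apply: contraNT cD => cQ; apply: (Dcl z).
    have cadj : adj c by rewrite /adj cQ; apply/exists_inP; exists z.
    apply/negPn/negP; rewrite negb_or => /andP[ca cb].
    have [sc [scF scD0]] := fp c cadj.
    have sca : sc \in NS S (D0 a) by apply: (subsetP (NS_sub _ (sF c a cadj aadj ca))).
    have scb : sc \in NS S (D0 b) by apply: (subsetP (NS_sub _ (sF c b cadj badj cb))).
    by move: sbD0; rewrite (NS_uniq (Q_comp w aQ) sba sca) scb.
  move=> s sND; have sa := subsetP (NS_sub _ (sDD0 a aQ)) _ sND.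
  have sb' := subsetP (NS_sub _ (sDD0 b bQ)) _ sND.
  by move: sbD0; rewrite (NS_uniq (Q_comp w aQ) sba sa) sb'.
have onlya c : adj c -> c = a.
  by move=> cadj; apply/eqP; move: (no c); rewrite cadj /= negbK.
have clD z c : z \in D -> e z c -> c \in Z -> (c \in D) || (c == a).
  move=> zD ezc cZ; have [//|/= cD] := boolP (c \in D).
  have cQ : c \in Q by apply: contraNT cD => cQ; apply: (Dcl z).
  by apply/eqP/onlya; rewrite /adj cQ; apply/exists_inP; exists z.
have le1 : #|NS S D| <= 1.
  exact: leq_trans (subset_leq_card (NS_sub _ (sDD0 a aQ))) (Q_comp w aQ).
have [s [NSs sN]] := le1_sub1 le1.
have [N0|/sN sND] := eqVneq (NS S D) set0.
  apply: (@Z_separation D w a a) => //; rewrite ?nt ?nD //.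
    by move=> z c zD ezc cZ; rewrite orbA (clD z).
  by move=> s'; rewrite N0 inE.
have sS : s \in S by case/NSP: sND.
apply: (@Z_separation D w a s) => //; first exact: nD.
- by apply/negP => sD; move: (ZR (DZ _ sD)); rewrite sS.
- exact: nt.
- by apply: contraNneq tS => <-.
- by move=> z c zD ezc cZ; rewrite orbA (clD z).
- by move=> s' /(subsetP NSs) /set1P ->; rewrite eqxx orbT.
Qed.

(** The condition on the remaining vertices has disappeared: [Z] is minimal among connected sets
    with two neighbours in [S], and this forces the shape of a chain. *)
Lemma Z_minimal (Y : {set V}) : Y \subset Z -> conn Y -> 1 < #|NS S Y| -> Y = Z.
Proof.
move=> sYZ cY NY; apply/eqP; rewrite eqEsubset sYZ.
exact: subset_trans Z_eq_Q (Q_in sYZ cY NY).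
Qed.

Lemma chain_set (C : seq V) :
  {subset C <= Z} -> sorted e C -> 1 < #|NS S [set x in C]| -> [set x in C] = Z.
Proof.
move=> sCZ sC; apply: Z_minimal; last exact: conn_sorted.
by apply/subsetP => x; rewrite inE => /sCZ.
Qed.

Lemma NS_2 (Y : {set V}) x y a b :
  x \in Y -> y \in Y -> a \in S -> b \in S -> e x a -> e y b -> a != b -> 1 < #|NS S Y|.
Proof.
move=> xY yY aS bS exa eyb ab.
have := subset_leq_card (_ : [set a; b] \subset NS S Y); rewrite cards2 ab; apply.
apply/subsetP => s /set2P[]->; apply/NSP; split=> //; [by exists x|by exists y].
Qed.

Lemma chain_of_min : exists C, [/\ chain_ok S C, uniq C & [set x in C] = Z].
Proof.
have [[z zZ zN]|no] : (exists2 z, z \in Z & 1 < #|nS S z|) \/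
    (forall z, z \in Z -> #|nS S z| <= 1).
  have [/exists_inP|/exists_inPn no] := boolP [exists z in Z, 1 < #|nS S z|]; first by left.
  by right=> z /no; rewrite -leqNgt.
  have ZE : [set z] = Z.
    by apply: Z_minimal; rewrite ?sub1set ?NS1 //; apply: conn1.
  exists [:: z]; split=> //; last by rewrite set_seq1.
  left; exists z => //; rewrite zN /= -ltnS.
  (* A neighbour outside [S] exists since [~: S] is connected and contains [t != z]; with degree at
     most four this leaves at most three neighbours in [S]. *)
  have [w wR ezw] : exists2 w, w \in ~: S & e z w.
    have [/exists_inP//|/exists_inPn nw] := boolP [exists w in ~: S, e z w].
    have /subsetP/(_ t tR)/set1P zt : ~: S \subset [set z].
      by apply: (connE cR (subsetP ZsubR _ zZ) (set11 z)) => a b /set1P -> _ /nw /negP bn /bn.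
    by move: Zt; rewrite zt zZ.
  apply: leq_trans (e4 z); apply: proper_card; apply/properP; split.
    by apply/subsetP => s; rewrite !inE => /andP[].
  by exists w; rewrite !inE // negb_and -in_setC wR.
have [s sN [s' s'N ss']] : exists2 s, s \in NS S Z & exists2 s', s' \in NS S Z & s != s'.
  by have /card_gt1P[x [y [xN yN xy]]] := NSZ; exists x => //; exists y.
have /NSP[sS [z zZ ezs]] := sN; have /NSP[s'S [z' z'Z ezs']] := s'N.
have one x : x \in Z -> forall a b, a \in S -> b \in S -> e x a -> e x b -> a = b.
  move=> xZ a b aS bS exa exb; have /card_le1_eqP := no x xZ.
  by apply; rewrite inE ?aS ?bS.
have /connP/(_ z z' zZ z'Z)/connectP[p0 pp0 pl0] := cZ.
have [p [pp pu pl]] : exists p, [/\ path (rin Z) z p, uniq (z :: p) & z' = last z p].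
  by case/shortenP: pp0 pl0 => p pp up _ pl; exists p.
have [sp sub] := sorted_connect_path pp.
have subC : {subset z :: p <= Z} by move=> x /predU1P[->|/sub].
have lastC : last z p \in z :: p by apply: mem_last.
(* A path on vertices of the chosen one that still sees two vertices of [S] must use all its
   vertices. A chord, or an interior vertex with a neighbour in [S], would give such a path with a
   vertex missing. *)
have full D : {subset D <= z :: p} -> sorted e D -> 1 < #|NS S [set x in D]| ->
    {subset z :: p <= D}.
  move=> sD oD ND x xC.
  have DZ : [set y in D] = Z by apply: chain_set => // y /sD /subC.
  by have := subC x xC; rewrite -DZ inE.
exists (z :: p); split=> //; last first.
  apply: chain_set => //.
  by apply: (@NS_2 _ z z' s s') => //; rewrite inE ?mem_head // pl.
right; split=> //.
- case: (p) pl => [|//] /= z'z; case/negP: ss'.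
  by apply/eqP; apply: (one z) => //; rewrite -z'z.
- move=> q x r y u CE r0; apply/negP => exy.
  have [v vr] : exists v, v \in r by case: (r) r0 => // v ? _; exists v; rewrite mem_head.
  have subD : {subset q ++ x :: y :: u <= z :: p}.
    move=> w; rewrite CE !mem_cat !inE mem_cat inE.
    by case/or4P => ->; rewrite ?orbT.
  have uC := pu; rewrite CE in uC.
  have sD : sorted e (q ++ x :: y :: u).
    move: sp; rewrite CE; case: (q) => [|a q'] /=.
      by rewrite cat_path /= exy => /and3P[_ _ ->].
    by rewrite !cat_path /= cat_path /= exy => /and5P[-> -> _ _ ->].
  have zD : z \in q ++ x :: y :: u.
    move: CE; case: (q) => [|a q'] [-> _]; by rewrite /= mem_head.
  have z'D : z' \in q ++ x :: y :: u.
    rewrite pl -[last z p]/(last z (z :: p)) CE last_cat /= last_cat /=.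
    by rewrite mem_cat [_ \in x :: _]inE (mem_last y u) !orbT.
  have vD : v \in q ++ x :: y :: u.
    apply: full => //; last by rewrite CE mem_cat inE mem_cat vr !orbT.
    by apply: (@NS_2 _ z z' s s') => //; rewrite inE.
  have : uniq (r ++ (q ++ x :: y :: u)).
    have -> : q ++ x :: y :: u = (q ++ [:: x]) ++ y :: u by rewrite -catA.
    by rewrite uniq_catCA -catA.
  by rewrite cat_uniq => /and3P[_ /hasPn/(_ v vD)]; rewrite /= vr.
- move=> q x r CE q0 r0; apply/setP => a; rewrite !inE; apply/negP => /andP[aS exa].
  have xC : x \in z :: p by rewrite CE mem_cat mem_head orbT.
  have uC := pu; rewrite CE in uC.
  have zq : z \in q by move: CE q0; case: (q) => // b q' [-> _] _; rewrite mem_head.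
  have z'r : z' \in r.
    rewrite pl -[last z p]/(last z (z :: p)) CE last_cat /=.
    by case: (r) r0 => // b r' _; rewrite /= mem_last.
  move: uC; rewrite cat_uniq /= => /and3P[_ /norP[xq /hasPn hr] /andP[xr _]].
  have [as'|as'] := eqVneq a s'.
    have : z' \in q ++ [:: x].
      apply: full.
      + by move=> w; rewrite CE !mem_cat !inE => /orP[->|->]; rewrite ?orbT.
      + by move: sp; rewrite CE -cat1s catA; case: (q) => [|b q'] //=; rewrite cat_path => /andP[].
      + apply: (@NS_2 _ z x s a) => //; rewrite ?inE ?mem_cat ?zq ?inE ?eqxx ?orbT //.
        by rewrite as'.
      + by rewrite pl.
    rewrite mem_cat inE => /orP[z'q|/eqP z'x]; first by move: (hr z' z'r); rewrite z'q.
    by rewrite -z'x z'r in xr.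
  have : z \in x :: r.
    apply: full.
    + by move=> w; rewrite CE !mem_cat => ->; rewrite orbT.
    + by move: sp; rewrite CE; case: (q) => [|b q'] //=; rewrite cat_path /= => /and3P[].
    + by apply: (@NS_2 _ x z' a s') => //; rewrite ?inE ?eqxx ?z'r ?orbT.
    + exact: mem_head.
  rewrite inE => /orP[/eqP zx|zr]; first by rewrite -zx zq in xq.
  by move: (hr z zr); rewrite zq.
- move=> a D [<- <-]; exists s, s'; split=> //.
    apply/setP => b; rewrite !inE; apply/andP/eqP => [[bS ezb]|->] //.
    exact: (one z).
  rewrite -pl; apply/setP => b; rewrite !inE; apply/andP/eqP => [[bS ezb]|->] //.
  exact: (one z').
Qed.

End Step.

Lemma chain_step (S : {set V}) t :
  1 < #|S| -> t \notin S -> conn (~: S) -> ~: S != [set t] ->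
  exists C, [/\ chain_ok S C, uniq C, {subset C <= ~: S :\ t} & conn (~: (S :|: [set x in C]))].
Proof.
move=> S2 tS cR Rt.
have [Z Zmin] := ex_minset (good_ex S2 tS cR Rt).
have [C [okC uC CZ]] := chain_of_min tS cR Zmin.
have /and4P[sZ _ _ cRZ] := Zgood Zmin.
exists C; split=> //; last by rewrite CZ setCU -setDE.
by move=> x xC; apply: (subsetP sZ); rewrite -CZ inE.
Qed.

Fixpoint chain_order (t : V) (S : {set V}) (L : seq (seq V)) : Prop :=
  if L is C :: L' then
    [/\ chain_ok S C, uniq C, {subset C <= ~: S :\ t} &
        chain_order t (S :|: [set x in C]) L']
  else ~: S = [set t].

Lemma chain_order_ex (t : V) (S : {set V}) :
  1 < #|S| -> t \notin S -> conn (~: S) -> exists L, chain_order t S L.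
Proof.
have [n] := ubnP #|~: S|; elim: n S => // n IH S; rewrite ltnS => Sn S2 tS cR.
have [Rt|Rt] := eqVneq (~: S) [set t]; first by exists [::].
have [C [okC uC sC cC]] := chain_step S2 tS cR Rt.
have [x xC] : exists x, x \in C.
  by case: okC => [[v -> _]|[]]; [exists v; rewrite mem_head|case: (C) => // v ? _; exists v; rewrite mem_head].
have [||| |L HL] := IH (S :|: [set x in C]).
- apply: leq_trans Sn; apply: proper_card; apply/properP; split.
    by rewrite setCS subsetUl.
  by exists x; [have := sC x xC; rewrite !inE => /andP[]|rewrite !inE xC orbT].
- by apply: leq_trans S2 (subset_leq_card (subsetUl _ _)).
- by rewrite !inE negb_or tS; apply/negP => /sC; rewrite !inE eqxx.
- exact: cC.
by exists (C :: L).
Qed.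

End Connected.

(** * Partial drawings *)

Import Order.TTheory GRing.Theory Num.Theory.
Local Open Scope ring_scope.

(* An edge from (ix, iy) runs vertically to height ih, horizontally to column
   iX, vertically to height ik, horizontally to column jx and vertically to
   (jx, jy).  While [ifin] is false only the first two parts and the upward ray
   on column iX are meaningful. *)
Record item := Item {
  ix : int; iy : int; ih : int; iX : int;
  ifin : bool; ik : int; jx : int; jy : int }.

Definition finish i k x y := Item (ix i) (iy i) (ih i) (iX i) true k x y.
Definition pending x y h X := Item x y h X false 0 0 0.

Definition btw (a b x : int) := (a <= x <= b) || (b <= x <= a).

(* [onV] and [onH] are the points of the vertical and horizontal parts: bends
   belong to both, the end points of the edge to neither. *)
Definition onV (i : item) (x y : int) : bool :=
  [|| [&& x == ix i, ih i <= y & y < iy i],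
      [&& x == iX i, ih i <= y, ifin i ==> (y <= ik i),
          ~~ ((x == ix i) && (y == iy i)) & ifin i ==> ~~ ((x == jx i) && (y == jy i))]
    | [&& ifin i, x == jx i, jy i < y & y <= ik i]].

Definition onH (i : item) (x y : int) : bool :=
  [&& ((y == ih i) && btw (ix i) (iX i) x) || [&& ifin i, y == ik i & btw (iX i) (jx i) x],
      ~~ ((x == ix i) && (y == iy i)) & ifin i ==> ~~ ((x == jx i) && (y == jy i))].

Definition straight i :=
  [&& ih i == iy i, ik i == iy i, jy i == iy i, iX i == jx i & jx i != ix i].

(** A straight item is a chain edge inside one row. In the other case [ih i < iy i] means a start by
    a loop below the source, and [jy i < ik i] an entry from above, which only the fourth edge of
    the last vertex uses. *)
Definition shape i :=
  [&& ih i <= iy i, (ih i < iy i) ==> (iX i != ix i) &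
      ifin i ==> (straight i ||
        [&& iy i < jy i, jy i <= ik i & (jy i < ik i) ==> (iX i != jx i)])].

Definition upd (T : eqType) A (f : T -> option A) k a := fun k' => if k' == k then Some a else f k'.

Lemma updE (T : eqType) A (f : T -> option A) k a : upd f k a k = Some a.
Proof. by rewrite /upd eqxx. Qed.

Lemma updN (T : eqType) A (f : T -> option A) k a k' : k' != k -> upd f k a k' = f k'.
Proof. by rewrite /upd => /negPf ->. Qed.

Section Steps.
Variables (V : finType) (e : rel V).
Hypothesis esym : symmetric e.
Hypothesis eirr : irreflexive e.

Definition mates_apart (M : V -> V -> Prop) (ed : V * V -> option item) (prs : seq (int * int)) :=
  forall p k k' i i', p \in prs -> ed k = Some i -> ed k' = Some i' ->
    ~~ ifin i -> ~~ ifin i' -> iX i = p.1 -> iX i' = p.2 -> ~ M k.2 k'.2.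

Definition free_col (vp : V -> option (int * int)) (ed : V * V -> option item) (v : V) (c h : int) :=
  (forall k i y, ed k = Some i -> onV i c y -> y <= h) /\
  (forall w y, vp w = Some (c, y) -> w != v -> y <= h).

(* [S] is drawn, [v] is being drawn, [I] are its predecessors whose edges have
   reached it and [O] its successors whose edges have left it.  The top row is
   occupied within [lo, hi], except for the chain edge [xc] under way.
   [(c, h)] in [FL]: nothing meets column [c] above height [h].  On level [A]
   nothing reaches the columns [AF].  [prs] are the adjacent column pairs
   joined at level 0; nothing is ever inserted between them, so [M]-related
   targets, the two ends of a chain that needs new columns between its ends,
   must not be pending on the two columns of one pair. *)
Record layout (S : {set V}) (v : V) (I O : {set V}) (M : V -> V -> Prop)
  (vp : V -> option (int * int)) (ed : V * V -> option item)
  (top lo hi : int) (xc : option (V * V)) (FL : seq (int * int)) (A : int) (AF : seq int)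
  (prs : seq (int * int)) (cols rows : seq int) : Prop := Layout {
  disjV : forall k k' i i' x y, ed k = Some i -> ed k' = Some i' -> k != k' ->
         onV i x y -> ~~ onV i' x y;
  disjH : forall k k' i i' x y, ed k = Some i -> ed k' = Some i' -> k != k' ->
         onH i x y -> ~~ onH i' x y;
  vertex_off : forall w x y k i, vp w = Some (x, y) -> ed k = Some i -> w != k.1 -> w != k.2 ->
         ~~ onV i x y && ~~ onH i x y;
  place_inj : forall w w' p, vp w = Some p -> vp w' = Some p -> w = w';
  item_src : forall k i, ed k = Some i -> vp k.1 = Some (ix i, iy i) /\ shape i;
  item_tgt : forall k i, ed k = Some i -> ifin i -> vp k.2 = Some (jx i, jy i);
  item_low : forall k i, ed k = Some i -> iy i <= top /\ (ifin i ==> (ik i <= top));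
  place_height : forall w x y, vp w = Some (x, y) -> [&& 2 <= y, y <= top & y != A];
  level0 : forall k i x, ed k = Some i -> onH i x 0 -> exists2 p, p \in prs & p.1 <= x <= p.2;
  levelA : forall k i x f, ed k = Some i -> onH i x A -> f \in AF -> x < f;
  levelA_range : 2 < A <= top;
  free_ok : forall c, c \in FL -> free_col vp ed v c.1 c.2;
  free_uniq : uniq (map fst FL);
  row_items : forall k i x, ed k = Some i -> Some k != xc -> onH i x top -> lo <= x <= hi;
  row_vertices : forall w x, vp w = Some (x, top) -> lo <= x <= hi;
  src_grid : forall k i, ed k = Some i -> [&& ix i \in cols, iX i \in cols, iy i \in rows & ih i \in rows];
  tgt_grid : forall k i, ed k = Some i -> ifin i -> [&& jx i \in cols, jy i \in rows & ik i \in rows];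
  free_grid : forall c, c \in FL -> c.1 \in cols;
  pair_grid : forall p, p \in prs -> (p.1 \in cols) && (p.2 \in cols);
  place_grid : forall w x y, vp w = Some (x, y) -> (x \in cols) && (y \in rows);
  level_grid : (top \in rows) && (0 \in rows) && (A \in rows);
  pair_lt : forall p, p \in prs -> p.1 < p.2;
  pair_adj : forall p c, p \in prs -> c \in cols -> (c <= p.1) || (p.2 <= c);
  pair_disj : forall p q, p \in prs -> q \in prs -> p != q -> (p.2 < q.1) || (q.2 < p.1);
  mates_split : mates_apart M ed prs;
  item_status : forall u w i, ed (u, w) = Some i -> e u w /\
         ((u \in S /\ ifin i = ((w \in S) || ((w == v) && (u \in I)))) \/
          [/\ u = v, w \in O & ~~ ifin i]);
  cut_drawn : forall u w, u \in S -> w \notin S -> e u w -> ed (u, w) <> None;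
  inner_drawn : forall u w, u \in S -> w \in S -> e u w -> ed (u, w) <> None \/ ed (w, u) <> None;
  item_dir : forall u w i, ed (u, w) = Some i -> ed (w, u) = None;
  placed_in : forall w p, vp w = Some p -> w \in S \/ w = v;
  in_placed : forall w, w \in S -> vp w <> None;
  outs_new : forall w, w \in O -> w \notin S /\ ed (v, w) <> None;
  cur_new : v \notin S;
  ins_sub : I \subset S }.

(** * Changing a single edge of a partial drawing *)

Section WithInv.
Variables (S : {set V}) (v : V) (I O : {set V}) (M : V -> V -> Prop).
Variables (vp : V -> option (int * int)) (ed : V * V -> option item).
Variables (top lo hi : int) (xc : option (V * V)) (FL : seq (int * int)) (A : int) (AF : seq int).
Variables (prs : seq (int * int)) (cols rows : seq int).

(** All drawing moves on edges are instances of this one check of the invariant. The last hypothesis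
    lists its two uses: finishing an edge that arrives at the current vertex, or starting an edge
    that leaves it. *)
Lemma set_item u w i S' v' I' O' lo' hi' xc' FL' AF' prs' :
  layout S v I O M vp ed top lo hi xc FL A AF prs cols rows ->
  (forall k' i' x y, k' != (u, w) -> ed k' = Some i' -> onV i x y -> ~~ onV i' x y) ->
  (forall k' i' x y, k' != (u, w) -> ed k' = Some i' -> onH i x y -> ~~ onH i' x y) ->
  (forall z x y, vp z = Some (x, y) -> z != u -> z != w -> ~~ onV i x y && ~~ onH i x y) ->
  vp u = Some (ix i, iy i) -> shape i -> (ifin i -> vp w = Some (jx i, jy i)) ->
  iy i <= top -> (ifin i ==> (ik i <= top)) ->
  (forall x, onH i x 0 -> exists2 p, p \in prs' & p.1 <= x <= p.2) ->
  {subset AF' <= AF} -> (forall x f, onH i x A -> f \in AF' -> x < f) ->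
  (forall c, c \in FL' -> c.1 \in cols /\
     [/\ (forall k i y, k != (u, w) -> ed k = Some i -> onV i c.1 y -> y <= c.2),
         (forall y, onV i c.1 y -> y <= c.2) &
         (forall w y, vp w = Some (c.1, y) -> w != v -> y <= c.2)]) ->
  uniq (map fst FL') ->
  (forall k i x, k != (u, w) -> ed k = Some i -> Some k != xc' -> onH i x top -> lo' <= x <= hi') ->
  (forall x, Some (u, w) != xc' -> onH i x top -> lo' <= x <= hi') ->
  (forall w x, vp w = Some (x, top) -> lo' <= x <= hi') ->
  [&& ix i \in cols, iX i \in cols, iy i \in rows & ih i \in rows] ->
  (ifin i -> [&& jx i \in cols, jy i \in rows & ik i \in rows]) ->
  (prs' = prs \/ exists p, [/\ prs' = p :: prs, p.1 \in cols, p.2 \in cols, p.1 < p.2 &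
      (forall c, c \in cols -> (c <= p.1) || (p.2 <= c)) /\
      (forall q, q \in prs -> (p.2 < q.1) || (q.2 < p.1)) /\
      (forall k' i', ed k' = Some i' -> ~~ ifin i' -> k' != (u, w) -> iX i' != p.1 /\ iX i' != p.2) /\
      (iX i != p.1 \/ iX i != p.2)]) ->
  (ifin i \/ forall p k' i', p \in prs -> ed k' = Some i' -> ~~ ifin i' -> k' != (u, w) ->
     (iX i = p.1 -> iX i' = p.2 -> ~ M w k'.2) /\
     (iX i = p.2 -> iX i' = p.1 -> ~ M k'.2 w)) ->
  (S' = S /\ v' = v) ->
  e u w ->
  ((u \in S /\ [/\ w = v, ifin i, I' = u |: I, O' = O & ed (u, w) <> None]) \/
   [/\ u = v, w \notin S, ~~ ifin i, I' = I & O' = w |: O]) ->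
  layout S' v' I' O' M vp (upd ed (u, w) i) top lo' hi' xc' FL' A AF' prs' cols rows.
Proof.
move=> H Hv Hh Hz Hu Hs Hw H6 H6' H0 HAF HA HFL HFLu Hr1 Hr1' Hr2 Hc1 Hc2 Hp Hm [-> ->] Euw Hst.
have old k i0 : upd ed (u, w) i k = Some i0 -> (k = (u, w) /\ i0 = i) \/ (k != (u, w) /\ ed k = Some i0).
  by rewrite /upd; case: eqP => [-> [->]|/eqP]; [left|right].
have Hp' p : p \in prs' -> p \in prs \/ prs' = p :: prs.
  by case: Hp => [->|[q [-> _ _ _ _]]]; [left|rewrite inE => /orP[/eqP->|]; [right|left]].
case: (H) => N1 N2 N3 N4 N5 N5' N6 N7 L0 LA LB FLL FLU R1 R2 C1 C2 C3 C4 C5 C6 P1 P2 P3 M1 S1 S2 S3 S4 S5 S6 S7 S8 S9.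
split=> //.
- move=> k k' i1 i2 x y /old[[-> ->]|[kn ek]] /old[[-> ->]|[kn' ek']]; rewrite ?eqxx // => kk'.
  + by move=> oi; exact: Hv _ _ _ _ kn' ek' oi.
  + by move=> oi; apply/negP => oi'; have := Hv _ _ _ _ kn ek oi'; rewrite oi.
  + exact: N1 kk'.
- move=> k k' i1 i2 x y /old[[-> ->]|[kn ek]] /old[[-> ->]|[kn' ek']]; rewrite ?eqxx // => kk'.
  + by move=> oi; exact: Hh _ _ _ _ kn' ek' oi.
  + by move=> oi; apply/negP => oi'; have := Hh _ _ _ _ kn ek oi'; rewrite oi.
  + exact: N2 kk'.
- move=> z x y k i1 vz /old[[-> ->]|[kn ek]] /=; first exact: Hz.
  exact: N3 vz ek.
- by move=> k i1 /old[[-> ->]|[kn ek]] //; apply: N5 ek.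
- by move=> k i1 /old[[-> ->]|[kn ek]] //; apply: N5' ek.
- by move=> k i1 /old[[kE ->]|[kn ek]] //; apply: N6 ek.
- move=> k i1 x /old[[kE ->]|[kn ek]] oh; first exact: H0.
  have [p pp px] := L0 _ _ _ ek oh; exists p => //.
  by case: Hp => [->|[q [-> _ _ _ _]]] //; rewrite inE pp orbT.
- by move=> k i1 x f /old[[kE ->]|[kn ek]] oh fA; [apply: HA|apply: LA ek oh _; apply: HAF].
- move=> c /HFL[_ [a b d]]; split=> // k i1 y /old[[kE ->]|[kn ek]]; first exact: b.
  exact: a kn ek.
- by move=> k i1 x /old[[-> ->]|[kn ek]]; [apply: Hr1'|apply: Hr1 ek].
- by move=> k i1 /old[[kE ->]|[kn ek]] //; apply: C1 ek.
- by move=> k i1 /old[[kE ->]|[kn ek]] //; apply: C2 ek.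
- by move=> c /HFL[].
- by case: Hp => [->|[q [-> q1 q2 _ _]]] // p; rewrite inE => /orP[/eqP->|/C4//]; rewrite q1.
- by case: Hp => [->|[q [-> q1 q2 q3 _]]] // p; rewrite inE => /orP[/eqP->|/P1//].
- case: Hp => [->|[q [-> q1 q2 q3 [q4 _]]]] // p c; rewrite inE => /orP[/eqP-> cc|]; last exact: P2.
  exact: q4.
- case: Hp => [->|[q [-> q1 q2 q3 [_ [q5 _]]]]] // p p'.
  rewrite !inE => /orP[/eqP->|pp] /orP[/eqP->|pp']; rewrite ?eqxx // => pne.
  + exact: q5.
  + by rewrite orbC; apply: q5.
  + exact: P3.
- move=> p k k' i1 i2 pp E1 E2 f1 f2 X1 X2.
  have kk' : k != k'.
    apply/eqP => kE; move: E1; rewrite kE E2 => -[iE]; move: X1; rewrite -iE X2 => p21.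
    case: (Hp' p pp) => [/P1|pE]; first by rewrite p21 ltxx.
    case: Hp => [|[q [qE _ _ q3 _]]]; first by rewrite pE => /(congr1 size) /= /eqP; rewrite eqn_leq ltnn.
    by move: qE q3; rewrite pE => -[<-]; rewrite p21 ltxx.
  case: Hp => [pE|[q [pE q1 q2 q3 [q4 [q5 [q6 q7]]]]]].
    rewrite pE in pp; move: E1 E2 => /old[[kE iE]|[kn ek]] /old[[kE' iE']|[kn' ek']].
    + by rewrite kE kE' eqxx in kk'.
    + subst k i1; case: Hm => [fi|Hm]; first by rewrite fi in f1.
      by have [Ha _] := Hm p k' i2 pp ek' f2 kn'; apply: Ha.
    + subst k' i2; case: Hm => [fi|Hm]; first by rewrite fi in f2.
      by have [_ Ha] := Hm p k i1 pp ek f1 kn; apply: Ha.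
    + exact: M1 pp ek ek' f1 f2 X1 X2.
  rewrite pE inE in pp; move: E1 E2 => /old[[kE iE]|[kn ek]] /old[[kE' iE']|[kn' ek']].
  + by rewrite kE kE' eqxx in kk'.
  + subst k i1; case: Hm => [fi|Hm]; first by rewrite fi in f1.
    case/orP: pp => [/eqP pq|pp].
      by have [] := q6 _ _ ek' f2 kn'; rewrite X2 pq eqxx.
    by have [Ha _] := Hm p k' i2 pp ek' f2 kn'; apply: Ha.
  + subst k' i2; case: Hm => [fi|Hm]; first by rewrite fi in f2.
    case/orP: pp => [/eqP pq|pp].
      by have [] := q6 _ _ ek f1 kn; rewrite X1 pq eqxx.
    by have [_ Ha] := Hm p k i1 pp ek f1 kn; apply: Ha.
  + case/orP: pp => [/eqP pq|pp].
      by have [] := q6 _ _ ek f1 kn; rewrite X1 pq eqxx.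
    exact: M1 pp ek ek' f1 f2 X1 X2.
- move=> u' w' i1 /old[[[-> ->] ->]|[kn ek]].
    split=> //; case: Hst => [[uS [wv fi IE OE en]]|[uv wS fi IE OE]]; subst I' O'.
      by left; rewrite fi wv eqxx !inE eqxx orbT.
    by right; rewrite uv !inE eqxx.
  have [euw' st] := S1 _ _ _ ek; split=> //.
  case: st => [[uS' fE]|[uv' wO fi']].
    left; split=> //; rewrite fE; case: Hst => [[uS [wv fi IE OE en]]|[uv wS fi IE OE]]; subst I' O' => //.
    have [wE|//] := eqVneq w' v; rewrite !inE; have [uE|//] := eqVneq u' u.
    by move: kn; rewrite wE uE wv eqxx.
  right; split=> //; case: Hst => [[uS [wv fi IE OE en]]|[uv wS fi IE OE]]; subst I' O' => //.
  by rewrite inE wO orbT.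
- move=> u' w' uS wS euw'; rewrite /upd; case: eqP => // _; exact: S2.
- move=> u' w' uS wS euw'; rewrite /upd; case: eqP => [_|_]; first by left.
  case: eqP => [_|_]; first by right.
  exact: S3.
- have rev : ed (w, u) = None.
    case: Hst => [[uS [wv fi _ _ en]]|[uv wS _ _ _]].
      by case E : (ed (u, w)) en => [j|//] _; apply: S4 E.
    case E : (ed (w, u)) => [j|//]; have [_ [[wS' _]|[wv _ _]]] := S1 _ _ _ E.
      by rewrite wS' in wS.
    by move: Euw; rewrite uv wv eirr.
  move=> u' w' i1 /old[[[-> ->] _]|[kn ek]].
    rewrite updN //; apply/eqP => -[uw _]; by rewrite uw eirr in Euw.
  rewrite updN; first exact: S4 ek.
  by apply/eqP => -[wE uE]; move: ek; rewrite wE uE rev.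
- move=> z zO; case: Hst => [[uS [wv fi IE OE en]]|[uv wS fi IE OE]]; subst I' O'.
    have [zS ez] := S7 z zO; split=> //; rewrite /upd; by case: eqP.
  move: zO; rewrite !inE => /orP[/eqP ->|/S7[zS ez]].
    by rewrite uv updE.
  by split=> //; rewrite /upd; case: eqP.
- by case: Hst => [[uS [wv fi IE OE en]]|[uv wS fi IE OE]]; subst I' O' => //; rewrite subUset S9 sub1set uS.
Qed.

End WithInv.

End Steps.

Ltac unfold_items := unfold onV, onH, shape, straight, btw, finish, pending in *;
  cbn [ix iy ih iX ifin ik jx jy fst snd] in *.
Ltac split_pairs := repeat match goal with
  | c : prod _ _ |- _ => destruct c
  end.
Ltac item_lia := clear; intros; split_pairs; unfold_items; lia.

Section Steps.
Variables (V : finType) (e : rel V).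
Hypothesis esym : symmetric e.
Hypothesis eirr : irreflexive e.

Section StepInstances.
Variables (S : {set V}) (v : V) (I O : {set V}) (M : V -> V -> Prop).
Variables (vp : V -> option (int * int)) (ed : V * V -> option item).
Variables (top lo hi : int) (xc : option (V * V)) (FL : seq (int * int)) (A : int) (AF : seq int).
Variables (prs : seq (int * int)) (cols rows : seq int).
Hypothesis H : layout e S v I O M vp ed top lo hi xc FL A AF prs cols rows.

Lemma pend_src u i : ed (u, v) = Some i -> e u v /\ u \in S.
Proof.
move=> E; have [euv [[uS _]|[uv _ _]]] := item_status H E; split=> //.
by move: euv; rewrite uv eirr.
Qed.

Lemma pend_FL k i h : ed k = Some i -> ~~ ifin i -> (iX i, h) \in FL -> False.
Proof.
move=> E fi /(free_ok H) [/(_ k i _ E) /= Hc _].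
(* The ray of a pending edge is unbounded, so it meets every height that is large enough, in
   particular one above [h]. *)
have [y /and3P[y1 y2 y3]] : exists y, [&& iy i < y, h < y & ih i <= y].
  by exists (`|iy i| + `|h| + `|ih i| + 1); lia.
by have /Hc : onV i (iX i) y; move: fi y1 y2 y3; item_lia.
Qed.

Lemma fin_free_col k i : ed k = Some i -> ~~ ifin i -> iy i < top ->
  forall k' i' y, k' != k -> ed k' = Some i' -> onV i' (iX i) y -> y < top.
Proof.
move=> E fi it k' i' y kk' E' oi; rewrite ltNge; apply/negP => ty.
have := disjV H E' E kk' oi.
have [_ /and3P[sh _ _]] := item_src H E.
by move: fi it ty sh; item_lia.
Qed.

Lemma FL_cons (c : int) (FL' : seq (int * int)) :
  uniq (map fst FL') -> (forall h, (c, h) \notin FL') ->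
  (c \notin map fst FL') && uniq (map fst FL').
Proof.
move=> u n; rewrite u andbT; apply/mapP => -[[c' h'] cFL /= cE].
by move/negP: (n h'); apply; rewrite cE.
Qed.

(** The ray is cut off at the vertex it runs into. No other item could use its column from this row
    on, so the column becomes free above [top]. *)
Lemma fin_D u i : ed (u, v) = Some i -> ~~ ifin i -> iy i < top -> vp v = Some (iX i, top) ->
  layout e S v (u |: I) O M vp (upd ed (u, v) (finish i top (iX i) top)) top lo hi xc
      ((iX i, top) :: FL) A AF prs cols rows.
Proof.
move=> E fi it Hv; have [euv uS] := pend_src E.
have [Hu sh] := item_src H E; have [it' _] := item_low H E.
have /and4P[cx cX cy ch] := src_grid H E.
have At := levelA_range H.
apply: (set_item eirr H) => //=.
- move=> k' i' x y kk' E' oi; apply: (disjV H E E'); first by rewrite eq_sym.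
  by move: oi fi; item_lia.
- move=> k' i' x y kk' E' oi; apply: (disjH H E E'); first by rewrite eq_sym.
  by move: oi fi it sh; item_lia.
- move=> z x y Hz zu zv; have := vertex_off H Hz E zu zv.
  by move: fi it sh; item_lia.
- by move: sh fi it; item_lia.
- move=> x oi; apply: (level0 H E); by move: oi fi it sh At; item_lia.
- move=> x f oi; apply: (levelA H E); by move: oi fi it sh At; item_lia.
- move=> c; rewrite inE => /orP[/eqP -> /=|cFL]; last first.
    have [a b] := free_ok H cFL; split; first exact: (free_grid H cFL).
    split=> // [k i0 y _ E0|y oi]; first exact: (a k).
    by apply: (a _ _ y E); move: oi fi it; item_lia.
  split=> //; split.
  + by move=> k i0 y kn E0 oi; have := fin_free_col E fi it kn E0 oi; apply: ltW.
  + by move=> y; move: it; item_lia.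
  + by move=> w y /(place_height H); item_lia.
- apply: FL_cons; first exact: (free_uniq H).
  by move=> h; apply/negP; apply: pend_FL E fi.
- move=> k i0 x _; exact: (row_items H).
- by move=> x _; move: fi it sh; item_lia.
- exact: (row_vertices H).
- by rewrite cx cX cy ch.
- by move=> _; rewrite cX; have /andP[/andP[-> _] _] := level_grid H.
- by left.
- by left.
- by left; split=> //; split=> //; rewrite E.
Qed.

(** The ray turns at the current row and runs along it to [v]; the stretch up to [v] must avoid the
    occupied interval. Its column is released above this row. *)
Lemma fin_side u i c lo' hi' : ed (u, v) = Some i -> ~~ ifin i -> iy i < top ->
  vp v = Some (c, top) -> iX i != c -> xc = None ->
  (forall x, btw (iX i) c x -> x != c -> ~~ (lo <= x <= hi)) ->
  lo' <= lo -> lo' <= iX i -> hi <= hi' -> iX i <= hi' ->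
  layout e S v (u |: I) O M vp (upd ed (u, v) (finish i top c top)) top lo' hi' None
      ((iX i, top) :: FL) A AF prs cols rows.
Proof.
move=> E fi it Hv Xc xc0 Hrow lo1 lo2 hi1 hi2; have [euv uS] := pend_src E.
have [Hu sh] := item_src H E; have [it' _] := item_low H E.
have /and4P[cx cX cy ch] := src_grid H E.
have At := levelA_range H.
have clh := row_vertices H Hv; have /and3P[_ _ tA] := place_height H Hv.
have /andP[ccol _] := place_grid H Hv.
have row x y : onH (finish i top c top) x y -> onH i x y \/ (y = top /\ ~~ (lo <= x <= hi)).
  move=> oi; have := Hrow x; move: oi fi it sh; unfold_items => oi fi it sh Hr.
  have [yt|yt] := eqVneq y top; last by left; move: oi fi it sh yt; item_lia.
  by right; split=> //; apply: Hr; move: oi fi it sh yt; item_lia.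
apply: (set_item eirr H) => //=.
- move=> k' i' x y kk' E' oi; apply: (disjV H E E'); first by rewrite eq_sym.
  by move: oi fi; item_lia.
- move=> k' i' x y kk' E' /row [oi|[-> oi]].
    by apply: (disjH H E E') oi; rewrite eq_sym.
  by apply: contra oi; apply: (row_items H E'); rewrite xc0.
- move=> z x y Hz zu zv; have Hz3 := vertex_off H Hz E zu zv.
  have r2z := row_vertices H; apply/andP; split; first by move: Hz3 fi it; item_lia.
  apply/negP => /row [oi|[yt]]; first by move: Hz3; rewrite oi andbF.
  by rewrite yt in Hz; rewrite (r2z _ _ Hz).
- by move: sh fi it Xc; item_lia.
- move=> x oi; apply: (level0 H E); by move: oi fi it sh At; item_lia.
- move=> x f oi; apply: (levelA H E); by move: oi fi it sh At tA; item_lia.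
- move=> d; rewrite inE => /orP[/eqP -> /=|cFL]; last first.
    have [a b] := free_ok H cFL; split; first exact: (free_grid H cFL).
    split=> // [k i0 y _ E0|y oi]; first exact: (a k).
    by apply: (a _ _ y E); move: oi fi it; item_lia.
  split=> //; split.
  + by move=> k i0 y kn E0 oi; have := fin_free_col E fi it kn E0 oi; apply: ltW.
  + by move=> y; move: it; item_lia.
  + by move=> w y /(place_height H); item_lia.
- apply: FL_cons; first exact: (free_uniq H).
  by move=> h; apply/negP; apply: pend_FL E fi.
- move=> k i0 x kk E0 _ oi; have := row_items H E0 _ oi; rewrite xc0 => /(_ isT).
  by move: lo1 hi1; item_lia.
- by move=> x _; move: fi it sh lo1 lo2 hi1 hi2 clh; item_lia.
- by move=> w x /(row_vertices H); move: lo1 hi1; item_lia.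
- by rewrite cx cX cy ch.
- by move=> _; rewrite ccol; have /andP[/andP[-> _] _] := level_grid H.
- by left.
- by left.
- by left; split=> //; split=> //; rewrite E.
Qed.

Definition mate_ok (w : V) (c : int) :=
  forall p k' i', p \in prs -> ed k' = Some i' -> ~~ ifin i' ->
     (c = p.1 -> iX i' = p.2 -> ~ M w k'.2) /\ (c = p.2 -> iX i' = p.1 -> ~ M k'.2 w).

Definition dropc (c : int) (L : seq (int * int)) := [seq p <- L | p.1 != c].

Lemma dropc_uniq c L : uniq (map fst L) -> uniq (map fst (dropc c L)).
Proof. by apply: subseq_uniq; apply: map_subseq; apply: filter_subseq. Qed.

Lemma dropcP c L p : p \in dropc c L -> p.1 != c /\ p \in L.
Proof. by rewrite mem_filter => /andP. Qed.

Lemma add_up w c h : vp v = Some (c, top) -> (c, h) \in FL -> h <= top ->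
  e v w -> w \notin S -> mate_ok w c ->
  layout e S v I (w |: O) M vp (upd ed (v, w) (pending c top top c)) top lo hi xc
      (dropc c FL) A AF prs cols rows.
Proof.
move=> Hv cFL ht evw wS Hm.
have At := levelA_range H; have [fV fvp] := free_ok H cFL.
have /andP[ccol crow] := place_grid H Hv.
apply: (set_item eirr H) => //=.
- move=> k' i' x y kk' E' oi; apply/negP => oi'.
  have xE : x = c by move: oi; item_lia.
  by rewrite xE in oi'; have := fV _ _ _ E' oi'; move: oi ht; item_lia.
- by move=> k' i' x y kk' E'; item_lia.
- by move=> z x y /(place_height H) + _ _; item_lia.
- by item_lia.
- by move=> x; item_lia.
- by move=> x f; move: At; item_lia.
- move=> d /dropcP[dc dFL]; have [a b] := free_ok H dFL; split; first exact: (free_grid H dFL).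
  split=> // [k i0 y _ E0|y]; first exact: (a k).
  by move: dc; item_lia.
- exact: dropc_uniq (free_uniq H).
- by move=> k i0 x _; apply: (row_items H).
- by move=> x _; item_lia.
- exact: (row_vertices H).
- by rewrite ccol crow.
- by left.
- by right=> p k' i' pp E' fi _; apply: Hm E' fi.
- by right; split.
Qed.

(** The new edge either enlarges the occupied interval of the row or is recorded in [xc']. In the
    second case it is a chain edge, exempt from the interval because the next vertex is going to be
    placed on it. *)
Lemma add_side w c f h lo' hi' xc' : vp v = Some (c, top) -> (f, h) \in FL -> h < top -> f != c ->
  (forall x, btw c f x -> x != c -> ~~ (lo <= x <= hi)) -> xc = None ->
  lo' <= lo -> hi <= hi' -> (xc' = None /\ lo' <= f <= hi') \/ xc' = Some (v, w) ->
  e v w -> w \notin S -> mate_ok w f ->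
  layout e S v I (w |: O) M vp (upd ed (v, w) (pending c top top f)) top lo' hi' xc'
      (dropc f FL) A AF prs cols rows.
Proof.
move=> Hv cFL ht fc Hrow xc0 lo1 hi1 Hxc evw wS Hm.
have At := levelA_range H; have [fV fvp] := free_ok H cFL.
have /andP[ccol crow] := place_grid H Hv; have fcol := free_grid H cFL.
have clh := row_vertices H Hv; have /and3P[_ _ tA] := place_height H Hv.
have wv : w != v by apply: contraTneq evw => ->; rewrite eirr.
have row x y : onH (pending c top top f) x y -> y = top /\ ~~ (lo <= x <= hi).
  move=> oi; have yt : y = top by move: oi; item_lia.
  by split=> //; apply: Hrow; move: oi; item_lia.
apply: (set_item eirr H) => //=.
- move=> k' i' x y kk' E' oi; apply/negP => oi'.
  have xE : x = f by move: oi fc; item_lia.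
  by rewrite xE in oi'; have := fV _ _ _ E' oi'; move: oi ht fc; item_lia.
- move=> k' i' x y kk' E' /row [-> oi].
  by apply: contra oi; apply: (row_items H E'); rewrite xc0.
- move=> z x y Hz zu zv; apply/andP; split; last first.
    apply/negP => /row [yt]; rewrite yt in Hz; by rewrite (row_vertices H Hz).
  apply/negP => oi; have xE : x = f by move: oi fc; item_lia.
  by rewrite xE in Hz; have := fvp _ _ Hz zu; move: oi ht; item_lia.
- by move: fc; item_lia.
- by move=> x; move: At; item_lia.
- by move=> x g; move: At tA; item_lia.
- move=> d /dropcP[dc dFL]; have [a b] := free_ok H dFL; split; first exact: (free_grid H dFL).
  split=> // [k i0 y _ E0|y]; first exact: (a k).
  by move: dc; item_lia.
- exact: dropc_uniq (free_uniq H).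
- move=> k i0 x kk E0 _ oi; have := row_items H E0 _ oi; rewrite xc0 => /(_ isT).
  by move: lo1 hi1; item_lia.
- move=> x Hx; case: Hxc => [[_ Hf]|xcE]; last by rewrite xcE eqxx in Hx.
  by move: Hf lo1 hi1 clh; item_lia.
- by move=> z x /(row_vertices H); move: lo1 hi1; item_lia.
- by rewrite ccol fcol crow.
- by left.
- by right=> p k' i' pp E' fi _; apply: Hm E' fi.
- by right; split.
Qed.

(** The edge leaves downwards on the column of [v], crosses to [f] at level [l] and rises there, so
    both columns must be free from below [l]. The level is -2 for the first two vertices, 0 for the
    pairs of chains and [A] for pool columns. The upper half of column [c] remains available for an
    edge going up. *)
Lemma add_down w c f h1 h2 l prs' AF' : vp v = Some (c, top) ->
  (c, h1) \in FL -> (f, h2) \in FL -> h1 < l -> h2 < l -> l < top -> f != c -> l \in rows ->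
  (forall k i x, ed k = Some i -> onH i x l -> ~~ btw c f x) ->
  (forall w x, vp w = Some (x, l) -> ~~ btw c f x) ->
  (l = 0 -> prs' = (c, f) :: prs /\ c < f) ->
  (prs' = prs \/ [/\ prs' = (c, f) :: prs, c < f,
      (forall d, d \in cols -> (d <= c) || (f <= d)) &
      (forall q, q \in prs -> (f < q.1) || (q.2 < c))]) ->
  {subset AF' <= AF} -> (l = A -> c < f /\ forall g, g \in AF' -> f < g) ->
  e v w -> w \notin S -> mate_ok w f ->
  layout e S v I (w |: O) M vp (upd ed (v, w) (pending c top l f)) top lo hi xc
      ((c, top) :: dropc c (dropc f FL)) A AF' prs' cols rows.
Proof.
move=> Hv cFL fFL h1l h2l lt fc lrow HH HV H0 Hprs sAF HA evw wS Hm.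
have At := levelA_range H; have [fV fvp] := free_ok H cFL; have [fV' fvp'] := free_ok H fFL.
have /andP[ccol crow] := place_grid H Hv; have fcol := free_grid H fFL.
have wv : w != v by apply: contraTneq evw => ->; rewrite eirr.
have ff k i d h : (d, h) \in FL -> ed k = Some i -> ~~ ifin i -> iX i != d.
  move=> dFL E fi; apply/eqP => XE; apply: (@pend_FL k i h) => //; by rewrite XE.
apply: (set_item eirr H) => //=.
- move=> k' i' x y kk' E' oi; apply/negP => oi'.
  have [xE|xE] : x = c \/ x = f by move: oi; item_lia.
    by rewrite xE in oi'; have := fV _ _ _ E' oi'; move: oi h1l lt xE fc; item_lia.
  by rewrite xE in oi'; have := fV' _ _ _ E' oi'; move: oi h2l lt xE fc; item_lia.
- move=> k' i' x y kk' E' oi; apply/negP => oi'.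
  have yE : y = l by move: oi; item_lia.
  by rewrite yE in oi'; have := HH _ _ _ E' oi'; move: oi; item_lia.
- move=> z x y Hz zu zv; apply/andP; split; apply/negP => oi.
    have [xE|xE] : x = c \/ x = f by move: oi; item_lia.
      rewrite xE in Hz; have := fvp _ _ Hz zu; move: oi h1l xE fc; item_lia.
    rewrite xE in Hz; have := fvp' _ _ Hz zu; move: oi h2l xE fc; item_lia.
  have yE : y = l by move: oi; item_lia.
  by rewrite yE in Hz; have := HV _ _ Hz; move: oi; item_lia.
- by move: fc lt; item_lia.
- move=> x oi; have l00 : l = 0 by move: oi; item_lia.
  have [-> cf] := H0 l00; exists (c, f); first exact: mem_head.
  by move: oi cf; item_lia.
- move=> x g oi gA; have lA0 : l = A by move: oi; item_lia.
  have [cf /(_ g gA)] := HA lA0; by move: oi cf; item_lia.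
- move=> d; rewrite inE => /orP[/eqP -> /=|].
    split=> //; split.
    + by move=> k i0 y _ E0 oi; have := fV _ _ _ E0 oi; move: h1l lt; item_lia.
    + by move=> y; move: fc lt; item_lia.
    + by move=> z y /(place_height H); item_lia.
  move=> /dropcP[dc /dropcP[df dFL]]; have [a b] := free_ok H dFL; split; first exact: (free_grid H dFL).
  split=> // [k i0 y _ E0|y]; first exact: (a k).
  by move: dc df; item_lia.
- apply: FL_cons; first by do 2!apply: dropc_uniq; exact: (free_uniq H).
  by move=> h'; apply/negP => /dropcP[]; rewrite eqxx.
- by move=> k i0 x _; apply: (row_items H).
- by move=> x _; move: lt; item_lia.
- exact: (row_vertices H).
- by rewrite ccol fcol crow.
- case: Hprs => [->|[-> cf Hc Hq]]; first by left.
  right; exists (c, f); split=> //; split=> //; split=> //; split.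
    move=> k' i' E' fi _; split; [exact: ff cFL E' fi|exact: ff fFL E' fi].
  by left.
- by right=> p k' i' pp E' fi _; apply: Hm E' fi.
- by right; split.
Qed.

(** The chain edge had been extended to column [r] as if it ended in a ray there; once [v] sits on
    it, everything beyond [v] is erased. The erased ray shows that nothing else meets [r] at height
    [top] or above, hence the bound [top - 1], which allows [r] to be used again in the same row. *)
Lemma cut a xa r c : xc = Some (a, v) -> ed (a, v) = Some (pending xa top top r) ->
  vp v = Some (c, top) -> xa < c -> c < r ->
  layout e S v (a |: I) O M vp (upd ed (a, v) (Item xa top top c true top c top)) top lo hi None
      ((r, top - 1) :: FL) A AF prs cols rows.
Proof.
move=> xcE E Hv xac cr; have [eav aS] := pend_src E.
have [Ha _] := item_src H E; rewrite /= in Ha.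
have /and4P[cx cX cy ch] := src_grid H E.
have At := levelA_range H; have clh := row_vertices H Hv; have alh := row_vertices H Ha.
have /andP[ccol crow] := place_grid H Hv.
have fi : ~~ ifin (pending xa top top r) by [].
have onr y : top <= y -> onV (pending xa top top r) r y by move: xac cr; item_lia.
have sub x y : onH (Item xa top top c true top c top) x y -> onH (pending xa top top r) x y.
  by move: xac cr; item_lia.
apply: (set_item eirr H) => //=.
- by move=> k' i' x y kk' E'; move: xac; item_lia.
- by move=> k' i' x y kk' E' /sub; apply: (disjH H E E'); rewrite eq_sym.
- move=> z x y Hz zu zv; have /andP[_ Hz3] := vertex_off H Hz E zu zv.
  apply/andP; split; first by move: xac; item_lia.
  by apply: contra Hz3; apply: sub.
- by move: xac; item_lia.
- by move=> x /sub; apply: (level0 H E).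
- by move=> x f /sub; apply: (levelA H E).
- move=> d; rewrite inE => /orP[/eqP -> /=|dFL]; last first.
    have [f b] := free_ok H dFL; split; first exact: (free_grid H dFL).
    split=> // [k i0 y _ E0|y]; first exact: (f k).
    by move: xac; item_lia.
  split=> //; split.
  + move=> k i0 y kn E0 oi; have [|ty] := ltP y top; first by item_lia.
    by have := disjV H E E0 _ (onr y ty); rewrite oi eq_sym => /(_ kn).
  + by move=> y; move: xac cr; item_lia.
  + move=> z y Hz zv; have := place_height H Hz => /and3P[_ yt _].
    have yne : y != top.
      apply/eqP => yE; rewrite yE in Hz.
      have [zaE|za] := eqVneq z a.
        by move: Hz; rewrite zaE Ha => -[re]; move: xac cr re; item_lia.
      by have := vertex_off H Hz E za zv; rewrite (onr top (lexx _)).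
    by move: yt yne; item_lia.
- apply: FL_cons; first exact: (free_uniq H).
  by move=> h; apply/negP; apply: (@pend_FL _ _ _ E).
- move=> k i0 x kk E0 _; apply: (row_items H E0); rewrite xcE.
  by apply: contraNneq kk => -[->].
- by move=> x _; move: xac clh alh; item_lia.
- exact: (row_vertices H).
- by rewrite cx ccol cy.
- by move=> _; rewrite ccol cy.
- by left.
- by left.
- by left; split=> //; split=> //; rewrite E.
Qed.

End StepInstances.
End Steps.

Section More.
Variables (V : finType) (e : rel V).
Hypothesis esym : symmetric e.
Hypothesis eirr : irreflexive e.

Section MoreSteps.
Variables (S : {set V}) (v : V) (I O : {set V}) (M : V -> V -> Prop).
Variables (vp : V -> option (int * int)) (ed : V * V -> option item).
Variables (top lo hi : int) (xc : option (V * V)) (FL : seq (int * int)) (A : int) (AF : seq int).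
Variables (prs : seq (int * int)) (cols rows : seq int).
Hypothesis H : layout e S v I O M vp ed top lo hi xc FL A AF prs cols rows.

Lemma place c lo' hi' : vp v = None ->
  (forall k i, ed k = Some i -> v != k.1 -> v != k.2 -> ~~ onV i c top) ->
  ~~ (lo <= c <= hi) -> (xc = None \/ exists a, xc = Some (a, v)) ->
  c \in cols -> top != A -> (lo <= hi -> lo' <= lo /\ hi <= hi') -> lo' <= c <= hi' ->
  layout e S v I O M (upd vp v (c, top)) ed top lo' hi' xc FL A AF prs cols rows.
Proof.
move=> Hv HV Hc Hxc ccol tA Hlo Hc'; have At := levelA_range H.
have old w p : upd vp v (c, top) w = Some p -> (w = v /\ p = (c, top)) \/ (w != v /\ vp w = Some p).
  by rewrite /upd; case: eqP => [-> E|/eqP]; [left; case: E|right].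
have keep w p : vp w = Some p -> upd vp v (c, top) w = Some p.
  by move=> E; rewrite updN //; apply/eqP => wv; rewrite wv Hv in E.
have inr (x : int) : lo <= x <= hi -> lo' <= x <= hi'.
  move=> xlh; have /Hlo[] : lo <= hi by move: xlh; item_lia.
  by move: xlh; item_lia.
case: (H) => N1 N2 N3 N4 N5 N5' N6 N7 L0 LA LB FLL FLU R1 R2 C1 C2 C3 C4 C5 C6 P1 P2 P3 M1 S1 S2 S3 S4 S5 S6 S7 S8 S9.
split=> //.
- move=> w x y k i /old[[-> [-> ->]]|[wv Hw]]; last exact: N3.
  move=> E k1 k2; rewrite (HV k i) //=; apply/negP => oi.
  have kx : Some k != xc.
    case: Hxc => [->|[a ->]] //; apply: contraNneq k2 => -[->] /=; exact: eqxx.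
  by have := R1 _ _ _ E kx oi; rewrite (negPf Hc).
- move=> w w' p /old[[-> ->]|[wv Hw]] /old[[-> pE]|[wv' Hw']] //.
  + by move: Hw' => /R2; rewrite (negPf Hc).
  + by move: Hw; rewrite pE => /R2; rewrite (negPf Hc).
  + exact: N4 Hw Hw'.
- by move=> k i E; have [a b] := N5 _ _ E; split=> //; apply: keep.
- by move=> k i E fi; apply: keep; apply: N5'.
- move=> w x y /old[[_ [_ ->]]|[wv /N7//]]; rewrite tA; by move: At; item_lia.
- by move=> d /FLL[a b]; split=> // w y /old[[-> _]|[wv Hw]]; [rewrite eqxx|apply: b].
- by move=> k i x E kx oi; apply: inr; exact: (R1 _ _ _ E kx oi).
- by move=> w x /old[[_ [->]]|[wv /R2 /inr]].
- by move=> w x y /old[[_ [-> ->]]|[wv /C5//]]; rewrite ccol; case/andP: C6 => /andP[->].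
- by move=> w p /old[[-> _]|[wv /S5//]]; right.
- by move=> w /S6; rewrite /upd; case: eqP.
Qed.

Lemma place_free c h lo' hi' : vp v = None -> (c, h) \in FL -> h < top ->
  ~~ (lo <= c <= hi) -> (xc = None \/ exists a, xc = Some (a, v)) ->
  top != A -> (lo <= hi -> lo' <= lo /\ hi <= hi') -> lo' <= c <= hi' ->
  layout e S v I O M (upd vp v (c, top)) ed top lo' hi' xc FL A AF prs cols rows.
Proof.
move=> Hv cFL ht Hc Hxc tA Hlo Hc'; apply: place => //; last exact: (free_grid H cFL).
move=> k i E _ _; apply/negP => oi; have [/(_ k i top E oi) /= + _] := free_ok H cFL.
by move: ht; clear; lia.
Qed.

Lemma place_pend u i lo' hi' : vp v = None -> ed (u, v) = Some i -> ~~ ifin i -> iy i < top ->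
  ~~ (lo <= iX i <= hi) -> (xc = None \/ exists a, xc = Some (a, v)) ->
  top != A -> (lo <= hi -> lo' <= lo /\ hi <= hi') -> lo' <= iX i <= hi' ->
  layout e S v I O M (upd vp v (iX i, top)) ed top lo' hi' xc FL A AF prs cols rows.
Proof.
move=> Hv E fi it Hc Hxc tA Hlo Hc'; apply: place => //; last by have /and4P[] := src_grid H E.
move=> k i' E' k1 k2; apply: (disjV H E E'); first by apply: contraNneq k2 => <-.
have [_ sh] := item_src H E.
by move: it fi sh; item_lia.
Qed.

Lemma newrow lo' hi' xc' :
  layout e S v I O M vp ed (top + 2) lo' hi' xc' FL A AF prs cols (top + 2 :: rows).
Proof.
case: (H) => N1 N2 N3 N4 N5 N5' N6 N7 L0 LA LB FLL FLU R1 R2 C1 C2 C3 C4 C5 C6 P1 P2 P3 M1 S1 S2 S3 S4 S5 S6 S7 S8 S9.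
split=> //.
- by move=> k i /N6; item_lia.
- by move=> w x y /N7; item_lia.
- by move: LB; item_lia.
- move=> k i x E _ oi; have [_ sh] := N5 _ _ E; have := N6 _ _ E.
  by move: oi sh; item_lia.
- by move=> w x /N7; item_lia.
- by move=> k i /C1 /and4P[-> -> a b]; rewrite !inE a b !orbT.
- by move=> k i /C2 Hc /Hc /and3P[-> a b]; rewrite !inE a b !orbT.
- by move=> w x y /C5 /andP[-> a]; rewrite inE a orbT.
- by case/andP: C6 => /andP[_ a] b; rewrite !inE eqxx a b !orbT.
Qed.

(** Height -3 lies below every level in use, the lowest being -2, so a fresh column is free for
    every kind of edge, loops included. *)
Lemma addcol c : c \notin cols -> (forall p, p \in prs -> (c <= p.1) || (p.2 <= c)) ->
  layout e S v I O M vp ed top lo hi xc ((c, -3) :: FL) A AF prs (c :: cols) rows.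
Proof.
move=> cc Hp.
case: (H) => N1 N2 N3 N4 N5 N5' N6 N7 L0 LA LB FLL FLU R1 R2 C1 C2 C3 C4 C5 C6 P1 P2 P3 M1 S1 S2 S3 S4 S5 S6 S7 S8 S9.
split=> //.
- move=> d; rewrite inE => /orP[/eqP->|/FLL//]; split=> /=.
    move=> k i y E oi; case/negP: cc.
    have /and4P[a b _ _] := C1 _ _ E.
    have [->|[->|[fi ->]]] : c = ix i \/ c = iX i \/ (ifin i /\ c = jx i) by move: oi; item_lia.
    - by [].
    - by [].
    by have /and3P[] := C2 _ _ E fi.
  by move=> w y /C5; rewrite (negPf cc).
- by apply: FL_cons => // h; apply/negP => /C3; rewrite (negPf cc).
- by move=> k i /C1 /and4P[a b -> ->]; rewrite !inE a b !orbT.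
- by move=> k i /C2 Hc /Hc /and3P[a -> ->]; rewrite !inE a !orbT.
- by move=> d; rewrite !inE => /orP[/eqP->|/C3 ->]; rewrite ?eqxx ?orbT.
- by move=> p /C4 /andP[a b]; rewrite !inE a b !orbT.
- by move=> w x y /C5 /andP[a ->]; rewrite !inE a !orbT.
- by move=> p d pp; rewrite inE => /orP[/eqP->|]; [apply: Hp|apply: P2].
Qed.

(** An empty row is turned into the auxiliary level. Nothing lies on it yet, so any list of columns
    satisfies the condition on [AF']. *)
Lemma setA AF' : hi < lo -> xc = None -> 2 < top ->
  layout e S v I O M vp ed top lo hi xc FL top AF' prs cols rows.
Proof.
move=> lh xc0 t2.
case: (H) => N1 N2 N3 N4 N5 N5' N6 N7 L0 LA LB FLL FLU R1 R2 C1 C2 C3 C4 C5 C6 P1 P2 P3 M1 S1 S2 S3 S4 S5 S6 S7 S8 S9.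
split=> //.
- move=> w x y Hw; have /and3P[-> -> _] := N7 _ _ _ Hw; apply: contraTneq lh => yt.
  by rewrite yt in Hw; have := R2 _ _ Hw; clear; lia.
- move=> k i x f E oi; have := R1 _ _ _ E; rewrite xc0 => /(_ x isT oi).
  by move: lh; clear; lia.
- by rewrite t2 /=.
- by case/andP: C6 => /andP[-> ->] _.
Qed.

Lemma weaken FL' AF' (M' : V -> V -> Prop) : {subset FL' <= FL} -> uniq (map fst FL') ->
  {subset AF' <= AF} ->
  (forall k k' i i', ed k = Some i -> ed k' = Some i' -> ~~ ifin i -> ~~ ifin i' ->
     M' k.2 k'.2 -> M k.2 k'.2) ->
  layout e S v I O M' vp ed top lo hi xc FL' A AF' prs cols rows.
Proof.
move=> sF uF sA sM.
case: (H) => N1 N2 N3 N4 N5 N5' N6 N7 L0 LA LB FLL FLU R1 R2 C1 C2 C3 C4 C5 C6 P1 P2 P3 M1 S1 S2 S3 S4 S5 S6 S7 S8 S9.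
split=> //.
- by move=> k i x f E oi /sA; exact: (LA _ _ _ _ E oi).
- by move=> c /sF /FLL.
- by move=> c /sF /C3.
- move=> p k k' i i' pp E E' f f' X X' m; apply: (M1 p k k' i i') => //.
  exact: sM E E' f f' m.
Qed.

(** All edges at [v] are accounted for, so [v] joins [S] and loses its exemption in [free_col]; the
    last hypothesis supplies the bound that must now hold for [v] itself. *)
Lemma close v' : v' \notin S -> v' != v -> vp v' = None -> vp v <> None ->
  (forall u, u \in S -> e u v -> u \in I) ->
  (forall w, e v w -> w \notin S -> w \in O) ->
  (forall c y, c \in FL -> vp v = Some (c.1, y) -> y <= c.2) ->
  layout e (v |: S) v' set0 set0 M vp ed top lo hi xc FL A AF prs cols rows.
Proof.
move=> v'S v'v Hv' Hv HI HO HF.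
case: (H) => N1 N2 N3 N4 N5 N5' N6 N7 L0 LA LB FLL FLU R1 R2 C1 C2 C3 C4 C5 C6 P1 P2 P3 M1 S1 S2 S3 S4 S5 S6 S7 S8 S9.
split=> //.
- move=> d dFL; have [a b] := FLL _ dFL; split=> // w y Hw _.
  have [wv|wv] := eqVneq w v; last exact: b Hw wv.
  by apply: HF dFL _; rewrite -wv.
- move=> u w i E; have [euw [[uS fE]|[uv wO fi]]] := S1 _ _ _ E; split=> //; left.
    rewrite !inE uS orbT andbF orbF fE; split=> //.
    have [wv|wv] := eqVneq w v; last by rewrite orbF.
    by rewrite wv (negPf S8) /= HI // -wv.
  have [wS _] := S7 _ wO; rewrite uv in E *; rewrite !inE eqxx andbF orbF (negPf wS) orbF; split=> //.
  have -> : w == v = false by apply/eqP => wv; rewrite wv in E; have [] := S1 _ _ _ E; rewrite eirr.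
  exact: negbTE.
- move=> u w; rewrite !inE negb_or => /orP[/eqP ->|uS] /andP[wv wS] euw.
    by have /S7[] := HO _ euw wS.
  exact: S2.
- move=> u w; rewrite !inE => /orP[/eqP ->|uS] /orP[/eqP ->|wS] euw.
  + by rewrite eirr in euw.
  + by right; apply: S2 => //; rewrite esym.
  + by left; apply: S2.
  + exact: S3.
- by move=> w p /S5[wS|->]; left; rewrite !inE ?wS ?eqxx ?orbT.
- by move=> w; rewrite !inE => /orP[/eqP->|/S6].
- by move=> w; rewrite inE.
- by rewrite !inE negb_or v'v.
- exact: sub0set.
Qed.

(** As long as nothing has been drawn for it, the current vertex is only a name. Between two steps
    the last vertex [t] holds this place. *)
Lemma inv_cur v' : I = set0 -> O = set0 -> vp v = None -> v' \notin S ->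
  layout e S v' set0 set0 M vp ed top lo hi xc FL A AF prs cols rows /\ vp v' = None.
Proof.
move=> IE OE Hv v'S; have H' := H; rewrite IE OE in H'.
case: (H') => N1 N2 N3 N4 N5 N5' N6 N7 L0 LA LB FLL FLU R1 R2 C1 C2 C3 C4 C5 C6 P1 P2 P3 M1 S1 S2 S3 S4 S5 S6 S7 S8 S9.
have Hv' : vp v' = None.
  case E : (vp v') => [p|//]; case: (S5 _ _ E) => [|vv]; first by rewrite (negPf v'S).
  by rewrite vv Hv in E.
split=> //; split=> //.
- move=> d dFL; have [a b] := FLL _ dFL; split=> // w y Hw _.
  by apply: (b w y Hw); apply: contraPneq Hw => ->; rewrite Hv.
- move=> u w i E; have [euw [[uS fE]|[uv wO fi]]] := S1 _ _ _ E; split=> //; left.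
    by split=> //; rewrite fE !inE !andbF.
  by rewrite inE in wO.
- by move=> w p E; case: (S5 _ _ E) => [|wv]; [left|rewrite wv Hv in E].
- by move=> w; rewrite inE.
Qed.

Lemma pending_edge u : u \in S -> e u v -> u \notin I ->
  exists i, [/\ ed (u, v) = Some i, ~~ ifin i & iy i <= top].
Proof.
move=> uS euv uI; have := cut_drawn H uS (cur_new H) euv; case E : (ed (u, v)) => [i|//] _.
exists i; split=> //; last by have [] := item_low H E.
have [_ [[_ ->]|[uv _ _]]] := item_status H E; first by rewrite (negPf (cur_new H)) eqxx.
by move: euv; rewrite uv eirr.
Qed.

Lemma pend_notin_FL k i h : ed k = Some i -> ~~ ifin i -> (iX i, h) \notin FL.
Proof. by move=> E fi; apply/negP; apply: (pend_FL H E fi). Qed.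

End MoreSteps.

(** * Assigning targets to columns *)

Section Mates.
Variables (S : {set V}) (v : V) (I O : {set V}) (M : V -> V -> Prop).
Variables (vp : V -> option (int * int)) (ed : V * V -> option item).
Variables (top lo hi : int) (xc : option (V * V)) (FL : seq (int * int)) (A : int) (AF : seq int).
Variables (prs : seq (int * int)) (cols rows : seq int).
Hypothesis H : layout e S v I O M vp ed top lo hi xc FL A AF prs cols rows.
Hypothesis Msym : forall a b, M a b -> M b a.
Hypothesis Mfun : forall a b c, M a b -> M a c -> b = c.
Hypothesis Mone : forall a b, M a b -> exists s, nS e S a \subset [set s].
Hypothesis Mv : forall w w', e v w -> e v w' -> ~ M w w'.

Lemma pend_inj k k' i i' : ed k = Some i -> ed k' = Some i' -> ~~ ifin i -> ~~ ifin i' ->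
  iX i = iX i' -> k = k'.
Proof.
move=> E E' f f' XE; apply/eqP/negPn/negP => kk.
have [y /and3P[y1 y2 /andP[y3 y4]]] : exists y, [&& iy i < y, iy i' < y, ih i <= y & ih i' <= y].
  by exists (`|iy i| + `|iy i'| + `|ih i| + `|ih i'| + 1); lia.
have oi : onV i (iX i) y by move: f y1 y3; item_lia.
by have := disjV H E E' kk oi; rewrite XE; move: f' y2 y4; item_lia.
Qed.

Lemma pair_inj p q c : p \in prs -> q \in prs ->
  (c = p.1 \/ c = p.2) -> (c = q.1 \/ c = q.2) -> p = q.
Proof.
move=> pp qq cp cq; apply/eqP/negPn/negP => pq.
have := pair_disj H pp qq pq; have := pair_lt H pp; have := pair_lt H qq.
by move: cp cq; item_lia.
Qed.

Let bad (w : V) (c : int) := exists p k i, [/\ p \in prs, ed k = Some i, ~~ ifin i, M w k.2 &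
  (c = p.1 /\ iX i = p.2) \/ (c = p.2 /\ iX i = p.1)].

Lemma not_bad w c : ~ bad w c -> mate_ok M ed prs w c.
Proof.
move=> nb p k i pp E fi; split=> cp Xp m; apply: nb; exists p, k, i; split=> //.
- by left.
- exact: Msym.
- by right.
Qed.

(** A column has one partner, the partner carries one pending edge, and the target of that edge has
    one mate. *)
Lemma bad_col w w' c : bad w c -> bad w' c -> w = w'.
Proof.
move=> [p [k [i [pp E fi m cp]]]] [p' [k' [i' [pp' E' fi' m' cp']]]].
have pE : p = p'.
  by apply: (@pair_inj p p' c) => //; [case: cp=> -[]; [left|right] | case: cp'=> -[]; [left|right]].
have kE : k = k'.
  apply: (pend_inj E E' fi fi'); have := pair_lt H pp; rewrite -pE in cp'.
  by move: cp cp'; item_lia.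
by apply: (@Mfun k.2); apply: Msym; rewrite // kE.
Qed.

(** The mate of [w] has a single drawn predecessor, hence a single pending edge; [Mv] ensures that
    this edge does not start at [v] itself. The only bad column is the partner of its column. *)
Lemma bad_tgt w c c' : e v w -> bad w c -> bad w c' -> c = c'.
Proof.
move=> evw [p [k [i [pp E fi m cp]]]] [p' [k' [i' [pp' E' fi' m' cp']]]].
have zE := Mfun m m'; have [s sE] := Mone (Msym m).
have srcS : forall k0 i0, ed k0 = Some i0 -> M w k0.2 -> k0.1 \in nS e S k0.2.
  move=> [a b] i0 E0 /= m0; have [eab [[aS _]|[av _ _]]] := item_status H E0.
    by rewrite inE aS esym.
  by case: (Mv evw _ m0); rewrite -av.
have /(subsetP sE)/set1P k2 := srcS k i E m.
have := srcS k' i' E' m'; rewrite -zE => /(subsetP sE)/set1P k1.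
have kE : k = k'.
  by rewrite (surjective_pairing k) (surjective_pairing k') k2 k1 zE.
have iE : i = i' by move: E; rewrite kE E' => -[].
have pE : p = p'.
  by apply: (@pair_inj p p' (iX i)) => //; [case: cp=> -[_]; [right|left] | rewrite iE; case: cp'=> -[_]; [right|left]].
by have := pair_lt H pp; subst p' i'; move: cp cp'; item_lia.
Qed.

(** The bad combinations form a partial matching between targets and columns. If one of them spoils
    the straight assignment, the crossed assignment contains none. *)
Lemma choose2 w1 w2 a1 a2 : e v w1 -> e v w2 -> w1 != w2 -> a1 != a2 ->
  (mate_ok M ed prs w1 a1 /\ mate_ok M ed prs w2 a2) \/
  (mate_ok M ed prs w2 a1 /\ mate_ok M ed prs w1 a2).
Proof.
move=> e1 e2 /eqP w12 /eqP c12.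
have [b11|/not_bad g11] := classic (bad w1 a1).
  right; split; apply: not_bad => b; first by apply: w12; apply: bad_col b11 b.
  by apply: c12; apply: bad_tgt e1 b11 b.
have [b22|/not_bad g22] := classic (bad w2 a2); last by left.
right; split; apply: not_bad => b; first by apply: c12; apply: bad_tgt e2 b b22.
by apply: w12; apply: bad_col b b22.
Qed.

Lemma choose_col w a1 a2 : e v w -> a1 != a2 -> mate_ok M ed prs w a1 \/ mate_ok M ed prs w a2.
Proof.
move=> ew /eqP c12; have [b1|/not_bad g1] := classic (bad w a1); last by left.
by right; apply: not_bad => b; apply: c12; apply: bad_tgt ew b1 b.
Qed.

End Mates.

Lemma mate_ok_add (M : V -> V -> Prop) ed prs v w w' i c : mate_ok M ed prs w c ->
  ~ M w w' -> ~ M w' w -> mate_ok M (upd ed (v, w') i) prs w c.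
Proof.
move=> ok m m' p k i' pp; rewrite /upd; case: eqP => [-> [_] _|_]; first by split.
exact: ok.
Qed.

Lemma mate_ok_fin (M : V -> V -> Prop) ed prs k0 w i c : mate_ok M ed prs w c -> ifin i ->
  mate_ok M (upd ed k0 i) prs w c.
Proof.
move=> ok fi p k i' pp; rewrite /upd; case: eqP => [_ [<-]|_]; first by rewrite fi.
exact: ok.
Qed.

End More.

Section Ops.
Variables (V : finType) (e : rel V).
Hypothesis esym : symmetric e.
Hypothesis eirr : irreflexive e.
Hypothesis e4 : max_degree_le e 4.

Definition outs (S : {set V}) (v : V) := [set w | e v w & w \notin S].

Lemma card_deg (S : {set V}) v : (#|nS e S v| + #|outs S v| <= 4)%N.
Proof.
apply: leq_trans (e4 v); rewrite -[X in (_ <= X)%N](cardsID S [set w | e v w]).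
apply: leq_add; apply: subset_leq_card; apply/subsetP => w; rewrite !inE.
  by move=> /andP[-> ->].
by rewrite andbC.
Qed.

(* Each drawn vertex inserts at most two columns into a gap, so a gap of
   [2 * 4 ^ k] suffices for the next [k] vertices. *)
Definition spaced (cols : seq int) (g : int) :=
  forall c c', c \in cols -> c' \in cols -> c < c' -> c + g <= c'.

(** Columns in [AF] can still be entered along the auxiliary level, being free from below it.
    Columns in [G] joined the pool later and may be blocked there; they become usable when the next
    auxiliary level is opened above them. *)
Definition pool (AF G : seq int) (FL : seq (int * int)) (A top : int) :=
  [/\ uniq (AF ++ G),
      forall f, f \in AF -> exists2 h, h < A & (f, h) \in FL &
      forall f, f \in G -> exists2 h, h <= top & (f, h) \in FL].

Lemma pool_uncons AF G FL A top p : pool AF G FL A top -> pool AF G (p :: FL) A top.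
Proof.
case=> u a b; split=> // f; [move=> /a[h hA hF]|move=> /b[h hA hF]]; exists h => //;
by rewrite inE hF orbT.
Qed.

Lemma pool_dropc AF G FL A top c : c \notin AF ++ G -> pool AF G FL A top ->
  pool AF G (dropc c FL) A top.
Proof.
rewrite mem_cat negb_or => /andP[cA cG] [u a b]; split=> // f fA.
  have [h hA hF] := a f fA; exists h => //; rewrite mem_filter hF andbT /=.
  by apply: contraNneq cA => <-.
have [h hA hF] := b f fA; exists h => //; rewrite mem_filter hF andbT /=.
by apply: contraNneq cG => <-.
Qed.

Lemma pool_top AF G FL A top top' : pool AF G FL A top -> top <= top' -> pool AF G FL A top'.
Proof.
case=> u a b tt; split=> // f /b[h ht hF]; exists h => //; exact: le_trans tt.
Qed.

Section AtVertex.
Variables (S : {set V}) (v : V) (M : V -> V -> Prop).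
Variables (vp : V -> option (int * int)) (ed : V * V -> option item).
Variables (top lo hi : int) (FL : seq (int * int)) (A : int) (AF : seq int).
Variables (prs : seq (int * int)) (cols rows : seq int).
Hypothesis H : layout e S v set0 set0 M vp ed top lo hi None FL A AF prs cols rows.
Hypothesis Hv : vp v = None.

Definition pcol (u : V) := if ed (u, v) is Some i then iX i else 0.

Lemma pends : exists us : seq V, [/\ uniq us, us =i nS e S v, size us = #|nS e S v|,
  sorted <%O (map pcol us) &
  forall u, u \in us -> exists i, [/\ ed (u, v) = Some i, ~~ ifin i, iy i <= top & pcol u = iX i]].
Proof.
have pe u : u \in nS e S v -> exists i, [/\ ed (u, v) = Some i, ~~ ifin i, iy i <= top & pcol u = iX i].
  rewrite inE esym => /andP[uS euv].
  have [|i [E fi it]] := pending_edge eirr H uS euv; first by rewrite inE.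
  by exists i; split=> //; rewrite /pcol E.
exists (sort (relpre pcol <=%O) (enum (nS e S v))); split.
- by rewrite sort_uniq enum_uniq.
- by move=> u; rewrite mem_sort mem_enum.
- by rewrite size_sort cardE.
- rewrite -sort_map sort_lt_sorted map_inj_in_uniq ?enum_uniq // => a b.
  rewrite !mem_enum => /pe[i [E fi _ ->]] /pe[i' [E' fi' _ ->]] XE.
  by case: (pend_inj H E E' fi fi' XE).
- by move=> u; rewrite mem_sort mem_enum; exact: pe.
Qed.

Lemma topA : A < top + 2.
Proof. by have := levelA_range H; clear; lia. Qed.

Lemma start_one u i : ed (u, v) = Some i -> ~~ ifin i -> iy i <= top ->
  layout e S v (u |: set0) set0 M (upd vp v (iX i, top + 2))
    (upd ed (u, v) (finish i (top + 2) (iX i) (top + 2))) (top + 2) (iX i) (iX i) None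
    ((iX i, top + 2) :: FL) A AF prs cols (top + 2 :: rows).
Proof.
move=> E fi it; have tA := topA.
have H1 := newrow H 1 0 None.
have it2 : iy i < top + 2 by move: it; clear; lia.
have H2 : layout e S v set0 set0 M (upd vp v (iX i, top + 2)) ed (top + 2) (iX i) (iX i) None FL A AF
    prs cols (top + 2 :: rows).
  apply: (place_pend H1 Hv E fi it2) => //; try by left.
  - by clear; lia.
  - by move: tA; clear; lia.
  - by clear; lia.
exact: (fin_D eirr H2 E fi it2 (updE _ _ _)).
Qed.

Lemma start_two u1 u2 i1 i2 lo' hi' : u1 != u2 ->
  ed (u1, v) = Some i1 -> ~~ ifin i1 -> iy i1 <= top ->
  ed (u2, v) = Some i2 -> ~~ ifin i2 -> iy i2 <= top ->
  lo' <= iX i1 -> lo' <= iX i2 -> iX i1 <= hi' -> iX i2 <= hi' ->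
  layout e S v (u2 |: (u1 |: set0)) set0 M (upd vp v (iX i1, top + 2))
    (upd (upd ed (u1, v) (finish i1 (top + 2) (iX i1) (top + 2))) (u2, v)
       (finish i2 (top + 2) (iX i1) (top + 2))) (top + 2) lo' hi' None
    ((iX i2, top + 2) :: (iX i1, top + 2) :: FL) A AF prs cols (top + 2 :: rows).
Proof.
move=> u12 E1 f1 t1 E2 f2 t2 a1 a2 a3 a4.
have H1 := start_one E1 f1 t1.
have X12 : iX i2 != iX i1.
  by apply: contraNneq u12 => XE; case: (pend_inj H E2 E1 f2 f1 XE) => ->.
apply: (fin_side eirr H1 _ f2) => //; rewrite ?updE ?updN //.
- by apply: contraNneq u12 => -[->].
- by move: t2; clear; lia.
- by move=> x; move: X12; item_lia.
Qed.

(** The vertex takes the middle column, so that the outer two edges enter from opposite sides; only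
    the top side is left for an outgoing edge. *)
Lemma start_three u1 u2 u3 i1 i2 i3 : uniq [:: u1; u2; u3] ->
  ed (u1, v) = Some i1 -> ~~ ifin i1 -> iy i1 <= top ->
  ed (u2, v) = Some i2 -> ~~ ifin i2 -> iy i2 <= top ->
  ed (u3, v) = Some i3 -> ~~ ifin i3 -> iy i3 <= top ->
  iX i1 < iX i2 -> iX i2 < iX i3 ->
  layout e S v (u3 |: (u1 |: (u2 |: set0))) set0 M (upd vp v (iX i2, top + 2))
    (upd (upd (upd ed (u2, v) (finish i2 (top + 2) (iX i2) (top + 2))) (u1, v)
       (finish i1 (top + 2) (iX i2) (top + 2))) (u3, v) (finish i3 (top + 2) (iX i2) (top + 2)))
     (top + 2) (iX i1) (iX i3) None
    ((iX i3, top + 2) :: (iX i1, top + 2) :: (iX i2, top + 2) :: FL) A AF prs cols (top + 2 :: rows).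
Proof.
rewrite /= !inE !negb_or => /and3P[/andP[u12 u13] u23 _].
move=> E1 f1 t1 E2 f2 t2 E3 f3 t3 x12 x23.
have u21 : u2 != u1 by rewrite eq_sym.
have H1 := start_two u21 E2 f2 t2 E1 f1 t1 (ltW x12) (lexx _) (lexx _) (ltW x12).
apply: (fin_side eirr H1 _ f3) => //; rewrite ?updE ?updN //.
- by apply: contraNneq u23 => -[->].
- by apply: contraNneq u13 => -[->].
- by move: t3; clear; lia.
- by move: x23; clear; lia.
- by move=> x; move: x12 x23; item_lia.
- by move: x12 x23; clear; lia.
- by move: x12 x23; clear; lia.
Qed.

End AtVertex.

Variables (t : V) (K : nat).

(* In the bound on [B] the summand [K + 2 - size AF] is a potential: a new
   auxiliary level costs [K + 1], and is needed only when at most one of the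
   [K + 2] pool columns is left in [AF]. *)
Definition stage (S : {set V}) (M : V -> V -> Prop) (W B : nat) vp ed top lo hi FL A AF G
    prs cols rows : Prop :=
   layout e S t set0 set0 M vp ed top lo hi None FL A AF prs cols rows /\
   [/\ vp t = None, pool AF G FL A top, size (AF ++ G) = K.+2,
       spaced cols (2 * 4 ^+ #|~: S|) &
       (size cols <= W)%N /\ (size rows * K.+1 + (K.+2 - size AF) <= B)%N].

Definition drawn S M W B := exists vp ed top lo hi FL A AF G prs cols rows,
  stage S M W B vp ed top lo hi FL A AF G prs cols rows.

Lemma spaced_le cols g g' : spaced cols g -> g' <= g -> spaced cols g'.
Proof. by move=> sp gg c c' cc cc' lt; have := sp c c' cc cc' lt; move: gg; clear; lia. Qed.

Lemma pow4_mono (m n : nat) : (m <= n)%N -> (2 * 4 ^+ m : int) <= 2 * 4 ^+ n.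
Proof. by move=> mn; rewrite ler_pM2l // ler_weXn2l. Qed.

Lemma card_setC_add (S : {set V}) v : v \notin S -> #|~: S| = #|~: (v |: S)|.+1.
Proof.
move=> vS; rewrite (cardsD1 v (~: S)) inE vS; congr _.+1.
by apply: eq_card => x; rewrite !inE negb_or.
Qed.


Definition upd_opt (ed : V * V -> option item) v (o : option V) i :=
  if o is Some w then upd ed (v, w) i else ed.
Definition add_opt (o : option V) (O : {set V}) := if o is Some w then w |: O else O.
Definition drop_opt c (o : option V) FL := if o is Some w then dropc c FL else FL.
Definition admissible (S : {set V}) v (M : V -> V -> Prop) ed prs (o : option V) c :=
  forall w, o = Some w -> [/\ e v w, w \notin S & mate_ok M ed prs w c].

Lemma oko_upo S v M ed prs o c o' i : (forall w w', e v w -> e v w' -> ~ M w w') ->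
  (forall w, o' = Some w -> e v w) ->
  admissible S v M ed prs o c -> admissible S v M (upd_opt ed v o' i) prs o c.
Proof.
move=> Mv; case: o' => [w' /(_ w' erefl) ew'|_] //= ok w ow; have [a b d] := ok w ow.
by split=> //; apply: mate_ok_add => //; apply: Mv.
Qed.

Section Emit.
Variables (S : {set V}) (v : V) (I O : {set V}) (M : V -> V -> Prop).
Variables (vp : V -> option (int * int)) (ed : V * V -> option item).
Variables (top lo hi : int) (FL : seq (int * int)) (A : int) (AF : seq int).
Variables (prs : seq (int * int)) (cols rows : seq int).

Lemma widen xc lo' hi' : layout e S v I O M vp ed top lo hi xc FL A AF prs cols rows ->
  lo' <= lo -> hi <= hi' -> layout e S v I O M vp ed top lo' hi' xc FL A AF prs cols rows.
Proof.
case=> N1 N2 N3 N4 N5 N5' N6 N7 L0 LA LB FLL FLU R1 R2 C1 C2 C3 C4 C5 C6 P1 P2 P3 M1 S1 S2 S3 S4 S5 S6 S7 S8 S9.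
move=> l h; split=> //.
  by move=> k i x E kx oi; have := R1 k i x E kx oi; move: l h; item_lia.
by move=> w x /R2; move: l h; item_lia.
Qed.

Lemma emit_up xc o c h : layout e S v I O M vp ed top lo hi xc FL A AF prs cols rows ->
  vp v = Some (c, top) -> (c, h) \in FL -> h <= top -> admissible S v M ed prs o c ->
  layout e S v I (add_opt o O) M vp (upd_opt ed v o (pending c top top c)) top lo hi xc
      (drop_opt c o FL) A AF prs cols rows.
Proof.
by case: o => [w|] // H Hv cF ht /(_ w erefl) [ew wS mw]; apply: (add_up eirr H Hv cF ht).
Qed.

Lemma emit_side o c f h lo' hi' :
  layout e S v I O M vp ed top lo hi None FL A AF prs cols rows ->
  vp v = Some (c, top) -> (f, h) \in FL -> h < top ->
  (f < lo /\ c = lo) \/ (hi < f /\ c = hi) ->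
  lo' <= lo -> hi <= hi' -> lo' <= f <= hi' -> admissible S v M ed prs o f ->
  layout e S v I (add_opt o O) M vp (upd_opt ed v o (pending c top top f)) top lo' hi' None
      (drop_opt f o FL) A AF prs cols rows.
Proof.
case: o => [w|]; last by move=> H _ _ _ _ l h0 _ _; apply: widen H l h0.
move=> H Hv fF ht fc l h0 fl0 /(_ w erefl) [ew wS mw].
have fc' : f != c by have := row_vertices H Hv; move: fc; item_lia.
apply: (add_side eirr H Hv fF ht) => //; last by left.
by move=> x; have := row_vertices H Hv; move: fc; item_lia.
Qed.
End Emit.

Section Choose.
Variables (S : {set V}) (v : V) (I O : {set V}) (M : V -> V -> Prop).
Variables (vp : V -> option (int * int)) (ed : V * V -> option item).
Variables (top lo hi : int) (xc : option (V * V)) (FL : seq (int * int)) (A : int) (AF : seq int).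
Variables (prs : seq (int * int)) (cols rows : seq int).
Hypothesis H : layout e S v I O M vp ed top lo hi xc FL A AF prs cols rows.
Hypothesis Msym : forall a b, M a b -> M b a.
Hypothesis Mfun : forall a b c, M a b -> M a c -> b = c.
Hypothesis Mone : forall a b, M a b -> exists s, nS e S a \subset [set s].
Hypothesis Mv : forall w w', e v w -> e v w' -> ~ M w w'.

Lemma choose2o (T : {set V}) a1 a2 : T \subset outs S v -> (#|T| <= 2)%N -> a1 != a2 ->
  exists o1 o2, [/\ admissible S v M ed prs o1 a1, admissible S v M ed prs o2 a2 &
    forall w, w \in T <-> o1 = Some w \/ o2 = Some w].
Proof.
move=> sT; have oT w : w \in T -> e v w /\ w \notin S.
  by move/(subsetP sT); rewrite inE => /andP.
have [[|w1 [|w2 [|w3 r]]] u] : exists2 r, uniq r & size r = #|T| /\ r =i T.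
  by exists (enum T); rewrite ?enum_uniq -?cardE //; split=> // w; rewrite mem_enum.
- case=> sz m _ _; exists None, None; split=> // w; split; last by case.
  by rewrite -m.
- case=> sz m _ a12; have w1T : w1 \in T by rewrite -m mem_head.
  have [ew wS] := oT _ w1T.
  have [ok|ok] := choose_col esym H Msym Mfun Mone Mv ew a12.
    exists (Some w1), None; split=> // [w [<-]//|w].
    by rewrite -m inE; split=> [/eqP ->|[[->]|//]]; [left|rewrite eqxx].
  exists None, (Some w1); split=> // [w [<-]//|w].
  by rewrite -m inE; split=> [/eqP ->|[//|[->]]]; [right|rewrite eqxx].
- case=> sz m _ a12; move: u; rewrite /= inE andbT => w12.
  have w1T : w1 \in T by rewrite -m mem_head.
  have w2T : w2 \in T by rewrite -m !inE eqxx orbT.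
  have [[e1 s1] [e2 s2]] := (oT _ w1T, oT _ w2T).
  have [[ok1 ok2]|[ok1 ok2]] := choose2 esym H Msym Mfun Mone Mv e1 e2 w12 a12.
    exists (Some w1), (Some w2); split=> [w [<-]//|w [<-]//|w].
    by rewrite -m !inE; split=> [/orP[]/eqP ->|[[->]|[->]]]; rewrite ?eqxx ?orbT; auto.
  exists (Some w2), (Some w1); split=> [w [<-]//|w [<-]//|w].
  by rewrite -m !inE; split=> [/orP[]/eqP ->|[[->]|[->]]]; rewrite ?eqxx ?orbT; auto.
- by case=> sz m; rewrite -sz.
Qed.

(** One target is first settled on [a1] or [a2], at most one of which is bad for it; the other two
    targets share the remaining two columns. *)
Lemma choose3o (T : {set V}) a1 a2 a3 : T \subset outs S v -> (#|T| <= 3)%N ->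
  a1 != a2 -> a1 != a3 -> a2 != a3 ->
  exists o1 o2 o3, [/\ admissible S v M ed prs o1 a1, admissible S v M ed prs o2 a2, admissible S v M ed prs o3 a3 &
    forall w, w \in T <-> [\/ o1 = Some w, o2 = Some w | o3 = Some w]].
Proof.
move=> sT c3T a12 a13 a23.
have [->|/set0Pn[w wT]] := eqVneq T set0.
  exists None, None, None; split=> // w; rewrite inE; by split=> // -[].
have : w \in outs S v by apply: (subsetP sT).
rewrite inE => /andP[ew wS].
have sT' : T :\ w \subset outs S v by apply: subset_trans sT; apply: subsetDl.
have c2T : (#|T :\ w| <= 2)%N by rewrite -ltnS; apply: leq_trans c3T; rewrite [X in (_ <= X)%N](cardsD1 w) wT.
have memT x : x \in T <-> x = w \/ x \in T :\ w.
  rewrite in_setD1; have [->|/eqP xw] := eqVneq x w; first by split=> //; left.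
  by split=> [xT|[//|//]]; right.
have [ok|ok] := choose_col esym H Msym Mfun Mone Mv ew a12.
  have [o2 [o3 [k2 k3 cov]]] := choose2o sT' c2T a23.
  exists (Some w), o2, o3; split=> // [x [<-]//|x].
  rewrite memT cov; split=> [[->|[->|->]]|[[->]|->|->]];
    [by constructor 1|by constructor 2|by constructor 3|by left|by right; left|by right; right].
have [o1 [o3 [k1 k3 cov]]] := choose2o sT' c2T a13.
exists o1, (Some w), o3; split=> // [x [<-]//|x].
rewrite memT cov; split=> [[->|[->|->]]|[->|[->]|->]];
  [by constructor 2|by constructor 1|by constructor 3|by right; left|by left|by right; right].
Qed.
End Choose.

Lemma FL_inj (FL : seq (int * int)) c h h' : uniq (map fst FL) -> (c, h) \in FL -> (c, h') \in FL -> h = h'.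
Proof.
elim: FL => [|[a b] FL IH] //=; rewrite !inE !xpair_eqE => /andP[na u].
have no h0 : (a, h0) \notin FL by apply: contra na => /(map_f fst).
case/orP=> [/andP[/eqP cE /eqP hE]|cF] /orP[/andP[/eqP cE' /eqP hE']|cF'].
- by rewrite hE hE'.
- by move: (no h'); rewrite -cE cF'.
- by move: (no h); rewrite -cE' cF.
- exact: IH.
Qed.

(** The common ending of all vertex drawings. If the column of [v] is still listed as free, the
    bound attached to it must be [top], since [v] itself sits there. *)
Lemma wrap S v M I O vp ed top lo hi FL A AF G prs cols rows X W B : v != t ->
  layout e S v I O M vp ed top lo hi None FL A AF prs cols rows ->
  vp t = None -> t \notin S -> vp v = Some (X, top) ->
  (forall u, u \in S -> e u v -> u \in I) ->
  (forall w, e v w -> w \notin S -> w \in O) ->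
  (X, top) \in FL \/ (forall h, (X, h) \notin FL) ->
  pool AF G FL A top -> size (AF ++ G) = K.+2 ->
  spaced cols (2 * 4 ^+ #|~: (v |: S)|) ->
  (size cols <= W)%N -> (size rows * K.+1 + (K.+2 - size AF) <= B)%N ->
  stage (v |: S) M W B vp ed top lo hi FL A AF G prs cols rows.
Proof.
move=> vt H Ht tS Hv HI HO HF Hp Hs Hsp HW HB.
split; last by split.
apply: (close esym eirr H) => //; first by rewrite eq_sym.
- by rewrite Hv.
- move=> [c h] y cF; rewrite Hv /= => -[cE <-]; subst c.
  case: HF => [XF|/(_ h)]; last by rewrite cF.
  by rewrite (FL_inj (free_uniq H) cF XF).
Qed.

Lemma pool_in AF G FL A top f : pool AF G FL A top -> f \in AF ++ G -> exists h, (f, h) \in FL.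
Proof.
by case=> _ a b; rewrite mem_cat => /orP[/a[h _ ?]|/b[h _ ?]]; exists h.
Qed.

Lemma pool_dropo AF G FL A top c o : c \notin AF ++ G -> pool AF G FL A top ->
  pool AF G (drop_opt c o FL) A top.
Proof. by case: o => [w|] //; exact: pool_dropc. Qed.

Lemma dropo_keep c d h o FL : (c, h) \in FL -> c != d -> (c, h) \in drop_opt d o FL.
Proof. by case: o => [w|] //= cF cd; rewrite mem_filter /= cd. Qed.

Lemma dropo_case (X h : int) o FL : (X, h) \in FL ->
  (X, h) \in drop_opt X o FL \/ (forall h', (X, h') \notin drop_opt X o FL).
Proof.
by case: o => [w|] /= XF; [right=> h'; rewrite mem_filter /= eqxx|left].
Qed.

Lemma addo_in (o : option V) w O : w \in add_opt o O <-> o = Some w \/ w \in O.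
Proof.
case: o => [x|] /=; last by split=> [|[]//]; right.
by rewrite !inE; split=> [/orP[/eqP->|]|[[->]|->]]; rewrite ?eqxx ?orbT; auto.
Qed.

Lemma oko_fin S v M ed prs o c k i : admissible S v M ed prs o c -> ifin i ->
  admissible S v M (upd ed k i) prs o c.
Proof.
by move=> ok fi w ow; have [a b d] := ok w ow; split=> //; apply: mate_ok_fin.
Qed.

Lemma card_le1_opt (T : {set V}) : (#|T| <= 1)%N -> exists o : option V, forall w, w \in T <-> o = Some w.
Proof.
move=> T1; have [->|/set0Pn[w wT]] := eqVneq T set0.
  by exists None => w; rewrite inE.
exists (Some w) => x; split=> [xT|[<-]//].
by move/card_le1_eqP: T1 => /(_ x w xT wT) ->.
Qed.

End Ops.

(** * Drawing a single vertex *)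

Section DrawOps.
Variables (V : finType) (e : rel V).
Hypothesis esym : symmetric e.
Hypothesis eirr : irreflexive e.
Hypothesis e4 : max_degree_le e 4.
Variables (t : V) (K : nat).

(** Exactly the facts on mates that make the bad combinations of targets and columns at [v] a
    partial matching. *)
Record mates_ok (S : {set V}) (v : V) (M : V -> V -> Prop) : Prop := Mates_ok {
  mates_sym : forall a b, M a b -> M b a;
  mates_fun : forall a b c, M a b -> M a c -> b = c;
  mates_one : forall a b, M a b -> exists s, nS e S a \subset [set s];
  mates_far : forall w w', e v w -> e v w' -> ~ M w w' }.

Section FromState.
Variables (S : {set V}) (M : V -> V -> Prop) (W B : nat).
Variables (vp : V -> option (int * int)) (ed : V * V -> option item).
Variables (top lo hi : int) (FL : seq (int * int)) (A : int) (AF G : seq int).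
Variables (prs : seq (int * int)) (cols rows : seq int).
Hypothesis D : stage e t K S M W B vp ed top lo hi FL A AF G prs cols rows.

Lemma spaced_step v : v \notin S -> spaced cols (2 * 4 ^+ #|~: (v |: S)|).
Proof.
move=> vS; case: D => _ [_ _ _ sp _]; apply: (spaced_le sp); apply: pow4_mono.
by rewrite (card_setC_add vS) leqnSn.
Qed.

Lemma cur v : v \notin S ->
  layout e S v set0 set0 M vp ed top lo hi None FL A AF prs cols rows /\ vp v = None.
Proof. by move=> vS; case: D => H [Ht _ _ _ _]; apply: (inv_cur H erefl erefl Ht vS). Qed.

(** A vertex pays [K + 1] for its row and at most 2 for pool columns withdrawn from [AF], which
    explains the recurring summand [K + 3]. *)
Lemma row_count j n : (j <= 2)%N -> (n = size AF - j)%N ->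
  ((size rows).+1 * K.+1 + (K.+2 - n) <= B + K.+3)%N.
Proof. by case: D => _ [_ _ _ _ [_ HB]] j2 ->; rewrite mulSn; lia. Qed.

Lemma tS : t \notin S.
Proof. by case: D => H _; exact: (cur_new H). Qed.

(** The only outgoing edge must rise on the middle column, without a choice, so its target is
    required to have no mate. The further conclusions expose the two released columns on either
    side, for a successor drawn immediately afterwards. *)
Lemma draw_three_preds v : v \notin S -> v != t -> #|nS e S v| = 3 ->
  (forall w b, e v w -> w \notin S -> ~ M w b /\ ~ M b w) ->
  exists vp' ed' top' lo' hi' FL' rows' X1 X2 X3,
  [/\ stage e t K (v |: S) M W (B + K.+3) vp' ed' top' lo' hi' FL' A AF G prs cols rows',
      (X1, top') \in FL' /\ (X3, top') \in FL', X1 < X2 /\ X2 < X3,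
      X1 \notin AF ++ G /\ X3 \notin AF ++ G &
      forall w, e v w -> w \notin S ->
        exists i, [/\ ed' (v, w) = Some i, ~~ ifin i & iX i = X2]].
Proof.
move=> vS vt n3 nM; have [H Hv] := cur vS.
case: (D) => _ [Ht Hp Hs _ [HW _]].
have [us [uu um us3 so ue]] := pends esym eirr H.
move: us3 uu um so ue; rewrite n3.
case: us => [|u1 [|u2 [|u3 [|? ?]]]] //= _ uu um /and3P[X12 X23 _] ue.
have [i1 [E1 f1 t1 P1]] := ue u1 (mem_head _ _).
have [i2 [E2 f2 t2 P2]] : exists i, [/\ ed (u2, v) = Some i, ~~ ifin i, iy i <= top & pcol v ed u2 = iX i].
  by apply: ue; rewrite !inE eqxx orbT.
have [i3 [E3 f3 t3 P3]] : exists i, [/\ ed (u3, v) = Some i, ~~ ifin i, iy i <= top & pcol v ed u3 = iX i].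
  by apply: ue; rewrite !inE eqxx !orbT.
rewrite P1 P2 P3 in X12 X23.
have H3 := start_three eirr H Hv uu E1 f1 t1 E2 f2 t2 E3 f3 t3 X12 X23.
have /card_le1_opt[o oP] : (#|outs e S v| <= 1)%N.
  by have := card_deg e4 S v; rewrite n3.
have ok : admissible e S v M (upd (upd (upd ed (u2, v) (finish i2 (top + 2) (iX i2) (top + 2))) (u1, v)
       (finish i1 (top + 2) (iX i2) (top + 2))) (u3, v) (finish i3 (top + 2) (iX i2) (top + 2))) prs o (iX i2).
  move=> w /oP; rewrite inE => /andP[ew wS]; split=> // p k i _ _ _.
  by split=> _ _; [have [] := nM w k.2 ew wS|have [] := nM w k.2 ew wS].
have X2F : (iX i2, top + 2) \in [:: (iX i3, top + 2), (iX i1, top + 2), (iX i2, top + 2) & FL].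
  by rewrite !inE eqxx !orbT.
have H4 := emit_up eirr H3 (updE _ _ _) X2F (lexx _) ok.
have nin i u : ed (u, v) = Some i -> ~~ ifin i -> iX i \notin AF ++ G.
  move=> E fi; apply/negP => /(pool_in Hp)[h hF].
  by have := pend_notin_FL H h E fi; rewrite hF.
do 7! eexists; exists (iX i1), (iX i2), (iX i3); split.
- apply: (wrap esym eirr vt H4) => //.
  + by rewrite updN // eq_sym.
  + exact: tS.
  + exact: updE.
  + move=> u uS euv; have : u \in nS e S v by rewrite inE uS esym.
    by rewrite -um !inE => /or3P[]->; rewrite ?orbT.
  + by move=> w ew wS; apply/addo_in; left; apply/oP; rewrite inE ew wS.
  + exact: dropo_case.
  + apply: pool_dropo; first exact: (nin _ _ E2).
    do 3! apply: pool_uncons; apply: pool_top Hp _; clear; lia.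
  + exact: spaced_step.
  + by apply: (@row_count 0); rewrite ?subn0.
- split; apply: dropo_keep; rewrite ?inE ?eqxx ?orbT //.
    by apply/eqP => XE; move: X12; rewrite XE ltxx.
  by apply/eqP => XE; move: X23; rewrite XE ltxx.
- by split; [exact: X12|exact: X23].
- by split; [exact: (nin _ _ E1)|exact: (nin _ _ E3)].
- move=> w ew wS; have : w \in outs e S v by rewrite inE ew wS.
  move/oP => oE; exists (pending (iX i2) (top + 2) (top + 2) (iX i2)).
  by rewrite oE /= updE.
Qed.

(** A vertex with one predecessor normally occurs only inside a chain. Here two free columns on
    either side of the incoming one are at hand, so up to three edges leave to the left, upwards and
    to the right. *)
Lemma draw_one_pred v w i p1 p3 h1 h3 : w \notin S -> w != t -> (forall u, u \in S -> e u w -> u = v) ->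
  ed (v, w) = Some i -> ~~ ifin i -> mates_ok S w M ->
  (p1, h1) \in FL -> (p3, h3) \in FL -> h1 <= top -> h3 <= top ->
  p1 < iX i -> iX i < p3 -> p1 \notin AF ++ G -> p3 \notin AF ++ G ->
  drawn e t K (w |: S) M W (B + K.+3).
Proof.
move=> wS wt only E fi mg p1F p3F h1t h3t p1X Xp3 p1P p3P; have [H Hv] := cur wS.
case: (D) => _ [Ht Hp Hs _ [HW _]].
have [evw vS] := pend_src eirr H E.
have [it _] := item_low H E.
have H1 := start_one eirr H Hv E fi it.
have cw : (#|nS e S w| >= 1)%N.
  by rewrite card_gt0; apply/set0Pn; exists v; rewrite inE vS esym.
have co : (#|outs e S w| <= 3)%N.
  have := leq_trans (leq_add cw (leqnn _)) (card_deg e4 S w); rewrite add1n.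
  by move=> h; rewrite -ltnS.
have X1 : iX i != p1 by move: p1X; clear; lia.
have X3 : iX i != p3 by move: Xp3; clear; lia.
have p13 : p1 != p3 by move: p1X Xp3; clear; lia.
have [o1 [o2 [o3 [k1 k2 k3 cov]]]] := choose3o esym H1 (mates_sym mg) (mates_fun mg) (mates_one mg) (mates_far mg)
   (subxx _) co X1 X3 p13.
have oe o a ed0 : admissible e S w M ed0 prs o a -> forall x, o = Some x -> e w x.
  by move=> ok x /ok[].
have p1F' : (p1, h1) \in (iX i, top + 2) :: FL by rewrite inE p1F orbT.
have h1t' : h1 < top + 2 by move: h1t; clear; lia.
have h3t' : h3 < top + 2 by move: h3t; clear; lia.
have H2 := emit_side (lo' := p1) (hi' := iX i) eirr H1 (updE _ _ _) p1F' h1t' (or_introl (conj p1X erefl)) (ltW p1X) (lexx _) _ k2.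
have {}H2 := H2 (ltac:(by rewrite lexx ltW)).
have p3F' : (p3, h3) \in drop_opt p1 o2 ((iX i, top + 2) :: FL).
  by apply: dropo_keep; [rewrite inE p3F orbT|rewrite eq_sym].
have H3 := emit_side (lo' := p1) (hi' := p3) eirr H2 (updE _ _ _) p3F' h3t' (or_intror (conj Xp3 erefl)) (lexx _) (ltW Xp3) _ (oko_upo _ (mates_far mg) (oe _ _ _ k2) k3).
have {}H3 := H3 (ltac:(by rewrite lexx (ltW (lt_trans p1X Xp3)))).
have XF : (iX i, top + 2) \in drop_opt p3 o3 (drop_opt p1 o2 ((iX i, top + 2) :: FL)).
  by do 2!apply: dropo_keep => //; rewrite mem_head.
have H4 := emit_up eirr H3 (updE _ _ _) XF (lexx _) (oko_upo _ (mates_far mg) (oe _ _ _ k3) (oko_upo _ (mates_far mg) (oe _ _ _ k2) k1)).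
do 12! eexists; apply: (wrap esym eirr wt H4) => //.
- by rewrite updN // eq_sym.
- exact: tS.
- exact: updE.
- by move=> u uS euw; rewrite (only u uS euw) !inE eqxx.
- move=> x ew xS; have : x \in outs e S w by rewrite inE ew xS.
  by case/cov => ->; do 3! (apply/addo_in; (try by left); right).
- exact: dropo_case.
- apply: pool_dropo.
    by apply/negP => /(pool_in Hp)[h hF]; have := pend_notin_FL H h E fi; rewrite hF.
  do 2! apply: pool_dropo => //.
  apply: pool_uncons; apply: pool_top Hp _; clear; lia.
- exact: Hs.
- exact: spaced_step.
- by apply: (@row_count 0); rewrite ?subn0.
Qed.

Lemma pend_pool k v i : v \notin S -> ed k = Some i -> ~~ ifin i -> iX i \notin AF ++ G.
Proof.
move=> vS E fi; have [H _] := cur vS; case: (D) => _ [_ Hp _ _ _].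
apply/negP => /(pool_in Hp)[h hF].
by have := pend_notin_FL H h E fi; rewrite hF.
Qed.

Lemma pends2 v : v \notin S -> #|nS e S v| = 2 ->
  exists u1 u2 i1 i2, [/\ u1 != u2, (forall u, u \in S -> e u v -> u = u1 \/ u = u2),
    [/\ ed (u1, v) = Some i1, ~~ ifin i1 & iy i1 <= top],
    [/\ ed (u2, v) = Some i2, ~~ ifin i2 & iy i2 <= top] & iX i1 < iX i2].
Proof.
move=> vS n2; have [H Hv] := cur vS.
have [us [uu um us2 so ue]] := pends esym eirr H.
move: us2 uu um so ue; rewrite n2.
case: us => [|u1 [|u2 [|? ?]]] //= _ uu um so ue.
have [i1 [E1 f1 t1 P1]] := ue u1 (mem_head _ _).
have [i2 [E2 f2 t2 P2]] : exists i, [/\ ed (u2, v) = Some i, ~~ ifin i, iy i <= top & pcol v ed u2 = iX i].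
  by apply: ue; rewrite !inE eqxx orbT.
exists u1, u2, i1, i2; split=> //.
- by move: uu; rewrite !inE andbT.
- move=> u uS euv; have : u \in nS e S v by rewrite inE uS esym.
  by rewrite -um !inE => /orP[]/eqP ->; auto.
- by move: so; rewrite P1 P2 andbT.
Qed.

Lemma draw_at_pred v u1 u2 i1 i2 o : v \notin S -> v != t -> u1 != u2 ->
  (forall u, u \in S -> e u v -> u = u1 \/ u = u2) ->
  [/\ ed (u1, v) = Some i1, ~~ ifin i1 & iy i1 <= top] ->
  [/\ ed (u2, v) = Some i2, ~~ ifin i2 & iy i2 <= top] ->
  admissible e S v M ed prs o (iX i1) -> (forall w, w \in outs e S v <-> o = Some w) ->
  drawn e t K (v |: S) M W (B + K.+3).
Proof.
move=> vS vt u12 un [E1 f1 t1] [E2 f2 t2] ok oP.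
have [H Hv] := cur vS; case: (D) => _ [Ht Hp Hs _ [HW _]].
have H2 := start_two (lo' := Num.min (iX i1) (iX i2)) (hi' := Num.max (iX i1) (iX i2))
  eirr H Hv u12 E1 f1 t1 E2 f2 t2 (ltac:(clear; lia)) (ltac:(clear; lia)) (ltac:(clear; lia)) (ltac:(clear; lia)).
have X1F : (iX i1, top + 2) \in [:: (iX i2, top + 2), (iX i1, top + 2) & FL].
  by rewrite !inE eqxx !orbT.
have H4 := emit_up eirr H2 (updE _ _ _) X1F (lexx _) (oko_fin _ (oko_fin _ ok (isT : ifin (finish _ _ _ _))) (isT : ifin (finish _ _ _ _))).
do 12! eexists; apply: (wrap esym eirr vt H4) => //.
- by rewrite updN // eq_sym.
- exact: tS.
- exact: updE.
- by move=> u uS euv; case: (un u uS euv) => ->; rewrite !inE eqxx ?orbT.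
- by move=> w ew wS; apply/addo_in; left; apply/oP; rewrite inE ew wS.
- exact: dropo_case.
- apply: pool_dropo; first exact: (pend_pool vS E1 f1).
  do 2! apply: pool_uncons; apply: pool_top Hp _; clear; lia.
- exact: Hs.
- exact: spaced_step.
- by apply: (@row_count 0); rewrite ?subn0.
Qed.

(** Either incoming column can carry the vertex and its outgoing edge, and at most one of them is
    bad for the target. No pool column is needed. *)
Lemma draw_two_le1 v : v \notin S -> v != t -> #|nS e S v| = 2 -> (#|outs e S v| <= 1)%N ->
  mates_ok S v M -> drawn e t K (v |: S) M W (B + K.+3).
Proof.
move=> vS vt n2 o1 mg; have [H Hv] := cur vS.
have [u1 [u2 [i1 [i2 [u12 un P1 P2 X12]]]]] := pends2 vS n2.
have /card_le1_opt[o oP] := o1.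
have X12' : iX i1 != iX i2 by move: X12; clear; lia.
have [ok|ok] : admissible e S v M ed prs o (iX i1) \/ admissible e S v M ed prs o (iX i2).
- case: o oP => [w|] oP; last by left.
  have : w \in outs e S v by apply/oP.
  rewrite inE => /andP[ew wS].
  by have [ok|ok] := choose_col esym H (mates_sym mg) (mates_fun mg) (mates_one mg) (mates_far mg) ew X12';
    [left|right]; move=> x [<-].
- exact: draw_at_pred P1 P2 ok oP.
- apply: (draw_at_pred vS vt _ _ P2 P1 ok oP); first by rewrite eq_sym.
  by move=> u uS euv; case: (un u uS euv); auto.
Qed.

(* A pool column on the outer side of the column of [u1] takes one outgoing
   edge; the column of [u2] joins the pool. *)
Lemma draw_two_outside v u1 u2 i1 i2 f : v \notin S -> v != t -> mates_ok S v M -> (#|outs e S v| <= 2)%N ->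
  u1 != u2 -> (forall u, u \in S -> e u v -> u = u1 \/ u = u2) ->
  [/\ ed (u1, v) = Some i1, ~~ ifin i1 & iy i1 <= top] ->
  [/\ ed (u2, v) = Some i2, ~~ ifin i2 & iy i2 <= top] ->
  f \in AF -> (f < iX i1 /\ iX i1 < iX i2) \/ (iX i2 < iX i1 /\ iX i1 < f) ->
  drawn e t K (v |: S) M W (B + K.+3).
Proof.
move=> vS vt mg o2' u12 un [E1 f1 t1] [E2 f2 t2] fA fX.
have [H Hv] := cur vS; case: (D) => _ [Ht Hp Hs _ [HW _]].
have fX1 : iX i1 != f by move: fX; clear; lia.
have [o1 [o2 [k1 k2 cov]]] := choose2o esym H (mates_sym mg) (mates_fun mg) (mates_one mg) (mates_far mg)
   (subxx _) o2' fX1.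
have k1' k i k' i' : ifin i -> ifin i' -> admissible e S v M (upd (upd ed k i) k' i') prs o1 (iX i1).
  by move=> a b; do 2 apply: oko_fin => //.
have k2' k i k' i' : ifin i -> ifin i' -> admissible e S v M (upd (upd ed k i) k' i') prs o2 f.
  by move=> a b; do 2 apply: oko_fin => //.
have k2e w : o2 = Some w -> e v w by move=> /k2[].
have [_ /(_ f fA)[h hA fF] _] := Hp; have At := levelA_range H.
have H2 := start_two (lo' := Num.min (iX i1) (iX i2)) (hi' := Num.max (iX i1) (iX i2))
  eirr H Hv u12 E1 f1 t1 E2 f2 t2 (ltac:(clear; lia)) (ltac:(clear; lia)) (ltac:(clear; lia)) (ltac:(clear; lia)).
have fF2 : (f, h) \in [:: (iX i2, top + 2), (iX i1, top + 2) & FL] by rewrite !inE fF !orbT.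
have H3 := emit_side (lo' := Num.min f (Num.min (iX i1) (iX i2)))
   (hi' := Num.max f (Num.max (iX i1) (iX i2))) eirr H2 (updE _ _ _) fF2
   (ltac:(move: hA At; clear; lia)) (ltac:(move: fX; clear; lia))
   (ltac:(clear; lia)) (ltac:(clear; lia)) (ltac:(clear; lia)) (k2' _ (finish _ _ _ _) _ (finish _ _ _ _) isT isT).
have {}H3 := weaken (AF' := rem f AF) (M' := M) H3 (fun _ h => h) (free_uniq H3) (@mem_rem _ f AF) (fun _ _ _ _ _ _ _ _ m => m).
have X1F : (iX i1, top + 2) \in drop_opt f o2 [:: (iX i2, top + 2), (iX i1, top + 2) & FL].
  by apply: dropo_keep; rewrite ?inE ?eqxx ?orbT.
have H4 := emit_up eirr H3 (updE _ _ _) X1F (lexx _)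
  (oko_upo _ (mates_far mg) k2e (k1' _ (finish _ _ _ _) _ (finish _ _ _ _) isT isT)).
have p1' := pend_pool vS E1 f1; have p2' := pend_pool vS E2 f2.
have [u0 a b] := Hp; move: (u0); rewrite cat_uniq => /and3P[uA /hasPn nAG uG].
have sA := size_rem fA.
do 12! eexists; apply: (wrap (G := iX i2 :: G) esym eirr vt H4) => //.
- by rewrite updN // eq_sym.
- exact: tS.
- exact: updE.
- by move=> u uS euv; case: (un u uS euv) => ->; rewrite !inE eqxx ?orbT.
- move=> w ew wS; have : w \in outs e S v by rewrite inE ew wS.
  by case/cov => ->; do 2! (apply/addo_in; (try by left); right).
- exact: dropo_case.
- have X12 : iX i2 != iX i1 by move: fX; clear; lia.
  have rA : {subset rem f AF <= AF} by exact: mem_rem.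
  apply: pool_dropo.
    rewrite mem_cat inE negb_or (negbTE (_ : iX i1 \notin rem f AF)) /=; last first.
      by apply: contra p1' => /rA; rewrite mem_cat => ->.
    rewrite eq_sym negb_or X12 /=; apply: contra p1'; by rewrite mem_cat => ->; rewrite orbT.
  apply: pool_dropo.
    rewrite mem_cat inE mem_rem_uniq // inE eqxx /= negb_or; apply/andP; split.
      by apply: contraNneq p2' => <-; rewrite mem_cat fA.
    by apply: contraL fA => /nAG.
  split.
  + rewrite cat_uniq rem_uniq //= uG andbT; apply/andP; split.
    * rewrite negb_or; apply/andP; split.
        by apply: contra p2' => /rA; rewrite mem_cat => ->.
      by apply/hasPn => x /nAG; apply: contra => /rA.
    * by apply: contra p2'; rewrite mem_cat => ->; rewrite orbT.
  + by move=> x /rA /a[h' hA' hF']; exists h' => //; rewrite !inE hF' !orbT.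
  + move=> x; rewrite inE => /orP[/eqP ->|/b[h' hA' hF']].
    * by exists (top + 2); rewrite ?inE ?eqxx.
    * by exists h'; rewrite ?inE ?hF' ?orbT //; move: (hA'); clear; lia.
- rewrite size_cat /= sA addnS -addSn prednK -?size_cat //.
  by case: (AF) fA.
- exact: spaced_step.
- by apply: (@row_count 1) => //; rewrite sA subn1.
Qed.

(** The potential is at least [K + 1] beforehand and 0 afterwards, since the whole pool becomes
    available; the drop pays for the extra row and [B] stays the same. *)
Lemma new_aux_level v : v \notin S -> (size AF <= 1)%N ->
  exists rows', stage e t K S M W B vp ed (top + 2) 1 0 FL (top + 2) (AF ++ G) [::] prs cols rows'.
Proof.
move=> vS A1; case: (D) => H [Ht Hp Hs Hsp [HW HB]].
have At := levelA_range H.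
have H1 := newrow H 1 0 None.
have {}H1 := setA H1 (AF ++ G) isT erefl (ltac:(move: At; clear; lia)).
exists (top + 2 :: rows); split=> //; split=> //.
- case: Hp => u a b; split; rewrite ?cats0 //.
  move=> f; rewrite mem_cat => /orP[/a|/b][h hA hF]; exists h => //.
    by move: hA At; clear; lia.
  by move: hA; clear; lia.
- by rewrite cats0.
- by split=> //; rewrite Hs subnn /= mulSn; lia.
Qed.

Lemma min2 (L : seq int) : uniq L -> (1 < size L)%N ->
  exists f1 f2 R, [/\ perm_eq L [:: f1, f2 & R], f1 < f2 & forall g, g \in R -> f2 < g].
Proof.
move=> uL sL; have : perm_eq (sort <=%O L) L by rewrite perm_sort.
have : sorted <%O (sort <=%O L) by rewrite sort_lt_sorted.
case E : (sort <=%O L) => [|f1 [|f2 R]].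
- by move=> _ sE; move: sL; rewrite -(perm_size sE).
- by move=> _ sE; move: sL; rewrite -(perm_size sE).
move=> /= /andP[f12 pR] pE; exists f1, f2, R; split=> //; first by rewrite perm_sym.
by move=> g gR; have /allP := order_path_min lt_trans pR; apply.
Qed.

(* If all available pool columns lie between the incoming ones, [v] is put on
   the leftmost of them and reaches the next one along level [A]. *)
Lemma draw_two_inside v u1 u2 i1 i2 : v \notin S -> v != t -> mates_ok S v M -> (#|outs e S v| <= 2)%N ->
  u1 != u2 -> (forall u, u \in S -> e u v -> u = u1 \/ u = u2) ->
  [/\ ed (u1, v) = Some i1, ~~ ifin i1 & iy i1 <= top] ->
  [/\ ed (u2, v) = Some i2, ~~ ifin i2 & iy i2 <= top] ->
  (1 < size AF)%N -> (forall f, f \in AF -> iX i1 < f < iX i2) ->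
  drawn e t K (v |: S) M W (B + K.+3).
Proof.
move=> vS vt mg o2' u12 un [E1 fi1 t1] [E2 fi2 t2] sA inA.
have [H Hv] := cur vS; case: (D) => _ [Ht Hp Hs _ [HW _]].
have [u0 a b] := Hp; move: (u0); rewrite cat_uniq => /and3P[uA /hasPn nAG uG].
have [f1 [f2 [R [pA f12 f2R]]]] := min2 uA sA.
have mA f : (f \in AF) = (f \in [:: f1, f2 & R]) by exact: perm_mem.
have f1A : f1 \in AF by rewrite mA mem_head.
have f2A : f2 \in AF by rewrite mA !inE eqxx orbT.
have RA : {subset R <= AF} by move=> x xR; rewrite mA !inE xR !orbT.
have /andP[X1f fX1] := inA _ f1A; have /andP[X1f' fX2] := inA _ f2A.
have [h1 h1A f1F] := a _ f1A; have [h2 h2A f2F] := a _ f2A.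
have At := levelA_range H; have tA := topA H.
have f12' : f1 != f2 by move: f12; clear; lia.
have [o1 [o2 [k1 k2 cov]]] := choose2o esym H (mates_sym mg) (mates_fun mg) (mates_one mg) (mates_far mg)
   (subxx _) o2' f12'.
have k1' k i k' i' : ifin i -> ifin i' -> admissible e S v M (upd (upd ed k i) k' i') prs o1 f1.
  by move=> ? ?; do 2 apply: oko_fin => //.
have k2' k i k' i' : ifin i -> ifin i' -> admissible e S v M (upd (upd ed k i) k' i') prs o2 f2.
  by move=> ? ?; do 2 apply: oko_fin => //.
have k2e w : o2 = Some w -> e v w by move=> /k2[].
have H1 := newrow H 1 0 None.
have {}H1 : layout e S v set0 set0 M (upd vp v (f1, top + 2)) ed (top + 2) f1 f1 None FL A AF prs cols (top + 2 :: rows).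
  apply: (place_free H1 Hv f1F) => //; try by left.
  - by move: h1A At; clear; lia.
  - by clear; lia.
  - by move: tA; clear; lia.
  - by rewrite !lexx.
have H2 := fin_side (lo' := iX i1) (hi' := f1) eirr H1 E1 fi1 (ltac:(move: t1; clear; lia)) (updE _ _ _)
   (ltac:(move: X1f; clear; lia)) erefl (ltac:(move=> x; move: X1f; item_lia))
   (ltW X1f) (lexx _) (lexx _) (ltW X1f).
have E2' : upd ed (u1, v) (finish i1 (top + 2) f1 (top + 2)) (u2, v) = Some i2.
  by rewrite updN //; apply: contraNneq u12 => -[->].
have H3 := fin_side (lo' := iX i1) (hi' := iX i2) eirr H2 E2' fi2 (ltac:(move: t2; clear; lia)) (updE _ _ _)
   (ltac:(move: fX1; clear; lia)) erefl (ltac:(move=> x; move: X1f fX1; item_lia))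
   (lexx _) (ltW (lt_trans X1f fX1)) (ltW fX1) (lexx _).
have {}H3 := weaken (AF' := AF) (M' := M) H3 (fun _ h => h) (free_uniq H3) (fun _ h => h) (fun _ _ _ _ _ _ _ _ m => m).
have f1F3 : (f1, h1) \in [:: (iX i2, top + 2), (iX i1, top + 2) & FL] by rewrite !inE f1F !orbT.
have f2F3 : (f2, h2) \in [:: (iX i2, top + 2), (iX i1, top + 2) & FL] by rewrite !inE f2F !orbT.
pose FL3 := [:: (iX i2, top + 2), (iX i1, top + 2) & FL].
pose FL4 := if o2 is Some w then (f1, top + 2) :: dropc f1 (dropc f2 FL3) else FL3.
pose it4 := pending f1 (top + 2) A f2.
(* Everything already on level [A] lies left of [f1], so the stretch from [f1] to [f2] is clear. As
   these are the two leftmost available columns, all of [R] lies right of the new stretch, which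
   restores [levelA]. *)
have H4 : layout e S v (u2 |: (u1 |: set0)) (add_opt o2 set0) M (upd vp v (f1, top + 2))
   (upd_opt (upd (upd ed (u1, v) (finish i1 (top + 2) f1 (top + 2))) (u2, v) (finish i2 (top + 2) f1 (top + 2))) v o2 it4)
   (top + 2) (iX i1) (iX i2) None FL4 A R prs cols (top + 2 :: rows).
  rewrite /FL4; case: (o2) k2 k2' => [w|] k2 k2'; last by apply: (weaken H3 (fun _ h => h) (free_uniq H3) RA).
  have [ew wS mw] := k2' (u1, v) (finish i1 (top + 2) f1 (top + 2)) (u2, v) (finish i2 (top + 2) f1 (top + 2)) isT isT w erefl.
  apply: (add_down eirr H3 (updE _ _ _) f1F3 f2F3 h1A h2A tA _ _ _ _ _ (or_introl erefl) RA) => //.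
  - by rewrite eq_sym.
  - by case/andP: (level_grid H3) => _ X; exact: X.
  - move=> k i x E oi; have := levelA H3 E oi f1A; move: f12; item_lia.
  - by move=> w' x /(place_height H3) /and3P[_ _]; rewrite eqxx.
  - by move=> A0; move: At; rewrite A0; clear; lia.
have f1F4 : exists2 h, (f1, h) \in FL4 & h <= top + 2.
  rewrite /FL4; case: (o2) => [w|]; first by exists (top + 2); rewrite ?mem_head.
  by exists h1 => //; move: h1A At; clear; lia.
have [h4 f1F4' h4t] := f1F4.
have H5 := emit_up eirr H4 (updE _ _ _) f1F4' h4t
  (oko_upo _ (mates_far mg) k2e (k1' _ (finish _ _ _ _) _ (finish _ _ _ _) isT isT)).
have {}H5 := weaken (FL' := dropc f1 (drop_opt f1 o1 FL4)) (M' := M) H5 (fun x => @mem_subseq _ _ _ (filter_subseq _ _) x)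
   (dropc_uniq f1 (free_uniq H5)) (fun _ h => h) (fun _ _ _ _ _ _ _ _ m => m).
have p1' := pend_pool vS E1 fi1; have p2' := pend_pool vS E2 fi2.
have uR : uniq [:: f1, f2 & R] by rewrite -(perm_uniq pA).
have X12 : iX i1 != iX i2 by move: X1f fX1; clear; lia.
(* The pool gives up [f1] and [f2] and receives the two incoming columns, both released at the
   current row, so its size is unchanged. *)
have pool5 : pool R [:: iX i1, iX i2 & G] (dropc f1 (drop_opt f1 o1 FL4)) A (top + 2).
  have nn x : x \in R ++ [:: iX i1, iX i2 & G] -> (x != f1) && (x != f2).
    rewrite mem_cat !inE => /or4P[xR|/eqP->|/eqP->|xG].
    - by have := f2R _ xR; move: f12; clear; lia.
    - by move: X1f f12; clear; lia.
    - by move: fX1 fX2; clear; lia.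
    - by have := nAG _ xG; rewrite /= mA !inE !negb_or => /and3P[-> ->].
  have k4 x h : x \in R ++ [:: iX i1, iX i2 & G] -> (x, h) \in FL3 -> (x, h) \in FL4.
    move=> /nn/andP[x1 x2] xF; rewrite /FL4; case: (o2) => [w|] //.
    by rewrite inE !mem_filter /= x1 x2 xF orbT.
  have k5 x h : x \in R ++ [:: iX i1, iX i2 & G] -> (x, h) \in FL3 -> (x, h) \in dropc f1 (drop_opt f1 o1 FL4).
    move=> xP xF; have /andP[x1 _] := nn x xP; rewrite mem_filter /= x1.
    by apply: dropo_keep => //; exact: k4.
  split.
  - rewrite cat_uniq /= !inE !negb_or X12 uG !andbT.
    move: (uR) => /= /and3P[_ _ ->] /=.
    have -> : iX i1 \notin R by apply: contra p1' => /RA; rewrite mem_cat => ->.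
    have -> : iX i2 \notin R by apply: contra p2' => /RA; rewrite mem_cat => ->.
    have -> : iX i1 \notin G by apply: contra p1'; rewrite mem_cat => ->; rewrite orbT.
    have -> : iX i2 \notin G by apply: contra p2'; rewrite mem_cat => ->; rewrite orbT.
    rewrite /= andbT; apply/hasPn => x /nAG; by apply: contra => /RA.
  - move=> x xR; have [h hA hF] := a _ (RA _ xR); exists h => //.
    by apply: k5; rewrite ?mem_cat ?xR // !inE hF !orbT.
  - move=> x xG; suff [h hA hF] : exists2 h, h <= top + 2 & (x, h) \in FL3.
      by exists h => //; apply: k5; rewrite // mem_cat xG orbT.
    move: xG; rewrite !inE => /or3P[/eqP->|/eqP->|/b[h hA hF]].
    + by exists (top + 2) => //; rewrite /FL3 !inE eqxx orbT.
    + by exists (top + 2) => //; rewrite /FL3 !inE eqxx.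
    + by exists h; rewrite ?/FL3 ?inE ?hF ?orbT //; move: hA; clear; lia.
have sR : size AF = (size R).+2 by rewrite (perm_size pA).
do 12! eexists; apply: (wrap (G := [:: iX i1, iX i2 & G]) esym eirr vt H5) => //.
- by rewrite updN // eq_sym.
- exact: tS.
- exact: updE.
- by move=> u uS euv; case: (un u uS euv) => ->; rewrite !inE eqxx ?orbT.
- move=> w ew wS; have : w \in outs e S v by rewrite inE ew wS.
  by case/cov => ->; do 2! (apply/addo_in; (try by left); right).
- by right=> h; rewrite mem_filter /= eqxx.
- by move: Hs; rewrite !size_cat sR /= !addnS.
- exact: spaced_step.
- by apply: (@row_count 2) => //; rewrite sR subn2.
Qed.

End FromState.

Lemma draw_two_preds (S : {set V}) M W B v : v \notin S -> v != t -> #|nS e S v| = 2 -> mates_ok S v M ->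
  drawn e t K S M W B -> drawn e t K (v |: S) M W (B + K.+3).
Proof.
move=> vS vt n2 mg [vp [ed [top [lo [hi [FL [A [AF [G [prs [cols [rows D]]]]]]]]]]]].
have [o1|o2] := leqP #|outs e S v| 1; first exact: (draw_two_le1 D).
have {}o2 : (#|outs e S v| <= 2)%N.
  by have := card_deg e4 S v; rewrite n2 -[4%N]/(2 + 2)%N leq_add2l.
wlog sA : top lo hi A AF G rows D / (1 < size AF)%N.
  move=> Hw; have [sA|sA] := leqP (size AF) 1; last exact: Hw D sA.
  have [rows' D'] := new_aux_level D vS sA; apply: Hw D' _.
  by case: (D) => _ [_ _ -> _ _].
have [u1 [u2 [i1 [i2 [u12 un P1 P2 X12]]]]] := pends2 D vS n2.
have [/hasP[f fA fo]|/hasPn no] := boolP (has (fun f => ~~ (iX i1 < f < iX i2)) AF); last first.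
  by apply: (draw_two_inside D vS vt mg o2 u12 un P1 P2 sA) => f /no; rewrite negbK.
have [E1 fi1 _] := P1; have [E2 fi2 _] := P2.
have fpool : f \in AF ++ G by rewrite mem_cat fA.
have fX1 : f != iX i1 by apply: contraNneq (pend_pool D vS E1 fi1) => <-.
have fX2 : f != iX i2 by apply: contraNneq (pend_pool D vS E2 fi2) => <-.
have [lt|ge] := ltP f (iX i1).
  by apply: (draw_two_outside D vS vt mg o2 u12 un P1 P2 fA); left.
have X2f : iX i2 < f by move: ge fX1 fX2 fo; clear; lia.
apply: (draw_two_outside D vS vt mg o2 _ _ P2 P1 fA); last by right.
  by rewrite eq_sym.
by move=> u uS euv; case: (un u uS euv); auto.
Qed.

End DrawOps.

(** * Drawing a chain *)

Section ChainOps.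
Variables (V : finType) (e : rel V).
Hypothesis esym : symmetric e.
Hypothesis eirr : irreflexive e.
Hypothesis e4 : max_degree_le e 4.
Variables (t : V) (K : nat) (M : V -> V -> Prop).

(* The next inner vertex goes right next to column [base], which must not be
   the left column of a pair. *)
Definition basecol (prs : seq (int * int)) (cols : seq int) (hi c' base : int) :=
  [/\ base \in cols, hi <= base, base < c' & forall p, p \in prs -> p.1 != base].

(** The state inside a chain: [a] is drawn, [z] comes next, and the edge between them runs to the
    provisional column [r]. The vertex variable [item_lia] is the far end of the chain; the edge
    from its predecessor [s'] waits on column [c'], right of everything in the row so far. For each
    of the [n] inner vertices to come, two columns are reserved in [W']. *)
Definition midstate (S : {set V}) (a z s' item_lia : V) (W' B' n : nat) vp ed top lo hi FL A AF G prs cols rows (c' r : int) : Prop :=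
 [/\ layout e S z set0 set0 M vp ed top lo hi (Some (a,z)) FL A AF prs cols rows,
     vp z = None /\ vp t = None,
     exists xa, ed (a,z) = Some (pending xa top top r),
     [/\ hi < c', c' < r & exists i', [/\ ed (s', item_lia) = Some i', ~~ ifin i', iy i' < top & iX i' = c']] &
     [/\ pool AF G FL A top, size (AF ++ G) = K.+2, spaced cols (2 * 4 ^+ #|~: S|),
         (size cols + 2 * n <= W')%N & (size rows * K.+1 + (K.+2 - size AF) <= B')%N]].

(** Gaps of [4 * g] leave room for two columns right after [b], and every gap afterwards is still at
    least [g]. *)
Lemma spaced_insert2 cols b (g : int) : 0 < g -> spaced cols (4 * g) -> b \in cols ->
  [/\ b + g \notin cols, b + 2 * g \notin b + g :: cols & spaced [:: b + 2 * g, b + g & cols] g].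
Proof.
move=> g0 sp bc.
have far c : c \in cols -> (c <= b) || (b + 4 * g <= c).
  by move=> cc; have := sp b c bc cc; move: g0; clear; lia.
have low c : c \in cols -> c < b -> c + 4 * g <= b by move=> cc; exact: sp.
split.
- by apply/negP => /far; move: g0; clear; lia.
- rewrite inE negb_or; apply/andP; split; first by move: g0; clear; lia.
  by apply/negP => /far; move: g0; clear; lia.
- move=> c c'; rewrite !inE => /or3P[/eqP->|/eqP->|cc] /or3P[/eqP->|/eqP->|cc'];
    try (by move: g0; clear; lia).
  + by have := far _ cc'; move: g0; clear; lia.
  + by have := far _ cc'; move: g0; clear; lia.
  + by have := far _ cc; have := low _ cc; move: g0; clear; lia.
  + by have := far _ cc; have := low _ cc; move: g0; clear; lia.
  + by have := sp _ _ cc cc'; move: g0; clear; lia.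
Qed.

Lemma card_outs1 (S : {set V}) z w : (0 < #|nS e S z|)%N -> w \in outs e S z ->
  (#|outs e S z :\ w| <= 2)%N.
Proof.
move=> n1 wo; have := leq_trans (leq_add n1 (leqnn _)) (card_deg e4 S z).
by rewrite (cardsD1 w) wo !add1n.
Qed.

(** The chain edges take the left and right sides, so of the at most two other edges one goes up on
    the new column [x], and one goes down to level 0 and up again on the neighbouring new column
    [d]. *)
Lemma chain_mid S a z z' s' item_lia W' B' n vp ed top lo hi FL A AF G prs cols rows c' r base :
  midstate S a z s' item_lia W' B' n.+1 vp ed top lo hi FL A AF G prs cols rows c' r ->
  basecol prs cols hi c' base -> mates_ok e S z M -> (forall b, ~ M z' b /\ ~ M b z') ->
  nS e S z = [set a] -> e z z' -> z' \notin S -> z' != t -> z != t -> item_lia != z ->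
  exists vp' ed' hi' FL' prs' cols' base',
    midstate (z |: S) z z' s' item_lia W' B' n vp' ed' top lo hi' FL' A AF G prs' cols' rows c' r /\
    basecol prs' cols' hi' c' base'.
Proof.
case=> H [Hz Ht] [xa Ea] [hc' c'r [i' [El fl' tl Xl]]] [Hp Hs Hsp HW HB].
case=> bcol hib bc' pb mg nM nSz ezz' z'S z't zt zlz.
have zS := cur_new H.
have z'z : z' != z by apply: contraTneq ezz' => ->; rewrite eirr.
pose g : int := 2 * 4 ^+ #|~: (z |: S)|.
have g0 : 0 < g by rewrite /g mulr_gt0 // exprn_gt0.
have {}Hsp : spaced cols (4 * g).
  by move: Hsp; rewrite (card_setC_add zS) exprS mulrCA.
have [xn dn sp'] := spaced_insert2 g0 Hsp bcol.
set x := base + g in xn dn sp'; set d := base + 2 * g in dn sp'.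
have xd : x < d by rewrite /x /d; move: g0; clear; lia.
have bx : base < x by rewrite /x; move: g0; clear; lia.
have c'col : c' \in cols by rewrite -Xl; have /and4P[] := src_grid H El.
have dc' : d < c' by have := Hsp _ _ bcol c'col bc'; rewrite /d; move: g0; clear; lia.
have PF p : p \in prs -> (p.2 <= base) || (d < p.1).
  move=> pp; have /andP[pc1 pc2] := pair_grid H pp; have := pair_lt H pp; have := pair_adj H pp bcol.
  have := Hsp _ _ bcol pc1; move/eqP: (pb p pp); rewrite /d; move: g0; clear; lia.
have At := levelA_range H.
have [Ha _] := item_src H Ea; rewrite /= in Ha.
have xalh := row_vertices H Ha; have /and3P[_ _ tA] := place_height H Ha.
have hx : hi < x by move: hib bx; clear; lia.
have H1 : layout e S z set0 set0 M vp ed top lo hi (Some (a,z)) ((d, -3) :: (x, -3) :: FL) A AF prs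
    (d :: x :: cols) rows.
  apply: addcol; last first.
  - by move=> p /PF; move: xd bx; item_lia.
  - exact: dn.
  apply: addcol => // p /PF; move: xd bx; item_lia.
have xF1 : (x, -3) \in ((d, -3) :: (x, -3) :: FL) by rewrite !inE eqxx orbT.
have H2 : layout e S z set0 set0 M (upd vp z (x, top)) ed top lo x (Some (a,z)) ((d, -3) :: (x, -3) :: FL) A AF prs
    (d :: x :: cols) rows.
  apply: (place_free H1 Hz xF1) => //.
  - by move: At; clear; lia.
  - by move: hx; clear; lia.
  - by right; exists a.
  - by move=> _; rewrite lexx (ltW hx).
  - by move: xalh hx; clear; lia.
have rx : x < r by move: dc' xd c'r; clear; lia.
have H3 := cut eirr H2 erefl Ea (updE _ _ _) (ltac:(move: xalh hx; clear; lia)) rx.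
set ed3 := upd ed _ _ in H3; set FL3 := (r, top - 1) :: _ in H3.
have z'o : z' \in outs e S z by rewrite inE ezz'.
have oT : (#|outs e S z :\ z'| <= 2)%N by apply: card_outs1; rewrite // nSz cards1.
have dx : d != x by move: xd; clear; lia.
have [o1 [o2 [k1 k2 cov]]] := choose2o esym H3 (mates_sym mg) (mates_fun mg) (mates_one mg) (mates_far mg)
   (subsetDl _ _) oT dx.
(* The two columns count as a pair only if the downward edge exists; otherwise nothing links them on
   level 0. *)
pose prs4 := if o1 is Some _ then (x, d) :: prs else prs.
pose FL4 := if o1 is Some _ then (x, top) :: dropc x (dropc d FL3) else FL3.
pose ed4 := upd_opt ed3 z o1 (pending x top 0 d).
have H4 : layout e S z (a |: set0) (add_opt o1 set0) M (upd vp z (x, top)) ed4 top lo x None FL4 A AF prs4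
    (d :: x :: cols) rows.
  rewrite /FL4 /prs4 /ed4; case: (o1) k1 => [w|] k1 //.
  have [ew wS mw] := k1 w erefl.
  have xF3 : (x, -3) \in FL3 by rewrite !inE eqxx !orbT.
  have dF3 : (d, -3) \in FL3 by rewrite !inE eqxx !orbT.
  apply: (add_down eirr H3 (updE _ _ _) xF3 dF3 _ _ _ _ _ _ _ (fun _ => conj erefl xd) _ (fun _ h => h)) => //.
  - by move: At; clear; lia.
  - by case/andP: (level_grid H3) => /andP[].
  - move=> k i y E oi; have [p pp py] := level0 H3 E oi.
    by move: (PF p pp) py bx xd; item_lia.
  - by move=> w' y /(place_height H3); clear; lia.
  - right; split=> //.
    + move=> c; rewrite !inE => /or3P[/eqP->|/eqP->|cc].
      * by rewrite lexx orbT.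
      * by rewrite lexx.
      * by have := Hsp _ _ bcol cc; rewrite /x /d; move: g0; clear; lia.
    + by move=> q /PF; move: bx xd; item_lia.
  - by move=> A0; exfalso; move: At; rewrite -A0; clear; lia.
have [h xF4 ht] : exists2 h, (x, h) \in FL4 & h <= top.
  rewrite /FL4; case: (o1) => [w|]; first by exists top; rewrite ?mem_head.
  by exists (-3); rewrite ?inE ?eqxx ?orbT //; move: At; clear; lia.
(* The new pair cannot create a conflict by itself, because both of its edges start at [z] and no
   two neighbours of [z] are mates. *)
have ok2 : admissible e S z M ed4 prs4 o2 x.
  move=> w ow; have [ew wS mw] := k2 w ow; split=> // p k i pp E fi.
  have pE : x = p.1 \/ x = p.2 -> p = (x, d).
    have pold : p \in prs -> ~ (x = p.1 \/ x = p.2).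
      by move=> pp'; move: (PF p pp') (pair_lt H pp') bx xd; item_lia.
    by move: pp; rewrite /prs4; case: (o1) => [w1|]; rewrite ?inE; [case/orP => [/eqP//|]|] => /pold.
  have kd : iX i = d -> exists2 w1, e z w1 & k.2 = w1.
    move=> id; case o1E : (o1) => [w1|]; last first.
      have := pend_notin_FL H4 (-3) E fi.
      by rewrite id /FL4 o1E !inE eqxx !orbT.
    have [ew1 _ _] := k1 w1 o1E; exists w1 => //.
    have E1 : ed4 (z, w1) = Some (pending x top 0 d) by rewrite /ed4 o1E /= updE.
    by have -> := pend_inj H4 E E1 fi isT id.
  split=> [xp ip m|xp ip m].
    rewrite (pE (or_introl xp)) /= in ip; have [w1 ew1 k2E] := kd ip.
    by apply: (mates_far mg ew ew1); rewrite -k2E.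
  by have := pE (or_intror xp) => pE'; move: xp xd; rewrite pE' /= => ->; rewrite ltxx.
have H5 := emit_up eirr H4 (updE _ _ _) xF4 ht ok2.
have {}H5 := weaken (FL' := dropc x (drop_opt x o2 FL4)) (M' := M) H5 (fun x => @mem_subseq _ _ _ (filter_subseq _ _) x)
   (dropc_uniq x (free_uniq H5)) (fun _ h => h) (fun _ _ _ _ _ _ _ _ m => m).
set ed5 := upd_opt ed4 _ _ _ in H5; set FL5 := dropc x _ in H5.
have keepF f h0 : f != x -> f != d -> (f, h0) \in FL3 -> (f, h0) \in FL5.
  move=> fx fd fF; rewrite mem_filter /= fx; apply: dropo_keep => //.
  by rewrite /FL4; case: (o1) => [w|] //; rewrite inE !mem_filter /= fx fd fF orbT.
have rF5 : (r, top - 1) \in FL5.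
  by apply: keepF; rewrite ?mem_head //; [move: rx|move: dc' c'r]; clear; lia.
have H6 := add_side (w := z') (lo' := lo) (hi' := x) (xc' := Some (z, z')) eirr H5 (updE _ _ _) rF5
  (ltac:(clear; lia)) (ltac:(move: rx; clear; lia)) (ltac:(move=> y; move: rx; item_lia)) erefl (lexx _) (lexx _) (or_intror erefl)
  ezz' z'S (fun p k i _ _ _ => conj (fun _ _ m => (nM _).1 m) (fun _ _ m => (nM _).2 m)).
set ed6 := upd ed5 _ _ in H6.
have vz' : vp z' = None.
  by case E : (vp z') => [p|//]; case: (placed_in H E) => [|/eqP]; rewrite ?(negPf z'S) ?(negPf z'z).
have H7 : layout e (z |: S) z' set0 set0 M (upd vp z (x, top)) ed6 top lo x (Some (z, z')) (dropc r FL5) A AF prs4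
    (d :: x :: cols) rows.
  apply: (close esym eirr H6) => //.
  - by rewrite updN.
  - by rewrite updE.
  - move=> u uS euz; have : u \in nS e S z by rewrite inE uS esym.
    by rewrite nSz => /set1P ->; rewrite !inE eqxx.
  - move=> w ezw wS; rewrite in_setU1; have [//|wz'] := eqVneq w z'; rewrite /=.
    have /cov : w \in outs e S z :\ z' by rewrite !inE wz' ezw.
    by case=> ->; do 2! (apply/addo_in; (try by left); right).
  - by move=> [c h'] y /dropcP[_ /dropcP[/= cx _]]; rewrite updE => -[xc _]; rewrite xc eqxx in cx.
(* The next inner vertex goes right after [d], a column that is the left one of no pair. *)
exists (upd vp z (x, top)), ed6, x, (dropc r FL5), prs4, (d :: x :: cols), d; split; last first.
  split; rewrite ?inE ?eqxx ?(ltW xd) //.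
  have pold p : p \in prs -> p.1 != d by move=> pp; apply/eqP => p1d; have /andP[] := pair_grid H pp; rewrite p1d; move: dn; rewrite inE negb_or => /andP[_ /negPf ->].
  rewrite /prs4; case: (o1) => [w|]; last exact: pold.
  by move=> p; rewrite inE => /orP[/eqP->/=|/pold//]; rewrite eq_sym.
split=> //.
- by split; rewrite updN // eq_sym.
- by exists x; rewrite /ed6 updE.
- split=> //; first by apply: lt_trans dc'.
  exists i'; split=> //; rewrite /ed6 /ed5 /ed4 /ed3.
  have s'S : s' \in S by case: (item_status H El) => _ [[]|[_]]; rewrite ?inE.
  have s'z : s' != z by apply: contraNneq zS => <-.
  have up1 f w j : @upd _ item f (z, w) j (s', item_lia) = f (s', item_lia).
    by rewrite updN //; apply: contraNneq s'z => -[->].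
  have upo1 f o j : upd_opt f z o j (s', item_lia) = f (s', item_lia) by case: o => [w|] //=.
  rewrite up1 !upo1 updN //; by apply: contraNneq zlz => -[_ ->].
have npool f : f \in AF ++ G -> [&& f != x, f != d & f != r].
  move=> fP; have [h0 fF] := pool_in Hp fP; have fc := free_grid H fF; rewrite /= in fc.
  apply/and3P; split.
  - by apply: contraNneq xn => <-.
  - by apply: contraNneq dn => <-; rewrite inE fc orbT.
  - by apply/eqP => fr; have := pend_notin_FL H h0 Ea isT; rewrite /= -fr fF.
split=> //.
- have [u0 a0 b0] := Hp.
  have kF f h0 : f \in AF ++ G -> (f, h0) \in FL -> (f, h0) \in dropc r FL5.
    move=> /npool/and3P[fx fd fr] fF; rewrite mem_filter /= fr; apply: keepF => //.
    by rewrite !inE fF !orbT.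
  split=> // f fA.
    by have [h0 hA hF] := a0 f fA; exists h0 => //; apply: kF => //; rewrite mem_cat fA.
  by have [h0 hA hF] := b0 f fA; exists h0 => //; apply: kF => //; rewrite mem_cat fA orbT.
- by move: HW; rewrite /= mulnS !addSn add0n !addnS.
Qed.

(** The far end sits on the column of its own incoming edge. Cutting the last chain edge releases
    [r], which then serves for an edge leaving to the right. *)
Lemma chain_end S a z s' W' B' vp ed top lo hi FL A AF G prs cols rows c' r :
  midstate S a z s' z W' B' 0 vp ed top lo hi FL A AF G prs cols rows c' r ->
  mates_ok e S z M -> nS e S z = [set a; s'] -> a != s' -> z != t ->
  drawn e t K (z |: S) M W' B'.
Proof.
case=> H [Hz Ht] [xa Ea] [hc' c'r [i' [El fl' tl Xl]]] [Hp Hs Hsp HW HB].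
move=> mg nSz as' zt; have zS := cur_new H; have At := levelA_range H.
have [Ha _] := item_src H Ea; rewrite /= in Ha.
have xalh := row_vertices H Ha; have /and3P[_ _ tA] := place_height H Ha.
have xac' : xa < c' by move: xalh hc'; clear; lia.
have H1 : layout e S z set0 set0 M (upd vp z (c', top)) ed top lo c' (Some (a,z)) FL A AF prs cols rows.
  rewrite -Xl; rewrite -Xl in hc' xac'; apply: (place_pend H Hz El fl' tl) => //.
  - by move: hc'; clear; lia.
  - by right; exists a.
  - by move=> _; rewrite lexx (ltW hc').
  - by move: xalh xac'; clear; lia.
have H2 := cut eirr H1 erefl Ea (updE _ _ _) xac' c'r.
have El' : upd ed (a, z) (Item xa top top c' true top c' top) (s', z) = Some i'.
  by rewrite updN //; apply: contraNneq as' => -[->].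
have H3 := fin_D eirr H2 El' fl' tl (ltac:(by rewrite Xl updE)).
rewrite Xl in H3.
have oT : (#|outs e S z| <= 2)%N.
  have := card_deg e4 S z; rewrite nSz cards2 as'.
  by rewrite -[4%N]/(2 + 2)%N leq_add2l.
have rc' : r != c' by move: c'r; clear; lia.
have [o1 [o2 [k1 k2 cov]]] := choose2o esym H3 (mates_sym mg) (mates_fun mg) (mates_one mg) (mates_far mg)
   (subxx _) oT rc'.
have k1e w : o1 = Some w -> e z w by move=> /k1[].
have rF : (r, top - 1) \in [:: (c', top), (r, top - 1) & FL] by rewrite !inE eqxx orbT.
have H4 := emit_side (lo' := lo) (hi' := r) eirr H3 (updE _ _ _) rF
   (ltac:(clear; lia)) (or_intror (conj c'r erefl)) (lexx _) (ltW c'r)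
   (ltac:(move: xalh c'r xac'; clear; lia)) k1.
have cF : (c', top) \in drop_opt r o1 [:: (c', top), (r, top - 1) & FL].
  by apply: dropo_keep; rewrite ?mem_head // eq_sym.
have H5 := emit_up eirr H4 (updE _ _ _) cF (lexx _) (oko_upo _ (mates_far mg) k1e k2).
have npool f : f \in AF ++ G -> (f != c') && (f != r).
  move=> fP; have [h0 fF] := pool_in Hp fP; apply/andP; split; apply/eqP => fE.
    by have := pend_notin_FL H h0 El fl'; rewrite Xl -fE fF.
  by have := pend_notin_FL H h0 Ea isT; rewrite /= -fE fF.
do 12! eexists; apply: (wrap (G := G) esym eirr zt H5) => //.
- by rewrite updN // eq_sym.
- by apply/negP => tS; case: (in_placed H tS).
- exact: updE.
- move=> u uS euz; have : u \in nS e S z by rewrite inE uS esym.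
  by rewrite nSz !inE => /orP[]/eqP ->; rewrite eqxx ?orbT.
- move=> w ew wS; have : w \in outs e S z by rewrite inE ew wS.
  by case/cov => ->; do 2! (apply/addo_in; (try by left); right).
- exact: dropo_case.
- apply: pool_dropo; first by apply/negP => /npool; rewrite eqxx.
  apply: pool_dropo; first by apply/negP => /npool; rewrite eqxx andbF.
  by do 2! apply: pool_uncons.
- by apply: (spaced_le Hsp); apply: pow4_mono; rewrite (card_setC_add zS) leqnSn.
- by rewrite muln0 addn0 in HW.
Qed.

Lemma bounded (cols : seq int) : exists m : int, forall c, c \in cols -> - m < c < m.
Proof.
elim: cols => [|c cols [m IH]]; first by exists 0.
exists (`|m| + `|c| + 1) => x; rewrite inE => /orP[/eqP ->|/IH]; clear; lia.
Qed.

(** The two columns of the chain not due to inner vertices are [l] and [r], added beyond all others: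
    [l] for an edge leaving the first vertex to the left, [r] for the provisional chain edges and
    finally for the far end. *)
Lemma chain_begin (M0 : V -> V -> Prop) S W B vp ed top lo hi FL A AF G prs cols rows z z' item_lia s s' i i' n :
  stage e t K S M0 W B vp ed top lo hi FL A AF G prs cols rows ->
  (forall a b, M a b -> M0 a b) -> mates_ok e S z M -> (forall b, ~ M z' b /\ ~ M b z') ->
  z \notin S -> z != t -> nS e S z = [set s] -> e z z' -> z' \notin S -> z' != t -> item_lia != z ->
  ed (s, z) = Some i -> ~~ ifin i -> iy i <= top ->
  ed (s', item_lia) = Some i' -> ~~ ifin i' -> iy i' <= top -> iX i < iX i' ->
  ((0 < n)%N -> M0 z item_lia) ->
  exists vp' ed' top' lo' hi' FL' A' AF' G' prs' cols' rows' c' r,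
    midstate (z |: S) z z' s' item_lia (W + 2 * n.+1) (B + K.+3) n vp' ed' top' lo' hi' FL' A' AF' G' prs' cols' rows' c' r /\
    ((0 < n)%N -> exists base, basecol prs' cols' hi' c' base).
Proof.
move=> D M0M mg nM zS zt nSz ezz' z'S z't zlz E fi it E' fi' it' cc' mate.
have [H0 Hz] := cur D zS; case: (D) => _ [Ht Hp Hs Hsp [HW HB]].
have H := weaken (M' := M) H0 (fun _ h => h) (free_uniq H0) (fun _ h => h) (fun _ _ _ _ _ _ _ _ m => M0M _ _ m).
have z'z : z' != z by apply: contraTneq ezz' => ->; rewrite eirr.
have [m bm] := bounded cols.
pose g : int := 2 * 4 ^+ #|~: S|.
have g0 : 0 < g by rewrite /g mulr_gt0 // exprn_gt0.
pose r := m + g; pose l := - m - g.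
have ccol : iX i \in cols by have /and4P[] := src_grid H E.
have c'col : iX i' \in cols by have /and4P[] := src_grid H E'.
have m0 : 0 < m by have := bm _ ccol; clear; lia.
have rn : r \notin cols by apply/negP => /bm; rewrite /r; move: g0; clear; lia.
have ln : l \notin r :: cols.
  rewrite inE negb_or; apply/andP; split; first by rewrite /l /r; move: g0 m0; clear; lia.
  by apply/negP => /bm; rewrite /l; move: g0; clear; lia.
have H1 : layout e S z set0 set0 M vp ed top lo hi None ((l, -3) :: (r, -3) :: FL) A AF prs
    (l :: r :: cols) rows.
  apply: addcol; last first.
  - by move=> p pp; have /andP[/bm a1 /bm a2] := pair_grid H pp; rewrite /l; move: a1 a2 g0; clear; lia.
  - exact: ln.
  apply: addcol => // p pp; have /andP[/bm a1 /bm a2] := pair_grid H pp; rewrite /r; move: a1 a2 g0; clear; lia.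
have H2 := start_one eirr H1 Hz E fi it.
set ed2 := upd ed _ _ in H2; set FL2 := (iX i, top + 2) :: _ in H2.
have z'o : z' \in outs e S z by rewrite inE ezz'.
have oT : (#|outs e S z :\ z'| <= 2)%N by apply: card_outs1; rewrite // nSz cards1.
have lc : l < iX i by have := bm _ ccol; rewrite /l; move: g0; clear; lia.
have c'r : iX i' < r by have := bm _ c'col; rewrite /r; move: g0; clear; lia.
have cr := lt_trans cc' c'r.
have lc' : l != iX i by move: lc; clear; lia.
have [o1 [o2 [k1 k2 cov]]] := choose2o esym H2 (mates_sym mg) (mates_fun mg) (mates_one mg) (mates_far mg)
   (subsetDl _ _) oT lc'.
have k1e w : o1 = Some w -> e z w by move=> /k1[].
have At := levelA_range H.
have lF : (l, -3) \in FL2 by rewrite !inE eqxx orbT.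
have H3 := emit_side (lo' := l) (hi' := iX i) eirr H2 (updE _ _ _) lF
   (ltac:(move: At; clear; lia)) (or_introl (conj lc erefl)) (ltW lc) (lexx _)
   (ltac:(by rewrite lexx (ltW lc))) k1.
have cF : (iX i, top + 2) \in drop_opt l o1 FL2.
  by apply: dropo_keep; rewrite ?mem_head // eq_sym.
have H4 := emit_up eirr H3 (updE _ _ _) cF (lexx _) (oko_upo _ (mates_far mg) k1e k2).
set ed4 := upd_opt (upd_opt _ _ _ _) _ _ _ in H4.
have rc : r != iX i by move: cr; clear; lia.
have rl : r != l by move: cr lc; clear; lia.
have rF : (r, -3) \in drop_opt (iX i) o2 (drop_opt l o1 FL2).
  by do 2! apply: dropo_keep => //; rewrite !inE eqxx !orbT.
have H5 := add_side (w := z') (lo' := l) (hi' := iX i) (xc' := Some (z, z')) eirr H4 (updE _ _ _) rF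
  (ltac:(move: At; clear; lia)) rc (ltac:(move=> y; move: cr; item_lia)) erefl (lexx _) (lexx _) (or_intror erefl)
  ezz' z'S (fun p k i _ _ _ => conj (fun _ _ m => (nM _).1 m) (fun _ _ m => (nM _).2 m)).
set ed5 := upd ed4 _ _ in H5; set FL5 := dropc r _ in H5.
have vz' : vp z' = None.
  by case Ez : (vp z') => [p|//]; case: (placed_in H Ez) => [|/eqP]; rewrite ?(negPf z'S) ?(negPf z'z).
have H7 : layout e (z |: S) z' set0 set0 M (upd vp z (iX i, top + 2)) ed5 (top + 2) l (iX i) (Some (z, z')) FL5 A AF prs
    (l :: r :: cols) (top + 2 :: rows).
  apply: (close esym eirr H5) => //.
  - by rewrite updN.
  - by rewrite updE.
  - move=> u uS euz; have : u \in nS e S z by rewrite inE uS esym.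
    by rewrite nSz => /set1P ->; rewrite !inE eqxx.
  - move=> w ezw wS; rewrite in_setU1; have [//|wz'] := eqVneq w z'; rewrite /=.
    have /cov : w \in outs e S z :\ z' by rewrite !inE wz' ezw.
    by case=> ->; do 2! (apply/addo_in; (try by left); right).
  - move=> [c h] y /dropcP[/= cr' cF']; rewrite updE => -[xc <-].
    have cF2 : (iX i, h) \in drop_opt (iX i) o2 (drop_opt l o1 FL2) by rewrite {1}xc.
    case: (dropo_case o2 cF) => [h1|h1]; last by move: (h1 h); rewrite cF2.
    by rewrite (FL_inj (free_uniq H4) cF2 h1).
exists (upd vp z (iX i, top + 2)), ed5, (top + 2), l, (iX i), FL5, A, AF, G, prs, (l :: r :: cols), (top + 2 :: rows), (iX i'), r.
split; last first.
  move/mate => mzz.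
  (* Here the separation of mates is used. If the column of the first vertex opens a pair, the
     insertion moves past its right column, and this is still left of the far end because
     [mates_split] excludes that the far end waits there. *)
  have [/hasP[p pp /eqP pc]|/hasPn no] := boolP (has (fun p : int * int => p.1 == iX i) prs).
    have /andP[_ p2c] := pair_grid H pp; have p12 := pair_lt H pp; exists p.2; split.
    - by rewrite !inE p2c !orbT.
    - by rewrite -pc ltW.
    - have := pair_adj H pp c'col; have : iX i' != p.2.
        by apply/eqP => X2; case: (mates_split H0 pp E E' fi fi' (Logic.eq_sym pc) X2).
      by rewrite pc; move: cc'; clear; lia.
    - move=> q qq; have [->|qp] := eqVneq q p; first by move: p12; clear; lia.
      by have := pair_disj H qq pp qp; have := pair_lt H qq; move: p12; clear; lia.
  by exists (iX i); split; rewrite ?inE ?ccol ?orbT.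
split=> //.
- by split; rewrite updN // eq_sym.
- by exists (iX i); rewrite /ed5 updE.
- split=> //; exists i'; split=> //; last by move: it'; clear; lia.
  have s'S : s' \in S by case: (item_status H E') => _ [[]|[_]]; rewrite ?inE.
  have s'z : s' != z by apply: contraNneq zS => <-.
  have up1 f w j : @upd _ item f (z, w) j (s', item_lia) = f (s', item_lia).
    by rewrite updN //; apply: contraNneq s'z => -[->].
  have upo1 f o j : upd_opt f z o j (s', item_lia) = f (s', item_lia) by case: o => [w|] //=.
  rewrite /ed5 /ed4 /ed2 up1 !upo1 updN //; by apply: contraNneq zlz => -[_ ->].
have npool f : f \in AF ++ G -> [&& f != l, f != r & f != iX i].
  move=> fP; have [h0 fF] := pool_in Hp fP; have fc := free_grid H fF; rewrite /= in fc.
  apply/and3P; split.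
  - by apply: contraNneq ln => <-; rewrite inE fc orbT.
  - by apply: contraNneq rn => <-.
  - by apply/eqP => fr; have := pend_notin_FL H h0 E fi; rewrite /= -fr fF.
split=> //.
- apply: pool_dropc; first by apply/negP => /npool; rewrite eqxx andbF.
  apply: pool_dropo; first by apply/negP => /npool; rewrite eqxx !andbF.
  apply: pool_dropo; first by apply/negP => /npool; rewrite eqxx.
  do 3! apply: pool_uncons; apply: pool_top Hp _; clear; lia.
- apply: (@spaced_le _ g); last by apply: pow4_mono; rewrite (card_setC_add zS) leqnSn.
  move=> x y; rewrite !inE => /or3P[/eqP->|/eqP->|xc] /or3P[/eqP->|/eqP->|yc]; rewrite /l /r.
  + by clear; lia.
  + by move: g0 m0; clear; lia.
  + by have := bm _ yc; clear; lia.
  + by move: g0 m0; clear; lia.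
  + by clear; lia.
  + by have := bm _ yc; move: g0; clear; lia.
  + by have := bm _ xc; move: g0; clear; lia.
  + by have := bm _ xc; clear; lia.
  + exact: Hsp.
- by rewrite /= mulnS addnA addnC; move: HW; clear; lia.
- by apply: (row_count D (j := 0)) => //; rewrite subn0.
Qed.

Definition pchain (S : {set V}) (C : seq V) :=
  [/\ (1 < size C)%N, sorted e C,
      forall p x q y r, C = p ++ x :: q ++ y :: r -> q != [::] -> ~~ e x y,
      forall p x q, C = p ++ x :: q -> p != [::] -> q != [::] -> nS e S x = set0 &
      forall z C', C = z :: C' ->
        exists s s', [/\ s != s', nS e S z = [set s] & nS e S (last z C') = [set s']]].

Lemma pchain_rev S C : pchain S C -> pchain S (rev C).
Proof.
have rn (q : seq V) : q != [::] -> rev q != [::] by rewrite -!size_eq0 size_rev.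
case=> sC so ch mid en; split.
- by rewrite size_rev.
- by rewrite rev_sorted (eq_sorted (e' := e)) // => x y /=; rewrite esym.
- move=> p x q y r rE qn; rewrite esym; apply: (ch (rev r) y (rev q) x (rev p)); last exact: rn.
  by rewrite -[C]revK rE !(rev_cat, rev_cons) -!cats1 -!catA.
- move=> p x q rE pn qn; apply: (mid (rev q) x (rev p)); rewrite ?rn //.
  by rewrite -[C]revK rE rev_cat rev_cons -cats1 -catA.
- move=> z C' rE; have CE : C = rcons (rev C') z by rewrite -[C]revK rE rev_cons.
  clear so ch mid; case: C => [//|y D] in rE CE en sC *.
  have [s [s' [ss' nz nl]]] := en y D erefl; exists s', s; split; first by rewrite eq_sym.
    by rewrite -nl; congr (nS e S _); have := congr1 (last y) CE; rewrite /= last_rcons.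
  rewrite -nz; congr (nS e S _); have := congr1 (last y) rE.
  by rewrite rev_cons last_rcons /= => <-.
Qed.

(** An induced path has no edge from [z] back into [p], so drawing the prefix adds only [a] to the
    drawn neighbours of [z]. *)
Lemma nS_prefix S C p a z q : pchain S C -> C = rcons p a ++ z :: q ->
  e a z /\ nS e (S :|: [set x in rcons p a]) z = a |: nS e S z.
Proof.
case=> sC so ch mid en CE.
have eaz : e a z.
  by move: so; rewrite CE cat_rcons => /cat_sorted2[_] /= /andP[].
split=> //; apply/setP => s; rewrite !inE mem_rcons inE.
have [->|sa] := eqVneq s a; first by rewrite orbT esym eaz.
rewrite /= orbC; case: (boolP (s \in p)) => //= sp.
have nes : ~~ e z s.
  case/splitPr: p / sp CE => p1 p2 CE.
  rewrite esym; apply: (ch p1 s (rcons p2 a) z q); last by case: (p2).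
  by rewrite CE rcons_cat /= -catA.
by rewrite (negPf nes) andbF.
Qed.

Lemma chain_loop (S U : {set V}) C item_lia s' W' B' : pchain S C -> uniq C -> item_lia = last item_lia C ->
  nS e S item_lia = [set s'] ->
  S :|: [set x in C] \subset U -> (forall y, y \in C -> y \notin S /\ y != t) ->
  (forall (T : {set V}) y, T \subset U -> y \in U -> mates_ok e T y M) ->
  (forall y b, y \in U -> ~ M y b /\ ~ M b y) ->
  forall q p a z vp ed top lo hi FL A AF G prs cols rows c' r,
    C = rcons p a ++ z :: q ->
    midstate (S :|: [set x in rcons p a]) a z s' item_lia W' B' (size q)
      vp ed top lo hi FL A AF G prs cols rows c' r ->
    ((0 < size q)%N -> exists base, basecol prs cols hi c' base) ->
    drawn e t K (S :|: [set x in C]) M W' B'.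
Proof.
move=> pC uC zlE nl CU CS mg nM; elim=> [|z' q IH] p a z vp ed top lo hi FL A AF G prs cols rows c' r CE st bs.
  have [eaz nz] := nS_prefix pC CE.
  have zE : item_lia = z by move: zlE; rewrite CE last_cat.
  rewrite zE in st nl.
  have -> : S :|: [set x in C] = z |: (S :|: [set x in rcons p a]).
    by apply/setP => x; rewrite CE !inE mem_cat !inE; case: (x \in S); case: (x \in rcons p a); case: (x == z).
  apply: (chain_end st).
  - apply: mg; last by apply: (subsetP CU); rewrite !inE CE mem_cat mem_head !orbT.
    apply: subset_trans CU; apply: setUS; apply/subsetP => x; rewrite !inE CE mem_cat => ->; exact: isT.
  - by rewrite nz nl.
  - have aC : a \in C by rewrite CE mem_cat mem_rcons mem_head.
    have [aS _] := CS a aC; apply: contraNneq aS => ->.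
    have : s' \in nS e S z by rewrite nl set11.
    by rewrite inE => /andP[].
  - by have [] := CS z; rewrite // CE mem_cat mem_head orbT.
have [eaz nz] := nS_prefix pC CE.
have CE' : C = rcons (rcons p a) z ++ z' :: q by rewrite CE [in RHS]cat_rcons.
have [ezz' nz'] := nS_prefix pC CE'.
have zC : z \in C by rewrite CE mem_cat mem_head orbT.
have z'C : z' \in C by rewrite CE' mem_cat mem_head orbT.
have [base bc] := bs isT.
have nz0 : nS e S z = set0.
  by case: pC => _ _ _ mid _; apply: (mid (rcons p a) z (z' :: q)) => //; case: (p).
have inU y : y \in C -> y \in U by move=> yC; apply: (subsetP CU); rewrite !inE yC orbT.
have z'p : z' \notin rcons (rcons p a) z.
  by move: uC; rewrite CE' cat_uniq => /and3P[_ /hasPn/(_ z' (mem_head _ _))].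
have zlz : item_lia != z.
  have zlq : item_lia \in z' :: q by rewrite zlE CE' last_cat /= mem_last.
  apply: contraTneq zlq => ->; move: uC; rewrite CE cat_uniq => /and3P[_ _] /=.
  by case/andP.
have [vp' [ed' [hi' [FL' [prs' [cols' [base' [st' bc']]]]]]]] :
  exists vp' ed' hi' FL' prs' cols' base',
    midstate (z |: (S :|: [set x in rcons p a])) z z' s' item_lia W' B' (size q) vp' ed' top lo hi' FL' A AF G prs' cols' rows c' r /\
    basecol prs' cols' hi' c' base'.
  apply: (chain_mid st bc) => //.
  - apply: mg (inU _ zC); apply: subset_trans CU; apply: setUS.
    apply/subsetP => x; rewrite !inE CE mem_cat => ->; exact: isT.
  - by move=> b; apply: nM; apply: inU.
  - by rewrite nz nz0 setU0.
  - have [z'S _] := CS _ z'C; rewrite !inE negb_or z'S /=; apply: contra z'p.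
    by move=> z'a; rewrite !(mem_rcons, inE); move: z'a; rewrite !(mem_rcons, inE) => ->; rewrite orbT.
  - by have [] := CS _ z'C.
  - by have [] := CS _ zC.
apply: (IH (rcons p a) z z' vp' ed' top lo hi' FL' A AF G prs' cols' rows c' r CE').
  rewrite (_ : S :|: _ = z |: (S :|: [set x in rcons p a])) //.
  by apply/setP => x; rewrite !inE mem_rcons inE; case: (x \in S); case: (x == z).
by move=> _; exists base'.
Qed.

Lemma draw_chain_lt (S U : {set V}) C M0 W B vp ed top lo hi FL A AF G prs cols rows z item_lia s s' i i' :
  stage e t K S M0 W B vp ed top lo hi FL A AF G prs cols rows -> pchain S C -> uniq C ->
  (forall a b, M a b -> M0 a b) ->
  S :|: [set x in C] \subset U -> (forall y, y \in C -> y \notin S /\ y != t) ->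
  (forall (T : {set V}) y, T \subset U -> y \in U -> mates_ok e T y M) ->
  (forall y b, y \in U -> ~ M y b /\ ~ M b y) ->
  (exists q, C = z :: q) -> item_lia = last item_lia C -> ((2 < size C)%N -> M0 z item_lia) ->
  nS e S z = [set s] -> nS e S item_lia = [set s'] -> item_lia != z ->
  [/\ ed (s, z) = Some i, ~~ ifin i & iy i <= top] ->
  [/\ ed (s', item_lia) = Some i', ~~ ifin i' & iy i' <= top] -> iX i < iX i' ->
  drawn e t K (S :|: [set x in C]) M (W + 2 * (size C).-1) (B + K.+3).
Proof.
move=> D pC uC MM CU CS mg nM [[|z' q] CE] zlE mate nz nl zlz [E fi it] [E' fi' it'] lt.
  by case: pC; rewrite CE.
have zC : z \in C by rewrite CE mem_head.
have z'C : z' \in C by rewrite CE !inE eqxx orbT.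
have [z'S z't] := CS z' z'C; have [zS zt] := CS z zC.
have ezz' : e z z' by case: pC => _; rewrite CE /= => /andP[].
have inU y : y \in C -> y \in U by move=> yC; apply: (subsetP CU); rewrite !inE yC orbT.
have SU : S \subset U by apply: subset_trans CU; apply: subsetUl.
have mate' : (0 < size q)%N -> M0 z item_lia by move=> q0; apply: mate; rewrite CE /= !ltnS.
have [vp1 [ed1 [top1 [lo1 [hi1 [FL1 [A1 [AF1 [G1 [prs1 [cols1 [rows1 [c' [r [st bs]]]]]]]]]]]]]]] :=
  chain_begin (n := size q) D MM (mg S z SU (inU _ zC)) (fun b => nM z' b (inU _ z'C))
    zS zt nz ezz' z'S z't zlz E fi it E' fi' it' lt mate'.
have szE : size C = (size q).+2 by rewrite CE.
rewrite szE /=.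
apply: (@chain_loop S U C item_lia s' _ _ pC uC zlE nl CU CS mg nM q [::] z z' vp1 ed1 top1 lo1 hi1 FL1 A1 AF1 G1 prs1 cols1 rows1 c' r) => //.
by rewrite (_ : S :|: _ = z |: S) //; apply/setP => x; rewrite !inE orbC.
Qed.

(** The pending edges to the two ends stand on different columns, and reversing the chain if
    necessary puts its first vertex on the left one. The whole chain pays for a single row. *)
Lemma draw_chain (S U : {set V}) C M0 W B : drawn e t K S M0 W B -> pchain S C -> uniq C ->
  (forall a b, M a b -> M0 a b) ->
  S :|: [set x in C] \subset U -> (forall y, y \in C -> y \notin S /\ y != t) ->
  (forall (T : {set V}) y, T \subset U -> y \in U -> mates_ok e T y M) ->
  (forall y b, y \in U -> ~ M y b /\ ~ M b y) ->
  (forall z C', C = z :: C' -> (2 < size C)%N -> M0 z (last z C') /\ M0 (last z C') z) ->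
  drawn e t K (S :|: [set x in C]) M (W + 2 * (size C).-1) (B + K.+3).
Proof.
move=> [vp [ed [top [lo [hi [FL [A [AF [G [prs [cols [rows D]]]]]]]]]]]] pC uC MM CU CS mg nM mate.
have [sC _ _ _ en] := pC.
have [z [C' CE]] : exists z C', C = z :: C' by case: (C) sC => // z C' _; exists z, C'.
have [s [s' [ss' nz nl]]] := en z C' CE.
have [item_lia zlE] : {item_lia | item_lia = last z C'} by exists (last z C').
rewrite -zlE in nl.
have [zC zlC] : z \in C /\ item_lia \in C by rewrite CE zlE mem_last mem_head.
have [[zS _] [zlS _]] := (CS z zC, CS item_lia zlC).
have zlz : item_lia != z.
  rewrite zlE; move: sC uC; rewrite CE; case: (C') => // y C'' _ /= /andP[zn _].
  by apply: contraNneq zn => <-; rewrite mem_last.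
have pend y u : nS e S y = [set u] -> y \notin S -> exists i, [/\ ed (u, y) = Some i, ~~ ifin i & iy i <= top].
  move=> ny yS; have [H _] := cur D yS.
  have : u \in nS e S y by rewrite ny set11.
  by rewrite inE => /andP[uS eyu]; apply: (pending_edge eirr H uS); rewrite 1?esym ?inE.
have [i P] := pend _ _ nz zS; have [i' P'] := pend _ _ nl zlS.
have last1 : item_lia = last item_lia C by rewrite CE zlE.
have m2 : (2 < size C)%N -> M0 z item_lia /\ M0 item_lia z by rewrite zlE; exact: mate.
have [lt|lt|X] := ltgtP (iX i) (iX i'); last first.
- have [H _] := cur D zS; case: P P' => [E fi _] [E' fi' _].
  by case: (pend_inj H E E' fi fi' X) => _ zz; rewrite zz eqxx in zlz.
- have := draw_chain_lt (C := rev C) (z := item_lia) (item_lia := z) D (pchain_rev pC) _ MM.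
  have -> : [set x in rev C] = [set x in C] by apply/setP => x; rewrite !inE mem_rev.
  rewrite rev_uniq size_rev => /(_ U s' s i' i uC CU _ mg nM _ _ _ nl nz _ P' P lt); apply.
  + by move=> y; rewrite mem_rev; exact: CS.
  + have revE : C = rcons (belast z C') item_lia by rewrite CE lastI zlE.
    by exists (rev (belast z C')); rewrite revE rev_rcons.
  + by rewrite CE rev_cons last_rcons.
  + by move/m2 => [].
  + by rewrite eq_sym.
- apply: (draw_chain_lt D pC uC MM CU CS mg nM _ last1 _ nz nl zlz P P' lt); first by exists C'.
  by move/m2 => [].
Qed.
End ChainOps.

(** * The whole ordering *)

Local Close Scope ring_scope.

Section DrawAll.
Variables (V : finType) (e : rel V).
Hypothesis esym : symmetric e.
Hypothesis eirr : irreflexive e.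
Hypothesis e4 : max_degree_le e 4.
Variables (t : V) (K : nat).

(* The ends of a remaining chain with an inner vertex. *)
Definition mate (L : seq (seq V)) (a b : V) := exists z C', [/\ z :: C' \in L, 1 < size C' &
  (a = z /\ b = last z C') \/ (b = z /\ a = last z C')].

Lemma chain_order_mem S L C : chain_order e t S L -> C \in L ->
  exists S0 : {set V}, [/\ S \subset S0, chain_ok e S0 C, uniq C & {subset C <= ~: S0 :\ t}].
Proof.
elim: L S => [|D L IH] S //= [ok uD sD oL]; rewrite inE => /orP[/eqP->|CL].
  by exists S.
have [S0 [sS okC uC sC]] := IH _ oL CL; exists S0; split=> //.
by apply: subset_trans sS; apply: subsetUl.
Qed.

Lemma chain_order_disj S L C D x : chain_order e t S L -> C \in L -> D \in L ->
  x \in C -> x \in D -> C = D.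
Proof.
elim: L S => [|E L IH] S //= [ok uE sE oL].
have no F : F \in L -> x \in E -> x \in F -> False.
  move=> FL xE xF; have [S0 [sS _ _ sF]] := chain_order_mem oL FL.
  by have := sF x xF; rewrite !inE (subsetP sS) ?andbF // !inE xE orbT.
rewrite !inE => /orP[/eqP->|CL] /orP[/eqP->|DL] // xC xD.
- by case: (no D).
- by case: (no C).
- exact: IH oL CL DL xC xD.
Qed.

Lemma mate_chain S L a b : chain_order e t S L -> mate L a b ->
  exists (S0 : {set V}) C s s', [/\ S \subset S0, pchain e S0 C /\ uniq C, {subset C <= ~: S0 :\ t}, C \in L &
    [/\ a \in C, b \in C, (2 < size C) && (a != b), nS e S0 a = [set s] /\ nS e S0 b = [set s'] & s != s']].
Proof.
move=> oL [z [C' [CL sC ab]]]; have [S0 [sS ok uC sub]] := chain_order_mem oL CL.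
case: ok => [[x [_ C'E]]|pC]; first by rewrite C'E in sC.
case: (pC) => _ _ _ _ /(_ z C' erefl)[s [s' [ss nz nl]]].
have item_lia : z != last z C'.
  by case: (C') uC sC => // y D /= /andP[zn _] _; apply: contraNneq zn => ->; rewrite mem_last.
have lC : last z C' \in z :: C' by rewrite mem_last.
case: ab => -[-> ->].
  by exists S0, (z :: C'), s, s'; split=> //; split=> //; rewrite ?mem_head ?ltnS ?sC.
exists S0, (z :: C'), s', s; split=> //; split=> //; rewrite ?mem_head ?ltnS ?sC //.
- by rewrite eq_sym.
- by rewrite eq_sym.
Qed.

Lemma mate_sym L a b : mate L a b -> mate L b a.
Proof. by move=> [z [C' [CL sC ab]]]; exists z, C'; split=> //; case: ab; auto. Qed.

Lemma mate_out S L a b : chain_order e t S L -> mate L a b -> a \notin S.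
Proof.
move=> oL m; have [S0 [C [s [s' [sS _ sub _ [aC _ _ _ _]]]]]] := mate_chain oL m.
by have := sub a aC; rewrite !inE => /andP[_]; apply: contra; apply: (subsetP sS).
Qed.

(** Remaining chains are pairwise disjoint, so mates are unique. When its chain is due, each end has
    one predecessor, different for the two ends; hence no earlier vertex is adjacent to both. *)
Lemma mate_good U L : chain_order e t U L ->
  forall (T : {set V}) y, T \subset U -> y \in U -> mates_ok e T y (mate L).
Proof.
move=> oL T y TU yU; split.
- exact: mate_sym.
- move=> a b c mb mc; case: (mb) (mc) => [z [C' [CL sC ab]]] [w [D' [DL sD ac]]].
  have inC x X : x = w \/ x = last w X -> x \in w :: X.
    by case=> ->; rewrite ?mem_head ?mem_last.
  have aC : a \in z :: C' by case: ab => -[]; [move=> ->|move=> _ ->]; rewrite ?mem_head ?mem_last.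
  have aD : a \in w :: D' by case: ac => -[]; [move=> ->|move=> _ ->]; rewrite ?mem_head ?mem_last.
  have [zw CD] := chain_order_disj oL CL DL aC aD; subst w D'.
  have [_ [_ [_ [_ [_ _ _ _ [_ _ /andP[_ nab] _ _]]]]]] := mate_chain oL mb.
  have [_ [_ [_ [_ [_ _ _ _ [_ _ /andP[_ nac] _ _]]]]]] := mate_chain oL mc.
  have {}nab : a <> b by exact/eqP.
  case: ab => -[h1 h2]; case: ac => -[h3 h4].
  - by rewrite h2 h4.
  - by case: nab; rewrite h2 -h4.
  - by case: nab; rewrite h1 -h3.
  - by rewrite h1 h3.
- move=> a b m; have [S0 [C [s [s' [sS _ sub _ [_ _ _ [na _] _]]]]]] := mate_chain oL m.
  exists s; rewrite -na; apply/subsetP => x; rewrite !inE => /andP[xT ->].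
  by rewrite (subsetP sS) ?(subsetP TU).
- move=> w w' ew ew' m; have [S0 [C [s [s' [sS _ sub _ [_ _ _ [nw nw'] ss]]]]]] := mate_chain oL m.
  have : y \in nS e S0 w by rewrite inE (subsetP sS) //= esym.
  have : y \in nS e S0 w' by rewrite inE (subsetP sS) //= esym.
  by rewrite nw nw' !inE => /eqP -> /eqP se; rewrite se eqxx in ss.
Qed.

Lemma chain_ok_ext (S S' : {set V}) C : (forall x, x \in C -> nS e S x = nS e S' x) ->
  chain_ok e S C -> chain_ok e S' C.
Proof.
move=> nE [[v CE cv]|[sC so ch mid en]].
  by left; exists v; rewrite -?nE ?CE ?mem_head.
right; split=> //.
- by move=> p x q CE pn qn; rewrite -nE ?(mid p x q) // CE mem_cat mem_head orbT.
- move=> z C' CE; have [s [s' [ss nz nl]]] := en z C' CE; exists s, s'; split=> //.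
    by rewrite -nE // CE mem_head.
  by rewrite -nE // CE mem_last.
Qed.

(** The second vertex saw nothing drawn before, so after [w] is drawn it becomes an end with [w] as
    its only predecessor, and [w] differs from the predecessor of the other end. *)
Lemma chain_behead (S : {set V}) w D : pchain e S (w :: D) -> uniq (w :: D) ->
  {subset w :: D <= ~: S} -> 1 < size D -> pchain e (w |: S) D.
Proof.
move=> [sC so ch mid en] uD sub sD.
have nE x p q : D = p ++ x :: q -> p != [::] -> nS e (w |: S) x = nS e S x.
  move=> DE pn; apply/setP => s; rewrite !inE; have [->|//] := eqVneq s w.
  rewrite (negPf (_ : ~~ e x w)) ?andbF //.
  by rewrite esym; apply: (ch [::] w p x q); rewrite // DE.
split=> //.
- by move: so => /path_sorted.
- move=> p x q y r DE; apply: (ch (w :: p) x q y r); by rewrite DE.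
- move=> p x q DE pn qn; rewrite (nE _ _ _ DE pn).
  by apply: (mid (w :: p) x q) => //; rewrite DE.
- move=> z C' DE; have [s [s' [ss nw nl]]] := en w D erefl.
  have ws' : w != s'.
    have : s' \in nS e S (last w D) by rewrite nl set11.
    rewrite inE => /andP[s'S _]; apply: contraTneq s'S => <-.
    by have := sub w (mem_head _ _); rewrite inE.
  exists w, s'; split=> //.
    have nz : nS e S z = set0.
      by apply: (mid [:: w] z C'); rewrite ?DE //; move: sD; rewrite DE; case: (C').
    apply/setP => x; rewrite !inE; have [->|xw] := eqVneq x w.
      by move: so; rewrite DE /= => /andP[ewz _]; rewrite esym ewz.
    by have := in_set0 x; rewrite -nz inE.
  rewrite -nl DE /=; move: sD DE; case/lastP: C' => [|E y]; first by move=> + DE; rewrite DE.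
  move=> _ DE; rewrite last_rcons; apply: (nE y (z :: E) [::]) => //.
  by rewrite DE -rcons_cons cats1.
Qed.

(* The end [w] of a later chain can be drawn early, right after its unique
   predecessor [v]. *)
Lemma strip S L w b v : chain_order e t S L -> mate L w b -> v \in S -> e v w ->
  exists L', chain_order e t (w |: S) L' /\
    forall a c, mate L' a c -> [\/ mate L a c, nS e S a = set0 | nS e S c = set0].
Proof.
elim: L S => [|C L IH] S; first by move=> _ [z [C' []]].
move=> oL mw vS evw; have [ok uC sC oL'] := oL.
have nwv : nS e (S :|: [set x in C]) w \subset [set v] \/ exists D, [/\ D =i C, pchain e S (w :: behead D),
      uniq (w :: behead D), D = w :: behead D & 1 < size (behead D)].
  case: (mw) => [z [C' [CL szC ab]]]; move: CL; rewrite inE => /orP[/eqP CE|CL].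
    right; case: ok => [[x CE']|pC]; first by move: szC; rewrite CE' in CE; case: CE => _ ->.
    case: ab => -[wz bz].
      move: (pC) (uC); rewrite -CE => pC2 uC2.
      by exists C; rewrite wz -CE.
    move: (pC) (uC); rewrite -CE => pC2 uC2.
    exists (rev C); rewrite -CE.
    have rE : rev (z :: C') = w :: behead (rev (z :: C')).
      rewrite bz; case/lastP: (C') szC => [//|E y] _.
      by rewrite -rcons_cons rev_rcons /= last_rcons.
    split; rewrite -?rE //.
    - by move=> x; rewrite mem_rev.
    - exact: pchain_rev.
    - by rewrite rev_uniq.
    - by rewrite size_behead size_rev.
  left; have mwL : mate L w b by exists z, C'.
  have [S0 [D [s [s' [sS _ _ _ [_ _ _ [nw _] _]]]]]] := mate_chain oL' mwL.
  have vs : v = s.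
    have : v \in nS e S0 w by rewrite inE esym evw (subsetP sS) // inE vS.
    by rewrite nw => /set1P.
  rewrite vs -nw; apply/subsetP => x; rewrite inE => /andP[xS ewx].
  by rewrite inE ewx (subsetP sS).
case: nwv => [nwv|[D [DC pD uD DE sD]]].
  have mwL : mate L w b.
    case: (mw) => [z [C' [CL szC ab]]]; move: CL; rewrite inE => /orP[/eqP CE|CL]; last by exists z, C'.
    exfalso.
    case: ok => [[x CE']|pC]; first by move: szC; rewrite CE' in CE; case: CE => _ ->.
    have wC : w \in C by rewrite -CE; case: ab => -[]; [move=> ->|move=> _ ->]; rewrite ?mem_head ?mem_last.
    have [y yC ewy] : exists2 y, y \in C & e w y.
      have so : sorted e C by case: pC.
      have sC2 : 1 < size C by case: pC.
      case/splitPr: wC so sC2 => p q; case: q => [|y q].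
        case/lastP: p => [//|p y] so _; exists y; first by rewrite mem_cat mem_rcons mem_head.
        by move: so; rewrite cat_rcons => /cat_sorted2[_] /= /andP[]; rewrite esym.
      by move=> /cat_sorted2[_] /= /andP[ewy _] _; exists y; rewrite // mem_cat !inE eqxx !orbT.
    have : y \in nS e (S :|: [set x in C]) w by rewrite !inE yC orbT.
    move/(subsetP nwv)/set1P => yv; have := sC y yC.
    by rewrite yv !inE vS andbF.
  have [L1 [oL1 mL1]] := IH _ oL' mwL (subsetP (subsetUl _ _) _ vS) evw.
  have wS1 := mate_out oL' mwL.
  exists (C :: L1); split=> /=.
    split=> //.
    - apply: chain_ok_ext ok => x xC; apply/setP => s; rewrite !inE.
      have [->|//] := eqVneq s w.
      have : x \notin nS e (S :|: [set x in C]) w.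
        apply/negP => /(subsetP nwv)/set1P xv; have := sC x xC.
        by rewrite xv !inE vS andbF.
      by rewrite !inE xC orbT /= esym => /negPf ->; rewrite andbF.
    - move=> x xC; have := sC x xC; rewrite !inE negb_or => /andP[-> ->]; rewrite !andbT.
      by apply: contraNneq wS1 => <-; rewrite !inE xC orbT.
    - by rewrite -setUA.
  move=> a c [z [C' [CL szC ab]]]; move: CL; rewrite inE => /orP[/eqP CE|CL].
    by constructor 1; exists z, C'; rewrite CE mem_head.
  have /mL1 : mate L1 a c by exists z, C'.
  have sub0 x : nS e (S :|: [set x in C]) x = set0 -> nS e S x = set0.
    move=> n0; apply/setP => y; have := in_set0 y; rewrite -{1}n0 !inE => h.
    by apply/negP => /andP[yS exy]; rewrite yS exy in h.
  case=> [[z0 [C0 [CL0 sz0 ab0]]]|/sub0 h|/sub0 h]; [constructor 1|by constructor 2|by constructor 3].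
  by exists z0, C0; rewrite inE CL0 orbT.
exists (behead D :: L); split=> /=.
  have subD : {subset w :: behead D <= ~: S}.
    by move=> x; rewrite -DE DC => /sC; rewrite !inE => /andP[].
  split.
  - by right; apply: chain_behead.
  - by case/andP: uD.
  - move=> x xD; have xD' : x \in D by rewrite DE inE xD orbT.
    have := sC x; rewrite -DC => /(_ xD'); rewrite !inE negb_or => /andP[-> ->]; rewrite !andbT.
    by case/andP: uD => wn _; apply: contraNneq wn => <-.
  - rewrite (_ : _ :|: _ = S :|: [set x in C]) //.
    by apply/setP => x; rewrite !inE -DC DE inE; case: (x == w); case: (x \in S).
move=> a c [z [C' [CL szC ab]]]; move: CL; rewrite inE => /orP[/eqP CE|CL].
  have nz : nS e S z = set0.
    case: pD => _ _ _ mid _; apply: (mid [:: w] z C') => //; first by rewrite -CE.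
    by case: (C') szC.
  by case: ab => -[h _]; [constructor 2|constructor 3]; rewrite h.
by constructor 1; exists z, C'; rewrite inE CL orbT.
Qed.


(** A pending edge has a drawn source, so a mate without drawn neighbours imposes no condition yet.
    This makes the new mates created by splitting off a chain end harmless. *)
Lemma drawn_weaken (S : {set V}) (M M' : V -> V -> Prop) W B : drawn e t K S M W B ->
  (forall a b, M' a b -> nS e S a <> set0 -> nS e S b <> set0 -> M a b) -> drawn e t K S M' W B.
Proof.
move=> [vp [ed [top [lo [hi [FL [A [AF [G [prs [cols [rows [H R]]]]]]]]]]]]] MM.
exists vp, ed, top, lo, hi, FL, A, AF, G, prs, cols, rows; split=> //.
apply: (weaken H) => //; first exact: (free_uniq H).
have src k i : ed k = Some i -> nS e S k.2 <> set0.
  case: k => u w /= E; have [euw [[uS _]|[_ + _]]] := item_status H E; last by rewrite inE.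
  by move/setP/(_ u); rewrite !inE uS esym euw.
by move=> k k' i i' E E' _ _ m; apply: MM m (src _ _ E) (src _ _ E').
Qed.

Lemma draw_single (S : {set V}) (M : V -> V -> Prop) W B v : drawn e t K S M W B -> v \notin S -> v != t ->
  1 < #|nS e S v| <= 3 -> mates_ok e S v M ->
  (#|nS e S v| = 3 -> forall w b, e v w -> ~ M w b) ->
  drawn e t K (v |: S) M W (B + K.+3).
Proof.
move=> D vS vt; case E : #|nS e S v| => [|[|[|[|?]]]] // _ mg nM.
  exact: (draw_two_preds esym eirr e4 vS vt E mg).
case: D => vp [ed [top [lo [hi [FL [A [AF [G [prs [cols [rows D]]]]]]]]]]].
have nM' w b : e v w -> w \notin S -> ~ M w b /\ ~ M b w.
  by move=> ew _; split=> [m|/(mates_sym mg) m]; apply: nM m.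
have [vp' [ed' [top' [lo' [hi' [FL' [rows' [X1 [X2 [X3 [D' _ _ _ _]]]]]]]]]]] :=
  draw_three_preds esym eirr e4 D vS vt E nM'.
by exists vp', ed', top', lo', hi', FL', A, AF, G, prs, cols, rows'.
Qed.

(** The vertex [w], split off its chain, is the only successor of [v]. It is placed right above [v]
    and uses the two columns released by the outer incoming edges of [v]. *)
Lemma draw_pair (S : {set V}) (M : V -> V -> Prop) W B v w : drawn e t K S M W B -> v \notin S -> v != t ->
  w \notin v |: S -> w != t -> e v w -> #|nS e S v| = 3 -> nS e S w = set0 ->
  (forall (T : {set V}) y, T \subset w |: (v |: S) -> y \in w |: (v |: S) -> mates_ok e T y M) ->
  (forall b, ~ M w b) ->
  drawn e t K (w |: (v |: S)) M W (B + K.+3 + K.+3).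
Proof.
move=> D vS vt wS wt ew nv nw mg nM.
case: D => vp [ed [top [lo [hi [FL [A [AF [G [prs [cols [rows D]]]]]]]]]]].
have wS' : w \notin S by apply: contra wS => ws; rewrite inE ws orbT.
have wv : w != v by apply: contraNneq wS => ->; rewrite inE set11.
have no1 : #|outs e S v| <= 1.
  by have := card_deg e4 S v; rewrite nv.
have nM' w' b : e v w' -> w' \notin S -> ~ M w' b /\ ~ M b w'.
  move=> ew' w'S; have -> : w' = w.
    by move/card_le1_eqP: no1; apply; rewrite inE ?ew ?ew' ?wS'.
  split=> [m|m]; first exact: nM m.
  have mgS : mates_ok e S w M.
    by apply: mg; rewrite ?setU11 // setUA subsetUr.
  exact: nM (mates_sym mgS m).
have [vp' [ed' [top' [lo' [hi' [FL' [rows' [X1 [X2 [X3 [D' [F1 F3] [X12 X23] [P1 P3] ex]]]]]]]]]]] :=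
  draw_three_preds esym eirr e4 D vS vt nv nM'.
have [i [E fi Xi]] := ex w ew wS'.
apply: (draw_one_pred esym eirr e4 D' wS wt _ E fi _ F1 F3 (lexx _) (lexx _)) => //; rewrite ?Xi //.
- move=> u; rewrite !inE => /orP[/eqP//|uS] euw.
  have : u \in nS e S w by rewrite inE uS esym.
  by rewrite nw inE.
- by apply: mg; rewrite ?subsetUr // setU11.
Qed.

(** Here [J] adds up the lengths minus one of the chains as actually drawn, after any splitting;
    every vertex other than [t] not counted by it has a row of its own. *)
Lemma draw_all n : forall (S : {set V}) L W B, #|~: S| <= n -> chain_order e t S L ->
  drawn e t K S (mate L) W B ->
  exists J (S' : {set V}), [/\ ~: S' = [set t], J < #|~: S| &
    drawn e t K S' (fun _ _ => False) (W + 2 * J) (B + K.+3 * (#|~: S|.-1 - J))].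
Proof.
have nomem (S0 : {set V}) (C : seq V) : {subset C <= ~: S0 :\ t} -> forall y, y \in C -> y \notin S0 /\ y != t.
  by move=> sC y /sC; rewrite !inE => /andP[].
have cardU (S0 : {set V}) (C : seq V) : uniq C -> {subset C <= ~: S0 :\ t} ->
    #|~: S0| = size C + #|~: (S0 :|: [set x in C])|.
  move=> uC sC; rewrite -(cardsID [set x in C] (~: S0)); congr addn.
    rewrite -(card_uniqP uC); apply: eq_card => x; rewrite !inE andbC.
    by have [/sC|//] := boolP (x \in C); rewrite !inE => /andP[_ ->].
  by apply: eq_card => x; rewrite !inE negb_or andbC.
elim: n => [|n IH] S L W B Sn oL D.
  have := oL; move: Sn; rewrite leqn0 cards_eq0 => /eqP S0.
  case: L oL D => [|C L] /= oL D; first by rewrite S0 => /setP/(_ t); rewrite !inE eqxx.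
  case=> ok _ sC _; have [x xC] : exists x, x \in C.
    by case: ok => [[v -> _]|[]]; [exists v; rewrite mem_head|case: (C) => // v ? _; exists v; rewrite mem_head].
  by have := sC x xC; rewrite S0 !inE andbF.
case: L oL D => [|C L] oL D.
  exists 0, S; split=> //; first by rewrite oL cards1.
  rewrite muln0 addn0 oL cards1 muln0 addn0.
  by apply: drawn_weaken D _.
have [ok uC sC _] := oL; have oL' : chain_order e t (S :|: [set x in C]) L by case: oL.
have cE := cardU S C uC sC; have CS := nomem S C sC.
have sub (a b : V) : mate L a b -> mate (C :: L) a b.
  by move=> [z [C' [CL szC ab]]]; exists z, C'; rewrite inE CL orbT.
(* One step draws [k + 1] vertices with [2 * j] new columns and [k + 1 - j] rows. A single vertex
   has [k = j = 0], a chain [k = j], and a vertex with its split-off successor [k = 1], [j = 0]. *)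
have done_ (S1 : {set V}) k j L1 : chain_order e t S1 L1 -> #|~: S| = k.+1 + #|~: S1| -> (j <= k) ->
    drawn e t K S1 (mate L1) (W + 2 * j) (B + K.+3 * (k.+1 - j)) ->
    exists J (S' : {set V}), [/\ ~: S' = [set t], J < #|~: S| &
      drawn e t K S' (fun _ _ => False) (W + 2 * J) (B + K.+3 * (#|~: S|.-1 - J))].
  move=> o1 kE jk D1; have S1n : #|~: S1| <= n.
    by move: Sn; rewrite kE addSn ltnS; apply: leq_trans; rewrite leq_addl.
  have [J [S' [S'E JS D']]] := IH S1 L1 _ _ S1n o1 D1.
  exists (j + J), S'; split=> //; first by move: JS jk; rewrite kE; clear; lia.
  rewrite mulnDr addnA (_ : (#|~: S|.-1 - (j + J)) = (k.+1 - j) + (#|~: S1|.-1 - J)).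
    by rewrite mulnDr addnA.
  by move: JS jk; rewrite kE; clear; lia.
case: ok => [[v CE /andP[v1 v3]]|pC]; last first.
  have mo y b : y \in S :|: [set x in C] -> ~ mate L y b /\ ~ mate L b y.
    by move=> yU; split=> [m|/mate_sym m]; have := mate_out oL' m; rewrite yU.
  have mt z C' : C = z :: C' -> 2 < size C -> mate (C :: L) z (last z C') /\ mate (C :: L) (last z C') z.
    move=> CE sz; have m : mate (C :: L) z (last z C').
      by exists z, C'; rewrite CE mem_head; split=> //; [move: sz; rewrite CE|left].
    by split=> //; apply: mate_sym.
  have D' := draw_chain esym eirr e4 D pC uC sub (subxx _) CS (mate_good oL') mo mt.
  have C0 : 0 < size C by case: pC => /ltnW.
  apply: (done_ (S :|: [set x in C]) (size C).-1 (size C).-1 L) => //.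
    by rewrite (prednK C0).
  by rewrite subSnn muln1.
have [vS vt] : v \notin S /\ v != t by apply: CS; rewrite CE mem_head.
have SE : S :|: [set x in C] = v |: S by apply/setP => x; rewrite CE !inE orbC.
rewrite SE CE /= in oL' cE.
have v13 : 1 < #|nS e S v| <= 3 by rewrite v1 v3.
have vU : v \in v |: S by rewrite setU11.
(* The one configuration in which no column can be chosen and a conflict of mates threatens; it is
   resolved by changing the ordering. *)
have [[n3 [w [b [ew m]]]]|no] := classic (#|nS e S v| = 3 /\ exists w b, e v w /\ mate L w b); last first.
  apply: (done_ (v |: S) 0 0 L) => //; rewrite muln0 addn0 subn0 muln1.
  apply: draw_single vS vt v13 _ _.
  - by apply: drawn_weaken D _ => a b m _ _; apply: sub.
  - by apply: (mate_good oL'); rewrite ?subsetUr.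
  - by move=> n3 w b ew m; apply: no; split=> //; exists w, b.
have [L1 [oL1 mL1]] := strip oL' m vU ew.
have wvS := mate_out oL' m.
have [S0 [C0 [s [s' [sS0 _ sub0 _ [wC _ _ [nw _] _]]]]]] := mate_chain oL' m.
have wt : w != t by have := sub0 w wC; rewrite !inE => /andP[].
have nSw : nS e S w = set0.
  have vs : v = s.
    by apply/set1P; rewrite -nw inE (subsetP sS0) //= esym.
  apply/setP => x; rewrite !inE; apply/negP => /andP[xS ewx].
  have : x \in nS e S0 w by rewrite inE ewx (subsetP sS0) // inE xS orbT.
  by rewrite nw -vs => /set1P xv; move: vS; rewrite -xv xS.
have nS0 x : nS e (v |: S) x = set0 -> nS e S x = set0.
  move=> n0; apply/setP => y; have := in_set0 y; rewrite -{1}n0 !inE => h.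
  by apply/negP => /andP[yS exy]; rewrite yS exy orbT in h.
apply: (done_ (w |: (v |: S)) 1 0 L1) => //.
  by rewrite cE (card_setC_add wvS).
rewrite muln0 addn0 subn0 muln2 -addnn addnA.
apply: draw_pair => //; last first.
- by move=> b' m'; have := mate_out oL1 m'; rewrite setU11.
- exact: (mate_good oL1).
apply: drawn_weaken D _ => x y /mL1[m'|/nS0 h|/nS0 h] nx ny //.
exact: sub.
Qed.
End DrawAll.

Local Open Scope ring_scope.

(** * The first edge and the last vertex *)

Section InitFinal.
Variables (V : finType) (e : rel V).
Hypothesis esym : symmetric e.
Hypothesis eirr : irreflexive e.
Hypothesis e4 : max_degree_le e 4.
Variables (t : V) (K : nat).

Lemma emit_down S v I O M vp ed top lo hi FL A AF prs cols rows o c f h1 h2 l :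
  layout e S v I O M vp ed top lo hi None FL A AF prs cols rows ->
  vp v = Some (c, top) -> (c, h1) \in FL -> (f, h2) \in FL -> h1 < l -> h2 < l -> l < 0 ->
  f != c -> l \in rows ->
  (forall k i x, ed k = Some i -> onH i x l -> ~~ btw c f x) ->
  admissible e S v M ed prs o f ->
  layout e S v I (add_opt o O) M vp (upd_opt ed v o (pending c top l f)) top lo hi None
    (if o is Some _ then (c, top) :: dropc c (dropc f FL) else FL) A AF prs cols rows.
Proof.
case: o => [w|] // H Hv cF fF h1l h2l l0 fc lr HH /(_ w erefl)[ew wS mw].
have At := levelA_range H; have := place_height H Hv => /and3P[ct _ _].
apply: (add_down eirr H Hv cF fF h1l h2l _ fc lr HH _ _ (or_introl erefl) (fun _ h => h)) => //.
- by move: l0 ct; clear; lia.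
- by move=> w' x /(place_height H); move: l0; clear; lia.
- by move=> l00; move: l0; rewrite l00 ltxx.
- by move=> lA; exfalso; move: l0 At; rewrite lA; clear; lia.
Qed.

Lemma inv_empty (s : V) M FL A AF cols rows : 2 < A -> A \in rows -> 0 \in rows ->
  (forall c, c \in FL -> c.1 \in cols) -> uniq (map fst FL) ->
  layout e set0 s set0 set0 M (fun _ => None) (fun _ => None) A 1 0 None FL A AF [::] cols rows.
Proof.
move=> A2 Ar Zr Fc Fu; split=> //.
- by rewrite A2 lexx.
- by rewrite Ar Zr.
- by move=> u w; rewrite inE.
- by move=> u w; rewrite inE.
- by move=> w; rewrite inE.
- by move=> w; rewrite inE.
- by rewrite inE.
Qed.

(** Both vertices lie on row 6, joined along it. Each has up to three more edges: one upwards, one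
    to the outer side on [l0] or [r1], and one looping below on level -2 to [d0] or [d1]. The rows
    are -2, 0, 4 and 6, with 4 as first auxiliary level; the pool lies to the right, entirely
    available. *)
Lemma initial_at (s0 s1 : V) M (FL : seq (int * int)) (AF cols : seq int) (d0 l0 x0 x1 r1 d1 : int) W : e s0 s1 -> s0 != t -> s1 != t ->
  mates_ok e set0 s0 M -> mates_ok e [set s0] s1 M -> (forall b, ~ M s1 b /\ ~ M b s1) ->
  d0 < l0 -> l0 < x0 -> x0 < x1 -> x1 < r1 -> r1 < d1 ->
  [/\ (d0, -3) \in FL, (l0, -3) \in FL & (x0, -3) \in FL] ->
  [/\ (x1, -3) \in FL, (r1, -3) \in FL & (d1, -3) \in FL] ->
  (forall f, f \in AF -> (f, -3) \in FL /\ d1 < f) -> uniq AF -> size AF = K.+2 ->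
  (forall c, c \in FL -> c.1 \in cols) -> uniq (map fst FL) ->
  spaced cols (2 * 4 ^+ #|~: (s1 |: [set s0])|) -> (size cols <= W)%N ->
  drawn e t K (s1 |: [set s0]) M W (4 * K.+1).
Proof.
move=> es s0t s1t mg0 mg1 nM dl lx xx xr rd [Fd0 Fl0 Fx0] [Fx1 Fr1 Fd1] AFF uA sA Fc uF sp sW.
have s10 : s1 != s0 by apply: contraTneq es => ->; rewrite eirr.
have H0 : layout e set0 s0 set0 set0 M (fun _ => None) (fun _ => None) 4 1 0 None FL 4 AF [::] cols [:: -2; 0; 4].
  by apply: inv_empty; rewrite ?inE.
have H1 : layout e set0 s0 set0 set0 M (fun _ => None) (fun _ => None) 6 1 0 None FL 4 AF [::] cols [:: 6; -2; 0; 4].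
  exact: (newrow H0 1 0 None).
have H2 : layout e set0 s0 set0 set0 M (upd (fun _ => None) s0 (x0, 6)) (fun _ => None) 6 x0 x0 None FL 4 AF [::] cols [:: 6; -2; 0; 4].
  by apply: (place_free H1 (erefl None) Fx0) => //; [clear; lia | left | rewrite lexx].
have n0 : nS e set0 s0 = set0 by apply/setP => x; rewrite !inE.
have s1o : s1 \in outs e set0 s0 by rewrite !inE es.
have oT : (#|outs e set0 s0 :\ s1| <= 3)%N.
  by have := card_deg e4 set0 s0; rewrite n0 cards0 add0n (cardsD1 s1) s1o.
have dl' : d0 != l0 by move: dl; clear; lia.
have dx' : d0 != x0 by move: dl lx; clear; lia.
have lx' : l0 != x0 by move: lx; clear; lia.
have [o1 [o2 [o3 [k1 k2 k3 cov]]]] := choose3o esym H2 (mates_sym mg0) (mates_fun mg0) (mates_one mg0) (mates_far mg0)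
  (subsetDl _ _) oT dl' dx' lx'.
have ke o a ed0 : admissible e set0 s0 M ed0 [::] o a -> forall w, o = Some w -> e s0 w.
  by move=> ok w /ok[].
have dl2 : l0 != d0 by rewrite eq_sym.
have lx2 : x0 != l0 by rewrite eq_sym.
have H3 := emit_down (l := -2) H2 (updE _ _ _) Fx0 Fd0 isT isT isT dx' isT (ltac:(by [])) k1.
set FL3 := if o1 is Some _ then _ else _ in H3.
have keep3 f h : f != x0 -> f != d0 -> (f, h) \in FL -> (f, h) \in FL3.
  by move=> fx fd fF; rewrite /FL3; case: (o1) => [w|] //; rewrite inE !mem_filter /= fx fd fF orbT.
have H4 := emit_side (lo' := l0) (hi' := x0) eirr H3 (updE _ _ _) (keep3 _ _ lx' dl2 Fl0) isT
  (or_introl (conj lx erefl)) (ltW lx) (lexx _) (ltac:(by rewrite lexx (ltW lx)))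
  (oko_upo _ (mates_far mg0) (ke _ _ _ k1) k2).
have [h xF3 ht] : exists2 h, (x0, h) \in FL3 & h <= 6.
  by rewrite /FL3; case: (o1) => [w|]; [exists 6; rewrite ?mem_head | exists (-3)].
have H5 := emit_up eirr H4 (updE _ _ _) (dropo_keep o2 xF3 lx2) ht
  (oko_upo _ (mates_far mg0) (ke _ _ _ k2) (oko_upo _ (mates_far mg0) (ke _ _ _ k1) k3)).
have {}H5 := weaken (FL' := dropc x0 (drop_opt x0 o3 (drop_opt l0 o2 FL3))) (M' := M) H5 (fun x => @mem_subseq _ _ _ (filter_subseq _ _) x)
   (dropc_uniq x0 (free_uniq H5)) (fun _ h => h) (fun _ _ _ _ _ _ _ _ m => m).
set FL5 := dropc x0 _ in H5; set ed5 := upd_opt _ _ _ _ in H5.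
have keep5 f h' : x0 < f -> (f, h') \in FL -> (f, h') \in FL5.
  move=> fx fF.
  have [a1 a2 a3] : [/\ f != x0, f != d0 & f != l0] by split; move: fx dl lx; clear; lia.
  by rewrite mem_filter /= a1; do 2! apply: dropo_keep => //; apply: keep3.
have xr0 : x0 < r1 by apply: lt_trans xr.
have xd0 : x0 < d1 by apply: lt_trans rd.
have H6 := add_side (w := s1) (lo' := l0) (hi' := x0) (xc' := Some (s0, s1)) eirr H5 (updE _ _ _) (keep5 _ _ xr0 Fr1)
  isT (ltac:(move: xr0; clear; lia)) (ltac:(move=> y; move: xr0; item_lia)) erefl (lexx _) (lexx _) (or_intror erefl)
  es (ltac:(by rewrite inE)) (fun p k i _ _ _ => conj (fun _ _ m => (nM _).1 m) (fun _ _ m => (nM _).2 m)).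
set ed6 := upd ed5 _ _ in H6.
have H7 : layout e (s0 |: set0) s1 set0 set0 M (upd (fun _ => None) s0 (x0, 6)) ed6 6 l0 x0 (Some (s0, s1)) (dropc r1 FL5) 4 AF [::] cols [:: 6; -2; 0; 4].
  apply: (close esym eirr H6) => //.
  - by rewrite !inE.
  - by rewrite updN.
  - by rewrite updE.
  - move=> w ew wS; rewrite in_setU1; have [//|ws] := eqVneq w s1; rewrite /=.
    have /cov : w \in outs e set0 s0 :\ s1 by rewrite !inE ws ew.
    by case=> ->; do 3! (apply/addo_in; (try by left); right).
  - by move=> [c h'] y /dropcP[_ /dropcP[/= cx _]]; rewrite updE => -[xc _]; rewrite xc eqxx in cx.
rewrite setU0 in H7.
have Fx1' : (x1, -3) \in dropc r1 FL5.
  by rewrite mem_filter keep5 //= andbT; move: xr; clear; lia.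
have H8 : layout e [set s0] s1 set0 set0 M (upd (upd (fun _ => None) s0 (x0, 6)) s1 (x1, 6)) ed6 6 l0 x1 (Some (s0, s1)) (dropc r1 FL5) 4 AF [::] cols [:: 6; -2; 0; 4].
  apply: (place_free H7 _ Fx1') => //.
  - by rewrite updN.
  - by move: xx; clear; lia.
  - by right; exists s0.
  - by move=> _; rewrite lexx (ltW xx).
  - by rewrite lexx (ltW (lt_trans lx xx)).
have H9 := cut eirr H8 erefl (updE _ _ _) (updE _ _ _) xx xr.
set ed9 := upd ed6 _ _ in H9; set FL9 := _ :: _ in H9.
have n1 : nS e [set s0] s1 = [set s0].
  by apply/setP => x; rewrite !inE; have [->|//] := eqVneq x s0; rewrite esym es.
have oT' : (#|outs e [set s0] s1| <= 3)%N.
  by have := card_deg e4 [set s0] s1; rewrite n1 cards1 add1n.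
have dr' : d1 != r1 by move: rd; clear; lia.
have dx1' : d1 != x1 by move: xr rd; clear; lia.
have rx1' : r1 != x1 by move: xr; clear; lia.
have [q1 [q2 [q3 [j1 j2 j3 cov1]]]] := choose3o esym H9 (mates_sym mg1) (mates_fun mg1) (mates_one mg1) (mates_far mg1)
  (subxx _) oT' dr' dx1' rx1'.
have je o a ed0 : admissible e [set s0] s1 M ed0 [::] o a -> forall w, o = Some w -> e s1 w.
  by move=> ok w /ok[].
have keep9 f h' : x0 < f -> f != r1 -> (f, h') \in FL -> (f, h') \in FL9.
  by move=> fx fr fF; rewrite inE mem_filter /= fr keep5 // orbT.
(* The loop of [s0] is directed to the left, so level -2 is clear from [x1] to [d1]. *)
have onlow y : forall k i, ed9 k = Some i -> onH i y (-2) -> y <= x0.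
  have Hup (f : V * V -> option item) k0 j0 : (forall k i, f k = Some i -> onH i y (-2) -> y <= x0) ->
      (onH j0 y (-2) -> y <= x0) -> forall k i, upd f k0 j0 k = Some i -> onH i y (-2) -> y <= x0.
    by move=> Hf Hj k1' i1; rewrite /upd; case: eqP => [_ [<-]|_ /Hf].
  have upo' (f : V * V -> option item) v0 o j0 : (forall k i, f k = Some i -> onH i y (-2) -> y <= x0) ->
      (onH j0 y (-2) -> y <= x0) -> forall k i, upd_opt f v0 o j0 k = Some i -> onH i y (-2) -> y <= x0.
    by case: o => [w|] //=; apply: Hup.
  have N1 : onH (Item x0 6 6 x1 true 6 x1 6) y (-2) -> y <= x0 by item_lia.
  have N2 X : onH (pending x0 6 6 X) y (-2) -> y <= x0 by item_lia.
  have N3 : onH (pending x0 6 (-2) d0) y (-2) -> y <= x0 by move: dl lx; item_lia.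
  by rewrite /ed9 /ed6 /ed5; apply: (Hup) => //; apply: (Hup) => //; do 3 apply: (upo') => //.
have Ex1 : upd (upd (fun _ => None) s0 (x0, 6)) s1 (x1, 6) s1 = Some (x1, 6 : int) by rewrite updE.
have rx2 : x1 != r1 by rewrite eq_sym.
have Fx9 := keep9 _ _ xx rx2 Fx1.
have Fd9 := keep9 _ _ xd0 dr' Fd1.
have H10 := emit_down (l := -2) H9 Ex1 Fx9 Fd9 isT isT isT dx1' isT
  (fun k i x E oi => ltac:(have := onlow x k i E oi; move: xx xr rd; item_lia)) j1.
set FL10 := if q1 is Some _ then _ else _ in H10.
have keep10 f h' : f != x1 -> f != d1 -> (f, h') \in FL9 -> (f, h') \in FL10.
  by move=> fx fd fF; rewrite /FL10; case: (q1) => [w|] //; rewrite inE !mem_filter /= fx fd fF orbT.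
have Fr10 : (r1, 6 - 1) \in FL10.
  by apply: keep10; rewrite ?mem_head // eq_sym.
have H11 := emit_side (lo' := l0) (hi' := r1) eirr H10 Ex1 Fr10 isT
  (or_intror (conj xr erefl)) (lexx _) (ltW xr) (ltac:(by rewrite lexx (ltW (lt_trans (lt_trans lx xx) xr))))
  (oko_upo _ (mates_far mg1) (je _ _ _ j1) j2).
have [h' xF10 ht'] : exists2 h, (x1, h) \in FL10 & h <= 6.
  by rewrite /FL10; case: (q1) => [w|]; [exists 6; rewrite ?mem_head | exists (-3)].
have H12 := emit_up eirr H11 Ex1 (dropo_keep q2 xF10 rx2) ht'
  (oko_upo _ (mates_far mg1) (je _ _ _ j2) (oko_upo _ (mates_far mg1) (je _ _ _ j1) j3)).
have {}H12 := weaken (FL' := dropc x1 (drop_opt x1 q3 (drop_opt r1 q2 FL10))) (M' := M) H12 (fun x => @mem_subseq _ _ _ (filter_subseq _ _) x)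
   (dropc_uniq x1 (free_uniq H12)) (fun _ h => h) (fun _ _ _ _ _ _ _ _ m => m).
do 12! eexists; apply: (wrap (G := [::]) esym eirr s1t H12) => //.
- by rewrite !updN // eq_sym.
- by rewrite inE eq_sym.
- exact: Ex1.
- by move=> u; rewrite !inE => /eqP ->; rewrite eqxx.
- move=> w ew wS; have : w \in outs e [set s0] s1 by rewrite inE ew wS.
  by case/cov1 => ->; do 3! (apply/addo_in; (try by left); right).
- by right=> h1; rewrite mem_filter /= eqxx.
- split; rewrite ?cats0 // => f /AFF[fF df]; exists (-3) => //.
  have [a1 a2 a3 a4] : [/\ f != x1, f != r1, f != d1 & x0 < f] by split; move: df xx xr rd; clear; lia.
  rewrite mem_filter /= a1; do 2! apply: dropo_keep => //; apply: keep10 => //.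
  exact: keep9.
- by rewrite cats0.
- by rewrite sA subnn addn0 leqnn.
Qed.

Lemma initial s0 s1 M : e s0 s1 -> s0 != t -> s1 != t ->
  mates_ok e set0 s0 M -> mates_ok e [set s0] s1 M -> (forall b, ~ M s1 b /\ ~ M b s1) ->
  drawn e t K (s1 |: [set s0]) M (K + 8) (4 * K.+1).
Proof.
move=> es s0t s1t mg0 mg1 nM.
pose g : int := 2 * 4 ^+ #|~: (s1 |: [set s0])|.
have g0 : 0 < g by rewrite /g mulr_gt0 // exprn_gt0.
pose col (j : nat) : int := j%:Z * g.
have collt i j : (i < j)%N -> col i < col j by move=> ij; rewrite /col ltr_pM2r.
have colinj : injective col.
  move=> i j; case: (ltngtP i j) => // /collt; first by move=> + E; rewrite E ltxx.
  by move=> + E; rewrite E ltxx.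
pose FL0 := [seq (col j, -3 : int) | j <- iota 0 (K + 8)].
have FLE : map fst FL0 = [seq col j | j <- iota 0 (K + 8)] by rewrite /FL0 -map_comp.
have inF j : (j < K + 8)%N -> (col j, -3 : int) \in FL0.
  by move=> jK; apply/mapP; exists j; rewrite // mem_iota.
have j6 j : (j < 6)%N -> (j < K + 8)%N by clear; lia.
(* The [K + 8] columns are six around the first edge and [K + 2] for the pool, at multiples of the
   required gap. *)
apply: (@initial_at s0 s1 M FL0 [seq col j | j <- iota 6 K.+2] (map fst FL0) (col 0) (col 1) (col 2) (col 3) (col 4) (col 5)) => //.
- exact: collt.
- exact: collt.
- exact: collt.
- exact: collt.
- exact: collt.
- by split; apply: inF; apply: j6.
- by split; apply: inF; apply: j6.
- move=> f /mapP[j]; rewrite mem_iota => /andP[j1 j2] ->; split; last exact: collt.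
  by apply: inF; move: j2; clear; lia.
- by rewrite map_inj_uniq ?iota_uniq.
- by rewrite size_map size_iota.
- by move=> c cF; apply: map_f.
- by rewrite FLE map_inj_uniq ?iota_uniq.
- move=> c c'; rewrite FLE => /mapP[i _ ->] /mapP[j _ ->]; rewrite -/g /col ltr_pM2r // ltz_nat => ij.
  have : (i.+1%:Z <= j%:Z :> int) by [].
  by rewrite -(ler_pM2r g0) -addn1 PoszD mulrDl mul1r.
- by rewrite !size_map size_iota.
Qed.

(** What remains of [layout] when no edge is pending. It depends only on the order of the
    coordinates, so it survives a monotone change of them. *)
Record complete (vp : V -> option (int * int)) (ed : V * V -> option item) (cols rows : seq int) : Prop := Complete {
  all_placed : forall w, vp w <> None;
  item_edge : forall u w i, ed (u, w) = Some i -> [/\ e u w, ifin i & ed (w, u) = None];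
  all_drawn : forall u w, e u w -> ed (u, w) <> None \/ ed (w, u) <> None;
  full_disjV : forall k k' i i' x y, ed k = Some i -> ed k' = Some i' -> k != k' ->
         onV i x y -> ~~ onV i' x y;
  full_disjH : forall k k' i i' x y, ed k = Some i -> ed k' = Some i' -> k != k' ->
         onH i x y -> ~~ onH i' x y;
  full_off : forall w x y k i, vp w = Some (x, y) -> ed k = Some i -> w != k.1 -> w != k.2 ->
         ~~ onV i x y && ~~ onH i x y;
  full_inj : forall w w' p, vp w = Some p -> vp w' = Some p -> w = w';
  item_ends : forall u w i, ed (u, w) = Some i ->
         [/\ vp u = Some (ix i, iy i), vp w = Some (jx i, jy i) & shape i];
  item_cols : forall k i, ed k = Some i -> [&& ix i \in cols, iX i \in cols & jx i \in cols];
  item_rows : forall k i, ed k = Some i -> [&& iy i \in rows, ih i \in rows, ik i \in rows & jy i \in rows];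
  full_grid : forall w x y, vp w = Some (x, y) -> (x \in cols) && (y \in rows) }.

Lemma inv_complete S I M vp ed top lo hi xc FL A AF prs cols rows :
  layout e S t I set0 M vp ed top lo hi xc FL A AF prs cols rows -> ~: S = [set t] -> vp t <> None ->
  (forall u, u \in S -> e u t -> u \in I) -> complete vp ed cols rows.
Proof.
move=> H St vt HI.
have Sn w : w != t -> w \in S.
  by move=> wt; apply: contraNT wt; rewrite -in_setC St inE.
have fin u w i : ed (u, w) = Some i -> ifin i.
  move=> E; have [euw [[uS ->]|[_]]] := item_status H E; last by rewrite inE.
  have [wt|/Sn ->//] := eqVneq w t; by rewrite HI ?orbT // -wt.
have N1 := disjV H; have N2 := disjH H; have N3 := vertex_off H; have N4 := place_inj H; have N5 := item_src H.
have N5' := item_tgt H; have C1 := src_grid H; have C2 := tgt_grid H; have C5 := place_grid H.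
split=> //.
- by move=> w; have [->//|/Sn] := eqVneq w t; apply: (in_placed H).
- move=> u w i E; split; [by have [] := item_status H E|exact: fin E|exact: (item_dir H E)].
- move=> u w euw; have [ut|/Sn uS] := eqVneq u t; last first.
    have [wt|/Sn wS] := eqVneq w t; last exact: (inner_drawn H).
    by left; rewrite wt in euw *; apply: (cut_drawn H) => //; exact: (cur_new H).
  have [wt|/Sn wS] := eqVneq w t; first by move: euw; rewrite ut wt eirr.
  by right; rewrite ut in euw *; apply: (cut_drawn H) => //; [exact: (cur_new H)|rewrite esym].
- by move=> u w i E; have [vu sh] := N5 _ _ E; split=> //; apply: (N5' _ _ E); apply: fin E.
- by case=> u w i E; have /and4P[-> -> _ _] := C1 _ _ E; have /and3P[-> _ _] := C2 _ _ E (fin _ _ _ E).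
- by case=> u w i E; have /and4P[_ _ -> ->] := C1 _ _ E; have /and3P[_ -> ->] := C2 _ _ E (fin _ _ _ E).
Qed.

(** With left, right and bottom taken, a fourth edge passes above the vertex on one extra row and
    enters from the top, where the column is still free. *)
Lemma fin_over S v I O M vp ed top lo hi FL A AF prs cols rows u i c h :
  layout e S v I O M vp ed top lo hi None FL A AF prs cols rows ->
  ed (u, v) = Some i -> ~~ ifin i -> iy i < top -> vp v = Some (c, top) ->
  (c, h) \in FL -> h <= top -> iX i != c ->
  exists lo' hi', layout e S v (u |: I) O M vp (upd ed (u, v) (finish i (top + 2) c top)) (top + 2) lo' hi' None
    [::] A [::] prs cols (top + 2 :: rows).
Proof.
move=> H E fi it Hv cF ht Xc.
have H' := newrow H 1 0 None.
have [euv uS] := pend_src eirr H E.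
have [Hu sh] := item_src H E; have At := levelA_range H.
have /and4P[cx cX cy ch] := src_grid H E; have /andP[ccol crow] := place_grid H Hv.
have [fV _] := free_ok H cF; rewrite /= in fV.
have norow k i' x : ed k = Some i' -> ~~ onH i' x (top + 2).
  by move=> E'; apply/negP => oi; have := row_items H' E' isT oi; clear; lia.
have ci x y : onV (finish i (top + 2) c top) x y -> onV i x y \/ (x = c /\ top < y).
  by move: fi sh; item_lia.
have hi_ x y : onH (finish i (top + 2) c top) x y -> onH i x y \/ y = top + 2.
  by move: fi sh; item_lia.
exists (Num.min (iX i) c), (Num.max (iX i) c).
apply: (set_item eirr H') => //=.
- move=> k' i' x y kk' E' /ci[oi|[-> ty]].
    by apply: (disjV H E E') => //; rewrite eq_sym.
  by apply/negP => oi'; have := fV _ _ _ E' oi'; move: ty ht; clear; lia.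
- move=> k' i' x y kk' E' /hi_[oi|->]; last exact: norow E'.
  by apply: (disjH H E E') => //; rewrite eq_sym.
- move=> z x y Hz zu zv; have /andP[a b] := vertex_off H Hz E zu zv.
  have /and3P[_ zt _] := place_height H Hz.
  apply/andP; split; apply/negP.
  + by case/ci=> [|[_ ty]]; [apply/negP|move: zt ty; clear; lia].
  + by case/hi_=> [|yt]; [apply/negP|move: zt yt; clear; lia].
- by move: fi sh it Xc; item_lia.
- by move: it; item_lia.
- by move=> x /hi_[/(level0 H E)//|]; move: At; clear; lia.
- by move=> k i' x _ E' _ oi; have := norow _ _ x E'; rewrite oi.
- by move=> x _ oi; move: (it) (sh) oi; item_lia.
- by move=> w x /(place_height H); clear; lia.
- by rewrite cx cX !inE cy ch !orbT.
- by move=> _; rewrite ccol !inE eqxx crow orbT.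
- by left.
- by left.
- by left; split=> //; rewrite E.
Qed.

(** The case distinction is on the number of predecessors of [t]. At most two rows are added, the
    row of [t] and the one above it for a fourth edge; without predecessors [t] goes on a pool
    column. *)
Lemma final_vertex (S : {set V}) W B : ~: S = [set t] -> drawn e t K S (fun _ _ => False) W B ->
  exists vp ed cols rows, [/\ complete vp ed cols rows, (size cols <= W)%N &
    (size rows * K.+1 <= B + 2 * K.+1)%N].
Proof.
move=> St [vp [ed [top [lo [hi [FL [A [AF [G [prs [cols [rows D]]]]]]]]]]]].
have tS : t \notin S by rewrite -in_setC St inE.
have [H Ht] := cur D tS; case: (D) => _ [_ Hp Hs _ [HW HB]].
have rowsB : (size rows * K.+1 <= B)%N by apply: leq_trans HB; apply: leq_addr.
have [us [uu um us4 so ue]] := pends esym eirr H.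
have sz4 : (size us <= 4)%N.
  by rewrite us4; apply: leq_trans (card_deg e4 S t); apply: leq_addr.
have inus u : u \in S -> e u t -> u \in us by move=> uS eut; rewrite um inE uS esym.
have At := topA H.
clear us4 um; case: us uu so ue sz4 inus => [|u1 [|u2 [|u3 us]]] uu so ue sz4 inus.
- have [f fP] : exists f, f \in AF ++ G by case: (AF ++ G) Hs => // f l _; exists f; rewrite mem_head.
  have [h fF] := pool_in Hp fP.
  have ht : h < top + 2.
    have At' := levelA_range H; case: Hp => _ a b; move: fP; rewrite mem_cat => /orP[/a|/b] [h' hA hF].
      by rewrite (FL_inj (free_uniq H) fF hF); move: hA At'; clear; lia.
    by rewrite (FL_inj (free_uniq H) fF hF); move: hA; clear; lia.
  have H1 := newrow H 1 0 None.
  have H2 := place_free (lo' := f) (hi' := f) H1 Ht fF ht (ltac:(clear; lia)) (or_introl erefl) (ltac:(move: At; clear; lia)) (ltac:(clear; lia)) (ltac:(by rewrite lexx)).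
  do 4 eexists; split; first apply: (inv_complete H2); rewrite ?updE //.
  + by move=> u uS eut; have := inus u uS eut.
  + by rewrite /= mulSn; move: rowsB; clear; lia.
- have [i1 [E1 f1 t1 P1]] := ue u1 (mem_head _ _).
  have H1 := start_one eirr H Ht E1 f1 t1.
  do 4 eexists; split; first apply: (inv_complete H1); rewrite ?updE //.
  + by move=> u uS eut; have := inus u uS eut; rewrite !inE => ->.
  + by rewrite /= mulSn; move: rowsB; clear; lia.
- have [i1 [E1 f1 t1 P1]] := ue u1 (mem_head _ _).
  have [i2 [E2 f2 t2 P2]] : exists i, [/\ ed (u2, t) = Some i, ~~ ifin i, iy i <= top & pcol t ed u2 = iX i].
    by apply: ue; rewrite !inE eqxx orbT.
  have u12 : u1 != u2 by move: uu; rewrite /= inE andbT.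
  have H1 := start_two (lo' := Num.min (iX i1) (iX i2)) (hi' := Num.max (iX i1) (iX i2))
    eirr H Ht u12 E1 f1 t1 E2 f2 t2 (ltac:(clear; lia)) (ltac:(clear; lia)) (ltac:(clear; lia)) (ltac:(clear; lia)).
  do 4 eexists; split; first apply: (inv_complete H1); rewrite ?updE //.
  + by move=> u uS eut; have := inus u uS eut; rewrite !inE => /orP[] ->; rewrite ?orbT.
  + by rewrite /= mulSn; move: rowsB; clear; lia.
have [i1 [E1 f1 t1 P1]] := ue u1 (mem_head _ _).
have [i2 [E2 f2 t2 P2]] : exists i, [/\ ed (u2, t) = Some i, ~~ ifin i, iy i <= top & pcol t ed u2 = iX i].
  by apply: ue; rewrite !inE eqxx orbT.
have [i3 [E3 f3 t3 P3]] : exists i, [/\ ed (u3, t) = Some i, ~~ ifin i, iy i <= top & pcol t ed u3 = iX i].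
  by apply: ue; rewrite !inE eqxx !orbT.
have [X12 X23] : iX i1 < iX i2 /\ iX i2 < iX i3.
  by move: so; rewrite /= P1 P2 P3 => /and3P[].
have uu3 : uniq [:: u1; u2; u3].
  by move: uu; rewrite /= !inE !negb_or => /and3P[/and3P[-> -> _] /andP[-> _] _].
have H3 := start_three eirr H Ht uu3 E1 f1 t1 E2 f2 t2 E3 f3 t3 X12 X23.
case: us uu so ue sz4 inus => [|u4 [|? ?]] // uu so ue _ inus.
  do 4 eexists; split; first apply: (inv_complete H3); rewrite ?updE //.
  + by move=> u uS eut; have := inus u uS eut; rewrite !inE => /or3P[] ->; rewrite ?orbT.
  + by rewrite /= mulSn; move: rowsB; clear; lia.
have [i4 [E4 f4 t4 P4]] : exists i, [/\ ed (u4, t) = Some i, ~~ ifin i, iy i <= top & pcol t ed u4 = iX i].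
  by apply: ue; rewrite !inE eqxx !orbT.
have [n1 n2 n3] : [/\ u4 != u1, u4 != u2 & u4 != u3].
  move: uu; rewrite /= !inE !negb_or => /and4P[/and3P[_ _ a] /andP[_ b] c _].
  by split; rewrite eq_sym.
set ed3 := upd (upd (upd ed _ _) _ _) _ _ in H3.
have E4' : ed3 (u4, t) = Some i4.
  rewrite /ed3 !updN //; by [apply: contraNneq n1 => -[->] | apply: contraNneq n2 => -[->] | apply: contraNneq n3 => -[->]].
have X42 : iX i4 != iX i2.
  by apply: contraNneq n2 => X; case: (pend_inj H E4 E2 f4 f2 X) => ->.
have X2F : (iX i2, top + 2) \in [:: (iX i3, top + 2), (iX i1, top + 2), (iX i2, top + 2) & FL].
  by rewrite !inE eqxx !orbT.
have [lo' [hi' H4]] := fin_over H3 E4' f4 (ltac:(move: t4; clear; lia)) (updE _ _ _) X2F (lexx _) X42.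
do 4 eexists; split; first apply: (inv_complete H4); rewrite ?updE //.
+ by move=> u uS eut; have := inus u uS eut; rewrite !inE => /or4P[] ->; rewrite ?orbT.
+ by rewrite /= !mulSn; move: rowsB; clear; lia.
Qed.
End InitFinal.

(** * Compression to consecutive grid lines *)

Definition rank (s : seq int) (x : int) : int := (count (fun c => c < x) (undup s))%:Z.

Lemma rank_le s x y : x <= y -> rank s x <= rank s y.
Proof. by move=> xy; rewrite lez_nat; apply: sub_count => c /lt_le_trans; apply. Qed.

Lemma rank_lt s x y : x \in s -> x < y -> rank s x < rank s y.
Proof.
move=> xs xy; rewrite ltz_nat; have : x \in undup s by rewrite mem_undup.
elim: (undup s) => //= c l IH; rewrite inE => /orP[/eqP<-|/IH{}IH].
  rewrite ltxx xy add0n add1n ltnS.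
  by apply: sub_count => d /lt_trans; apply.
case: (ltP c x) => [cx|xc]; first by rewrite (lt_trans cx xy) ltn_add2l.
by rewrite add0n; apply: leq_trans IH _; rewrite leq_addl.
Qed.

Lemma rank_ltE s x y : x \in s -> y \in s -> (rank s x < rank s y) = (x < y).
Proof.
move=> xs ys; apply/idP/idP; last exact: rank_lt.
by apply: contraTT; rewrite -!leNgt; apply: rank_le.
Qed.

Lemma rank_leE s x y : x \in s -> y \in s -> (rank s x <= rank s y) = (x <= y).
Proof. by move=> xs ys; rewrite leNgt rank_ltE // -leNgt. Qed.

Lemma rank_eqE s x y : x \in s -> y \in s -> (rank s x == rank s y) = (x == y).
Proof. by move=> xs ys; rewrite !eq_le !rank_leE. Qed.

Lemma rank_bound s x : x \in s -> 0 <= rank s x < (size (undup s))%:Z.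
Proof.
move=> xs; rewrite le0z_nat ltz_nat -(count_predC (fun c => c < x)) -addn1 leq_add2l.
by rewrite -has_count; apply/hasP; exists x; rewrite ?mem_undup //= ltxx.
Qed.

(** The ranks of distinct entries are distinct and below their number, so by counting they exhaust
    the range. *)
Lemma rank_onto s j : 0 <= j < (size (undup s))%:Z -> exists2 c, c \in s & rank s c = j.
Proof.
pose R := [seq `|rank s c|%N | c <- undup s].
have Ru : uniq R.
  rewrite map_inj_in_uniq ?undup_uniq // => x y; rewrite !mem_undup => xs ys.
  by move/(congr1 Posz)/eqP; rewrite !gez0_abs // rank_eqE // => /eqP.
have Rsub : {subset R <= iota 0 (size (undup s))}.
  move=> k /mapP[c]; rewrite mem_undup => cs ->; rewrite mem_iota.
  by have := rank_bound cs; rewrite /rank absz_nat => /andP[_].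
have [_ RE] := uniq_min_size Ru Rsub (ltac:(by rewrite size_iota size_map)).
case: j => // j /andP[_]; rewrite ltz_nat => js.
have : j \in R by rewrite RE mem_iota.
by case/mapP => c; rewrite mem_undup => cs ->; exists c.
Qed.

Definition rank_item (cols rows : seq int) (i : item) :=
  Item (rank cols (ix i)) (rank rows (iy i)) (rank rows (ih i)) (rank cols (iX i)) (ifin i)
    (rank rows (ik i)) (rank cols (jx i)) (rank rows (jy i)).

Section Compress.
Variables (V : finType) (e : rel V) (vp : V -> option (int * int)) (ed : V * V -> option item).
Variables (cols rows : seq int).
Hypothesis H : complete e vp ed cols rows.

Definition zrange (n : nat) : seq int := [seq j%:Z | j <- iota 0 n].

Lemma mem_zrange n x : (x \in zrange n) = (0 <= x < n%:Z).
Proof.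
apply/mapP/idP => [[j]|].
  by rewrite mem_iota => /andP[_ jn] ->; rewrite le0z_nat ltz_nat.
by case: x => // j /andP[_ jn]; exists j; rewrite // mem_iota.
Qed.

Let rx := rank cols.
Let ry := rank rows.

Lemma rank_onV i x y : [&& ix i \in cols, iX i \in cols & jx i \in cols] ->
  [&& iy i \in rows, ih i \in rows, ik i \in rows & jy i \in rows] -> x \in cols -> y \in rows ->
  onV (rank_item cols rows i) (rx x) (ry y) = onV i x y.
Proof.
by move=> /and3P[a1 a2 a3] /and4P[b1 b2 b3 b4] xc yr; rewrite /onV /= /rx /ry !rank_eqE // !rank_leE // !rank_ltE.
Qed.

Lemma rank_onH i x y : [&& ix i \in cols, iX i \in cols & jx i \in cols] ->
  [&& iy i \in rows, ih i \in rows, ik i \in rows & jy i \in rows] -> x \in cols -> y \in rows ->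
  onH (rank_item cols rows i) (rx x) (ry y) = onH i x y.
Proof.
by move=> /and3P[a1 a2 a3] /and4P[b1 b2 b3 b4] xc yr; rewrite /onH /btw /= /rx /ry !rank_eqE // !rank_leE.
Qed.

Lemma rank_shape i : [&& ix i \in cols, iX i \in cols & jx i \in cols] ->
  [&& iy i \in rows, ih i \in rows, ik i \in rows & jy i \in rows] ->
  shape (rank_item cols rows i) = shape i.
Proof.
by move=> /and3P[a1 a2 a3] /and4P[b1 b2 b3 b4]; rewrite /shape /straight /= !rank_eqE // !rank_leE // !rank_ltE.
Qed.

(** Width and height count every grid line that meets the drawing, including lines merely crossed,
    so the gaps between used columns have to vanish. After ranking, each lattice point on an item is
    the image of a point with listed coordinates, where disjointness is known. *)
Lemma compress : exists vp' ed', complete e vp' ed' (zrange (size (undup cols))) (zrange (size (undup rows))).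
Proof.
exists (fun w => omap (fun p => (rx p.1, ry p.2)) (vp w)), (fun k => omap (rank_item cols rows) (ed k)).
have inv_ k i : omap (rank_item cols rows) (ed k) = Some i -> exists2 i0, ed k = Some i0 & i = rank_item cols rows i0.
  by case: (ed k) => [i0 [<-]|//]; exists i0.
have invp w p : omap (fun p => (rx p.1, ry p.2)) (vp w) = Some p -> exists2 p0, vp w = Some p0 & p = (rx p0.1, ry p0.2).
  by case: (vp w) => [p0 [<-]|//]; exists p0.
have onVE k i0 x y : ed k = Some i0 -> onV (rank_item cols rows i0) x y ->
    exists x0 y0, [/\ x0 \in cols, y0 \in rows, x = rx x0 & y = ry y0].
  move=> E oi; have /and3P[a1 a2 a3] := item_cols H E; have /and4P[b1 b2 b3 b4] := item_rows H E.
  have [x0 xc xE] : exists2 x0, x0 \in cols & x = rx x0.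
    have : x = rx (ix i0) \/ x = rx (iX i0) \/ x = rx (jx i0) by move: oi; rewrite /onV /=; case/or3P => /andP[]; [move/eqP; auto|move/eqP; auto|move=> _ /andP[/eqP]; auto].
    by case=> [->|[->|->]]; eexists; try reflexivity.
  have [y0 yr yE] : exists2 y0, y0 \in rows & ry y0 = y.
    apply: rank_onto; have [_ /= fi _] := item_edge H (u := k.1) (w := k.2) (i := i0) (ltac:(by rewrite -surjective_pairing)).
    move: oi fi; rewrite /onV /=.
    move: (rank_bound b1) (rank_bound b2) (rank_bound b3) (rank_bound b4); move: (size _).
    by clear; lia.
  by exists x0, y0.
have onHE k i0 x y : ed k = Some i0 -> onH (rank_item cols rows i0) x y ->
    exists x0 y0, [/\ x0 \in cols, y0 \in rows, x = rx x0 & y = ry y0].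
  move=> E oi; have /and3P[a1 a2 a3] := item_cols H E; have /and4P[b1 b2 b3 b4] := item_rows H E.
  have [y0 yr yE] : exists2 y0, y0 \in rows & y = ry y0.
    have : y = ry (ih i0) \/ y = ry (ik i0) by move: oi; rewrite /onH /= => /andP[/orP[/andP[/eqP]|/and3P[_ /eqP]]]; auto.
    by case=> ->; eexists; try reflexivity.
  have [x0 xc xE] : exists2 x0, x0 \in cols & rx x0 = x.
    apply: rank_onto.
    move: oi; rewrite /onH /btw /=.
    move: (rank_bound a1) (rank_bound a2) (rank_bound a3); move: (size _).
    by clear; lia.
  by exists x0, y0.
split.
- by move=> w; have := all_placed H (w := w); case: (vp w).
- by move=> u w i /inv_[i0 E ->]; have [a b c] := item_edge H E; rewrite c.
- by move=> u w euw; case: (all_drawn H euw) => h; [left|right]; move: h; case: (ed _).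
- move=> k k' i i' x y /inv_[i0 E ->] /inv_[i1 E' ->] kk oi.
  have [x0 [y0 [xc yr xE yE]]] := onVE _ _ _ _ E oi; move: oi; rewrite xE yE.
  rewrite !rank_onV ?(item_cols H E) ?(item_rows H E) ?(item_cols H E') ?(item_rows H E') //; exact: (full_disjV H E E' kk).
- move=> k k' i i' x y /inv_[i0 E ->] /inv_[i1 E' ->] kk oi.
  have [x0 [y0 [xc yr xE yE]]] := onHE _ _ _ _ E oi; move: oi; rewrite xE yE.
  rewrite !rank_onH ?(item_cols H E) ?(item_rows H E) ?(item_cols H E') ?(item_rows H E') //; exact: (full_disjH H E E' kk).
- move=> w x y k i /invp[[x0 y0] Hw [-> ->]] /inv_[i0 E ->] w1 w2 /=.
  have /andP[xc yr] := full_grid H Hw.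
  rewrite rank_onV ?rank_onH ?(item_cols H E) ?(item_rows H E) //; exact: (full_off H Hw E w1 w2).
- move=> w w' p /invp[[x0 y0] Hw ->] /invp[[x1 y1] Hw' pE].
  have /andP[xc yr] := full_grid H Hw; have /andP[xc' yr'] := full_grid H Hw'.
  have /eqP := congr1 fst pE; have /eqP := congr1 snd pE; rewrite /= !rank_eqE // => /eqP yE /eqP xE.
  by apply: (full_inj H Hw); rewrite xE yE.
- move=> u w i /inv_[i0 E ->]; have [-> -> sh] := item_ends H E; split=> //.
  by rewrite rank_shape ?(item_cols H E) ?(item_rows H E).
- move=> k i /inv_[i0 E ->] /=; have /and3P[a1 a2 a3] := item_cols H E.
  by rewrite !mem_zrange !rank_bound.
- move=> k i /inv_[i0 E ->] /=; have /and4P[a1 a2 a3 a4] := item_rows H E.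
  by rewrite !mem_zrange !rank_bound.
- move=> w x y /invp[[x0 y0] Hw [-> ->]]; have /andP[xc yr] := full_grid H Hw.
  by rewrite !mem_zrange !rank_bound.
Qed.
End Compress.

(** * Polygonal lines *)

Definition disjoint_seg (s u : pt * pt) :=
  [|| Num.max s.1.1 s.2.1 < Num.min u.1.1 u.2.1, Num.max u.1.1 u.2.1 < Num.min s.1.1 s.2.1,
      Num.max s.1.2 s.2.2 < Num.min u.1.2 u.2.2 | Num.max u.1.2 u.2.2 < Num.min s.1.2 s.2.2].

Lemma i2q_lt a b : (i2q a < i2q b) = (a < b).
Proof. by rewrite /i2q ltr_int. Qed.
Lemma i2q_le a b : (i2q a <= i2q b) = (a <= b).
Proof. by rewrite /i2q ler_int. Qed.

Lemma disjoint_segP s u p : disjoint_seg s u -> ~~ (on_seg p s && on_seg p u).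
Proof.
move=> D; apply/negP => /andP[/andP[/andP[a1 a2] /andP[a3 a4]] /andP[/andP[b1 b2] /andP[b3 b4]]].
by case/or4P: D; rewrite -i2q_lt ltNge => /negP; apply;
  [apply: le_trans b1 a2|apply: le_trans a1 b2|apply: le_trans b3 a4|apply: le_trans a3 b4].
Qed.

Fixpoint simple_segs (l : seq (pt * pt)) : bool :=
  if l is s :: l' then
    [&& axis_seg s, (if l' is u :: l'' then ~~ overlap s u && all (disjoint_seg s) l'' else true) & simple_segs l']
  else true.

Lemma simple_orth l : simple_segs (segments l) -> orth_polyline l.
Proof.
rewrite /orth_polyline; elim: (segments l) => [|s L IH] /=; first by split=> // i j; rewrite andbF.
case/and3P=> axs hd /IH[ax pw]; split; first by rewrite axs.
case=> [|i] [|j] //=; last first.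
  by rewrite !ltnS => /pw[a b]; split=> [[/a]|/b].
rewrite ltnS => jL; case: L jL hd {IH ax pw} => //= u L jL /andP[ov ds]; split.
  by case=> j0; move: jL; rewrite j0.
case: j jL => [|j] // jL _ p; apply: disjoint_segP.
by have /allP := ds; apply; apply: mem_nth.
Qed.

Definition swap_seg (s : pt * pt) := (s.2, s.1).

Lemma segments_rcons l a b : segments (rcons (rcons l a) b) = rcons (segments (rcons l a)) (a, b).
Proof. by rewrite /segments; elim: l => [|x [|y l] IH] //=; congr cons; exact: IH. Qed.

Lemma segments_rev l : segments (rev l) = rev (map swap_seg (segments l)).
Proof.
elim: l => [|a [|b l] IH] //.
have -> : segments (a :: b :: l) = (a, b) :: segments (b :: l) by [].
by rewrite map_cons !rev_cons segments_rcons -rev_cons IH.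
Qed.

Lemma on_seg_swap p s : on_seg p (swap_seg s) = on_seg p s.
Proof. by rewrite /on_seg /swap_seg /= (minC s.2.1) (minC s.2.2) (maxC s.2.1) (maxC s.2.2). Qed.

Lemma overlap_swapl s u : overlap (swap_seg s) u = overlap s u.
Proof.
rewrite /overlap /horiz /vert /swap_seg /= (minC s.2.1) (minC s.2.2) (maxC s.2.1) (maxC s.2.2) (eq_sym s.2.1) (eq_sym s.2.2).
by case: eqP => [->|_] //=; case: eqP => [->|_].
Qed.

Lemma overlapC s u : overlap s u = overlap u s.
Proof.
rewrite /overlap (andbC (horiz s)) (andbC (vert s)) (eq_sym s.1.2) (eq_sym s.1.1).
by rewrite (maxC (Num.min s.1.1 s.2.1)) (maxC (Num.min s.1.2 s.2.2)) (minC (Num.max s.1.1 s.2.1)) (minC (Num.max s.1.2 s.2.2)).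
Qed.

Lemma overlap_swapr s u : overlap s (swap_seg u) = overlap s u.
Proof. by rewrite overlapC overlap_swapl overlapC. Qed.

Lemma on_polyline_rev p l : on_polyline p (rev l) = on_polyline p l.
Proof.
rewrite /on_polyline segments_rev has_rev has_map; apply: eq_has => s; exact: on_seg_swap.
Qed.

Lemma orth_rev l : orth_polyline l -> orth_polyline (rev l).
Proof.
rewrite /orth_polyline segments_rev size_rev size_map; set L := segments l => -[ax pw]; split.
  rewrite all_rev all_map; apply: sub_all ax => s; rewrite /axis_seg /horiz /vert /=.
  by rewrite ![s.2.1 == _]eq_sym ![s.2.2 == _]eq_sym.
move=> i j /andP[ij jL].
have nthE k : (k < size L)%N -> nth (0, 0, (0, 0)) (rev (map swap_seg L)) k = swap_seg (nth (0, 0, (0, 0)) L (size L - k.+1)).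
  move=> kL; rewrite nth_rev size_map // (nth_map (0, 0, (0, 0))) //.
  by rewrite ltn_subrL /=; apply: leq_ltn_trans kL.
rewrite !nthE //; last exact: ltn_trans jL.
have [a b] := pw (size L - j.+1)%N (size L - i.+1)%N (ltac:(move: ij jL; clear; lia)).
rewrite overlap_swapl overlap_swapr overlapC; split=> [ji|ji p].
  by apply: a; move: ji jL; clear; lia.
rewrite !on_seg_swap andbC; apply: b; move: ji jL; clear; lia.
Qed.

(** Parts of length zero and collinear corners are left out, as [orth_polyline] requires
    nondegenerate segments and every listed point counts as a bend. *)
Definition bends (i : item) : seq pt :=
  if straight i then [::] else
  (if ih i < iy i then [:: (ix i, ih i); (iX i, ih i)] else if iX i != ix i then [:: (iX i, ih i)] else [::]) ++
  (if jy i < ik i then [:: (iX i, ik i); (jx i, ik i)] else if iX i != jx i then [:: (iX i, ik i)] else [::]).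

Definition poly i := (ix i, iy i) :: rcons (bends i) (jx i, jy i).

Definition onP (i : item) (x y : int) :=
  [|| onV i x y, onH i x y, (x == ix i) && (y == iy i) | (x == jx i) && (y == jy i)].

Lemma shapeN i : ifin i -> shape i -> ~~ straight i ->
  [/\ ih i <= iy i, ih i < iy i -> iX i != ix i, iy i < jy i, jy i <= ik i & jy i < ik i -> iX i != jx i].
Proof.
rewrite /shape => -> /= /and3P[h1 /implyP h2 h3] /negPf ns; move: h3; rewrite ns /= => /and3P[h3 h4 /implyP h5].
by split.
Qed.

Lemma overlap_hv s u : horiz s -> vert u -> ~~ overlap s u.
Proof.
rewrite /overlap /horiz /vert => /andP[/eqP -> _] /andP[_ /negPf ->].
by rewrite eqxx !andbF.
Qed.

Lemma overlap_vh s u : vert s -> horiz u -> ~~ overlap s u.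
Proof. by move=> vs hu; rewrite overlapC overlap_hv. Qed.

Ltac simpletac := rewrite /segments /=; intros; repeat (apply/andP; split) => //;
  first [ by rewrite /axis_seg /horiz /vert /=; lia
        | by apply: overlap_hv; rewrite /horiz /vert /=; lia
        | by apply: overlap_vh; rewrite /horiz /vert /=; lia
        | by rewrite /disjoint_seg /= !(lt_min, gt_max); lia ].

Lemma poly_simple i : ifin i -> shape i -> simple_segs (segments (poly i)).
Proof.
move=> fi sh; rewrite /poly /bends; case: ifPn => [|nst].
  by rewrite /straight /segments /= /axis_seg /horiz /vert /=; clear; lia.
have [h1 h2 h3 h4 h5] := shapeN fi sh nst; case: i h1 h2 h3 h4 h5 {fi sh nst} => x y h X f k a b /= h1 h2 h3 h4 h5.
case: (boolP (h < y)) h2 => hy h2; case: (boolP (b < k)) h5 => bk h5; rewrite ?cats0 /=;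
  [have {}h2 := h2 isT|have {}h2 := h2 isT|clear h2|clear h2];
  [have {}h5 := h5 isT|clear h5|have {}h5 := h5 isT|clear h5].
- simpletac.
- case: ifP => Xa; simpletac.
- case: ifP => Xa; simpletac.
- case: ifP => Xx; case: ifP => Xa; simpletac.
Qed.

Definition in_box (s : pt * pt) (x y : int) :=
  (Num.min s.1.1 s.2.1 <= x <= Num.max s.1.1 s.2.1) && (Num.min s.1.2 s.2.2 <= y <= Num.max s.1.2 s.2.2).

Ltac bendtac := unfold onP, onV, onH, btw, in_box;
  cbn [fst snd ix iy ih iX ifin ik jx jy]; rewrite ?(ge_min, le_max); lia.

Lemma bends_on i p : ifin i -> shape i -> p \in bends i -> onV i p.1 p.2 && onH i p.1 p.2.
Proof.
move=> fi sh; rewrite /bends; case: ifPn => [//|nst].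
have [h1 h2 h3 h4 h5] := shapeN fi sh nst; case: i h1 h2 h3 h4 h5 fi {sh nst} => x y h X f k a b /= h1 h2 h3 h4 h5 fi.
case: (boolP (h < y)) h2 => hy h2; case: (boolP (b < k)) h5 => bk h5;
  [have {}h2 := h2 isT|have {}h2 := h2 isT|clear h2|clear h2];
  [have {}h5 := h5 isT|clear h5|have {}h5 := h5 isT|clear h5].
- rewrite !inE => /or4P[] /eqP ->; bendtac.
- case: ifP => Xa; rewrite !inE ?orbF; [case/or3P=> /eqP ->|case/orP=> /eqP ->]; bendtac.
- case: ifP => Xa; rewrite !inE ?orbF; [case/or3P=> /eqP ->|case/orP=> /eqP ->]; bendtac.
- case: ifP => Xx; case: ifP => Xa; rewrite ?inE ?orbF //; [case/orP=> /eqP ->|move/eqP=> ->|move/eqP=> ->]; bendtac.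
Qed.

Ltac segtac2 := rewrite /horiz /vert /in_box /= ?(ge_min, le_max) ?orbb ?eqxx ?andbF -?eq_le /=;
  lazymatch goal with |- is_true ((_ == _) && _) -> _ => move=> /andP[/eqP <-] | _ => move=> /andP[+ /eqP <-] end; let B := fresh in intro B; split=> //; revert B;
  unfold onV, onH, btw; cbn [fst snd ix iy ih iX ifin ik jx jy]; rewrite ?eqxx /= ?implyTb; lia.

(** The bridge from polygonal lines to items: apart from the two ends, lattice points on horizontal
    segments are seen by [onH] and those on vertical segments by [onV]. *)
Lemma seg_on i s x y : ifin i -> shape i -> s \in segments (poly i) -> in_box s x y ->
  (horiz s -> onH i x y || ((x == ix i) && (y == iy i)) || ((x == jx i) && (y == jy i))) /\
  (vert s -> onV i x y || ((x == ix i) && (y == iy i)) || ((x == jx i) && (y == jy i))).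
Proof.
move=> fi sh; rewrite /poly /bends.
case: ifPn => [|nst].
  by rewrite /straight /segments /= inE => st /eqP ->; rewrite /horiz /vert /= => B; split; move: st fi B; bendtac.
have [h1 h2 h3 h4 h5] := shapeN fi sh nst; case: i h1 h2 h3 h4 h5 fi {sh nst} => x1 y1 h X f k a b /= h1 h2 h3 h4 h5.
case: f => // _.
case: (boolP (h < y1)) h2 => hy h2; case: (boolP (b < k)) h5 => bk h5;
  [have {}h2 := h2 isT|have {}h2 := h2 isT|clear h2|clear h2];
  [have {}h5 := h5 isT|clear h5|have {}h5 := h5 isT|clear h5].
- rewrite /segments /= !inE => /or4P[| | |/orP[]] /eqP ->; segtac2.
- have kb : k = b by (move: h4 bk; clear; lia).
  subst k; case: eqVneq => Xa; first subst a; rewrite /segments /= !inE ?orbF;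
    [case/or3P|case/or4P] => /eqP ->; segtac2.
- have hE : h = y1 by (move: h1 hy; clear; lia).
  subst h; case: eqVneq => Xx; first subst x1; rewrite /segments /= !inE ?orbF;
    [case/or3P|case/or4P] => /eqP ->; segtac2.
- have kb : k = b by (move: h4 bk; clear; lia).
  have hE : h = y1 by (move: h1 hy; clear; lia).
  subst k h; case: eqVneq => Xx; first subst x1; (case: eqVneq => Xa; first subst a);
    rewrite /segments /= !inE ?orbF; [idtac|case/orP|case/orP|case/or3P] => /eqP ->; segtac2.
Qed.

(** * The orthogonal drawing *)

Lemma simple_axis l : simple_segs l -> all axis_seg l.
Proof. by elim: l => //= s l IH /and3P[-> _ /IH]. Qed.

Lemma on_seg_int s (z : pt) : on_seg (qp z) s = in_box s z.1 z.2.
Proof. by rewrite /on_seg /in_box /= !i2q_le. Qed.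

Lemma in_segments (l : seq pt) s : s \in segments l -> s.1 \in l /\ s.2 \in l.
Proof.
rewrite /segments; elim: l => [|a [|b l] IH] //.
have -> : zip (a :: b :: l) (behead (a :: b :: l)) = (a, b) :: zip (b :: l) (behead (b :: l)) by [].
rewrite inE => /orP[/eqP ->|/IH[a1 a2]]; first by rewrite /= !inE !eqxx ?orbT.
by rewrite inE a1 inE a2 !orbT.
Qed.

Lemma poly_coord i q : q \in poly i -> q.1 \in [:: ix i; iX i; jx i] /\ q.2 \in [:: iy i; ih i; ik i; jy i].
Proof.
rewrite /poly /bends inE mem_rcons inE.
case/or3P=> [/eqP->|/eqP->|]; rewrite ?inE ?eqxx ?orbT //.
case: ifP => // _; rewrite mem_cat => /orP[].
  case: ifP => _; first by rewrite !inE => /orP[]/eqP ->; rewrite /= !eqxx ?orbT.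
  by case: ifP => _; rewrite ?inE // => /eqP ->; rewrite /= !eqxx ?orbT.
case: ifP => _; first by rewrite !inE => /orP[]/eqP ->; rewrite /= !eqxx ?orbT.
by case: ifP => _; rewrite ?inE // => /eqP ->; rewrite /= !eqxx ?orbT.
Qed.

(** Height and width are specified through the proposition that a grid line meets the drawing, so
    the list of lines is extracted from a finite range by excluded middle. *)
Lemma ex_filter (l : seq int) (P : int -> Prop) : uniq l -> (forall x, P x -> x \in l) ->
  exists s : seq int, [/\ uniq s, (size s <= size l)%N & forall x, x \in s <-> P x].
Proof.
elim: l P => [|a l IH] P /=.
  by move=> _ Pl; exists [::]; split=> // x; split=> // /Pl.
case/andP=> al unfold_items Pl.
have [x|s [us sl sP]] := IH (fun x => P x /\ x <> a) unfold_items.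
  by case=> /Pl; rewrite inE => /orP[/eqP|].
have [Pa|nPa] := classic (P a).
  exists (a :: s); split=> //=.
    by rewrite us andbT; apply/negP => /sP[].
  move=> x; rewrite inE; split=> [/orP[/eqP->//|/sP[]//]|Px].
  by have [//|/eqP xa] := eqVneq x a; apply/sP.
exists s; split=> //; first exact: leqW.
move=> x; split=> [/sP[]//|Px]; apply/sP; split=> // xa; apply: nPa; by rewrite -xa.
Qed.

Lemma overlap_inv s u : overlap s u ->
  (horiz s /\ horiz u /\ exists x y, [/\ in_box s x y, in_box u x y, in_box s (x + 1) y & in_box u (x + 1) y]) \/
  (vert s /\ vert u /\ exists x y, [/\ in_box s x y, in_box u x y, in_box s x (y + 1) & in_box u x (y + 1)]).
Proof.
case: s => [[s1 s2] [s3 s4]]; case: u => [[u1 u2] [u3 u4]]; rewrite /overlap.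
case/orP=> /andP[/andP[/andP[hs hu] /eqP yy] lt]; [left|right]; split=> //; split=> //.
  exists (Num.max (Num.min s1 s3) (Num.min u1 u3)), s2; move: hs hu yy lt; rewrite /horiz /in_box /=.
  by clear => *; split; lia.
exists s1, (Num.max (Num.min s2 s4) (Num.min u2 u4)); move: hs hu yy lt; rewrite /vert /in_box /=.
by clear => *; split; lia.
Qed.

Section Draw.
Variables (V : finType) (e : rel V).
Variables (vp : V -> option (int * int)) (ed : V * V -> option item) (m n : nat).
Hypothesis H : complete e vp ed (zrange m) (zrange n).

Definition pos v : pt := odflt (0, 0) (vp v).
Definition route (u v : V) : seq pt :=
  if ed (u, v) is Some i then bends i else if ed (v, u) is Some i then rev (bends i) else [::].

Lemma vpE v : vp v = Some (pos v).
Proof. by rewrite /pos; case: (vp v) (all_placed H (w := v)). Qed.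

Lemma pos_inj : injective pos.
Proof. by move=> v w vw; apply: (full_inj H (vpE v)); rewrite vpE -vw. Qed.

Lemma edge_item u v : e u v -> exists k i, ed k = Some i /\
  ((k = (u, v) /\ polyline pos route u v = poly i /\ route u v = bends i) \/
   (k = (v, u) /\ polyline pos route u v = rev (poly i) /\ route u v = rev (bends i))).
Proof.
move=> euv; have ends a b i : ed (a, b) = Some i -> pos a = (ix i, iy i) /\ pos b = (jx i, jy i).
  by move=> E; have [pa pb _] := item_ends H E; move: pa pb; rewrite !vpE => -[->] [->].
case: (all_drawn H euv); case E : (ed _) => [i|] // _.
  exists (u, v), i; split=> //; left; have [pu pv] := ends _ _ _ E.
  by rewrite /polyline /route E pu pv.
exists (v, u), i; split=> //; right; have [pv pu] := ends _ _ _ E.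
have [_ _ En] := item_edge H E; rewrite /polyline /route E En pu pv; split=> //; split=> //.
by rewrite /poly rev_cons rev_rcons.
Qed.

Lemma item_ok k i : ed k = Some i -> [/\ ifin i, shape i, vp k.1 = Some (ix i, iy i) & vp k.2 = Some (jx i, jy i)].
Proof. by case: k => u w E; have [_ fi _] := item_edge H E; have [a b c] := item_ends H E; split. Qed.

Lemma seg_H k i s x y : ed k = Some i -> s \in segments (poly i) -> in_box s x y -> horiz s ->
  onH i x y \/ exists2 w, vp w = Some (x, y) & w = k.1 \/ w = k.2.
Proof.
move=> E sp sb hs; have [fi sh v1 v2] := item_ok E; have [Hh _] := seg_on fi sh sp sb.
case/orP: (Hh hs) => [/orP[|/andP[/eqP -> /eqP ->]]|/andP[/eqP -> /eqP ->]]; first by left.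
  by right; exists k.1; auto.
by right; exists k.2; auto.
Qed.

Lemma seg_V k i s x y : ed k = Some i -> s \in segments (poly i) -> in_box s x y -> vert s ->
  onV i x y \/ exists2 w, vp w = Some (x, y) & w = k.1 \/ w = k.2.
Proof.
move=> E sp sb hs; have [fi sh v1 v2] := item_ok E; have [_ Hh] := seg_on fi sh sp sb.
case/orP: (Hh hs) => [/orP[|/andP[/eqP -> /eqP ->]]|/andP[/eqP -> /eqP ->]]; first by left.
  by right; exists k.1; auto.
by right; exists k.2; auto.
Qed.

Lemma on_poly k i (z : pt) : ed k = Some i -> on_polyline (qp z) (poly i) ->
  [\/ onV i z.1 z.2, onH i z.1 z.2 | exists2 w, vp w = Some z & w = k.1 \/ w = k.2].
Proof.
move=> E /hasP[s sp]; rewrite on_seg_int => sb; have [fi sh v1 v2] := item_ok E.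
have /allP/(_ s sp)/orP[hs|hs] := simple_axis (poly_simple fi sh).
  case: (seg_H E sp sb hs); first by constructor 2.
  by rewrite -surjective_pairing; constructor 3.
case: (seg_V E sp sb hs); first by constructor 1.
by rewrite -surjective_pairing; constructor 3.
Qed.

Lemma off_vertex k i w x y : ed k = Some i -> vp w = Some (x, y) -> onV i x y || onH i x y ->
  w = k.1 \/ w = k.2.
Proof.
move=> E Hw oi; have [w1|/negP w1] := boolP (w == k.1); first by left; apply/eqP.
have [w2|/negP w2] := boolP (w == k.2); first by right; apply/eqP.
by have := full_off H Hw E (introN idP w1) (introN idP w2); rewrite -negb_or oi.
Qed.

Lemma ends_off k i w x y : ed k = Some i -> vp w = Some (x, y) -> w = k.1 \/ w = k.2 ->
  ~~ onV i x y && ~~ onH i x y.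
Proof.
move=> E Hw wk; have [fi sh v1 v2] := item_ok E.
have [[-> ->]|[-> ->]] : (x = ix i /\ y = iy i) \/ (x = jx i /\ y = jy i).
  by case: wk => wk; [left|right]; move: Hw; rewrite wk ?v1 ?v2 => -[].
- by move: fi sh; clear; case: i => ? ? ? ? ? ? ? ?; item_lia.
- by move: fi sh; clear; case: i => ? ? ? ? ? ? ? ?; item_lia.
Qed.

(** Two items sharing both ends could only be opposite orientations of one edge, and [item_edge]
    stores just one of them. *)
Lemma two_ends k k' i i' w w' : ed k = Some i -> ed k' = Some i' -> w != w' ->
  w = k.1 \/ w = k.2 -> w' = k.1 \/ w' = k.2 -> w = k'.1 \/ w = k'.2 -> w' = k'.1 \/ w' = k'.2 -> k = k'.
Proof.
case: k => a b; case: k' => c d E E' /eqP ww /= h1 h2 h3 h4.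
have [_ _ N] := item_edge H E.
have [[-> ->]//|[ad bc]] : (a = c /\ b = d) \/ (a = d /\ b = c).
  clear -ww h1 h2 h3 h4; case: h1 => h1; case: h2 => h2; case: h3 => h3; case: h4 => h4;
    try (by case: ww; rewrite h1 h2); try (by case: ww; rewrite h3 h4);
    by [left; split; congruence | right; split; congruence].
by move: E'; rewrite -ad -bc N.
Qed.

(* An overlap contains two neighbouring grid points; where the two edges are
   otherwise disjoint both would have to be common end points. *)
Lemma no_overlap k k' i i' s u : ed k = Some i -> ed k' = Some i' -> k != k' ->
  s \in segments (poly i) -> u \in segments (poly i') -> ~~ overlap s u.
Proof.
move=> E E' kk ss uu; apply/negP => /overlap_inv ov.
have comH x y : horiz s -> horiz u -> in_box s x y -> in_box u x y ->
    exists w, [/\ vp w = Some (x, y), w = k.1 \/ w = k.2 & w = k'.1 \/ w = k'.2].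
  move=> hs hu bs bu; case: (seg_H E ss bs hs) => [o1|[w Hw wk]].
    case: (seg_H E' uu bu hu) => [o2|[w Hw wk]].
      by have := full_disjH H E E' kk o1; rewrite o2.
    by exists w; split=> //; apply: (off_vertex E Hw); rewrite o1 orbT.
  exists w; split=> //; case: (seg_H E' uu bu hu) => [o2|[w' Hw' wk']].
    by apply: (off_vertex E' Hw); rewrite o2 orbT.
  by rewrite (full_inj H Hw Hw').
have comV x y : vert s -> vert u -> in_box s x y -> in_box u x y ->
    exists w, [/\ vp w = Some (x, y), w = k.1 \/ w = k.2 & w = k'.1 \/ w = k'.2].
  move=> hs hu bs bu; case: (seg_V E ss bs hs) => [o1|[w Hw wk]].
    case: (seg_V E' uu bu hu) => [o2|[w Hw wk]].
      by have := full_disjV H E E' kk o1; rewrite o2.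
    by exists w; split=> //; apply: (off_vertex E Hw); rewrite o1.
  exists w; split=> //; case: (seg_V E' uu bu hu) => [o2|[w' Hw' wk']].
    by apply: (off_vertex E' Hw); rewrite o2.
  by rewrite (full_inj H Hw Hw').
have [w [w' [ww [w1 w2] [w1' w2']]]] : exists w w', [/\ w != w',
    (w = k.1 \/ w = k.2) /\ (w' = k.1 \/ w' = k.2) & (w = k'.1 \/ w = k'.2) /\ (w' = k'.1 \/ w' = k'.2)].
  case: ov => -[hs [hu [x [y [b1 b2 b3 b4]]]]].
    have [w [Hw w1 w2]] := comH _ _ hs hu b1 b2; have [w' [Hw' w1' w2']] := comH _ _ hs hu b3 b4.
    exists w, w'; split=> //; apply/eqP => ww.
    by move: Hw; rewrite ww Hw' => -[]; clear; lia.
  have [w [Hw w1 w2]] := comV _ _ hs hu b1 b2; have [w' [Hw' w1' w2']] := comV _ _ hs hu b3 b4.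
  exists w, w'; split=> //; apply/eqP => ww.
  by move: Hw; rewrite ww Hw' => -[]; clear; lia.
by rewrite (two_ends E E' ww w1 w2 w1' w2') eqxx in kk.
Qed.

(** A bend counts as a point of both directions, so any other edge through it would violate
    disjointness in one of them. Bends are lattice points, hence integer points suffice although
    crossings are tested at rational ones. *)
Lemma bend_off k k' i i' b : ed k = Some i -> ed k' = Some i' -> k != k' ->
  b \in bends i -> ~~ on_polyline (qp b) (poly i').
Proof.
move=> E E' kk bb; have [fi sh _ _] := item_ok E; have /andP[oV oH] := bends_on fi sh bb.
apply/negP => /(on_poly E')[o|o|[w Hw wk]].
- by have := full_disjV H E E' kk oV; rewrite o.
- by have := full_disjH H E E' kk oH; rewrite o.
- have Hw' : vp w = Some (b.1, b.2) by rewrite Hw -surjective_pairing.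
  have wk' := off_vertex E Hw' (ltac:(by rewrite oV)).
  by have := ends_off E Hw' wk'; rewrite oV.
Qed.

Lemma drawing : orthogonal_drawing e pos route.
Proof.
split; first exact: pos_inj.
split.
  move=> u v euv; rewrite /route; case E : (ed (u, v)) => [i|]; case E' : (ed (v, u)) => [j|] //.
  - by have [_ _] := item_edge H E; rewrite E'.
  - by rewrite revK.
split.
  move=> u v /edge_item[k [i [E [[_ [-> _]]|[_ [-> _]]]]]]; have [fi sh _ _] := item_ok E.
    exact: simple_orth (poly_simple fi sh).
  exact: orth_rev (simple_orth (poly_simple fi sh)).
split.
  move=> u v w /edge_item[k [i [E pE]]] wu wv.
  have -> : on_polyline (qp (pos w)) (polyline pos route u v) = on_polyline (qp (pos w)) (poly i).
    by case: pE => [[_ [-> _]]|[_ [-> _]]]; rewrite ?on_polyline_rev.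
  have nk : ~ (w = k.1 \/ w = k.2).
    by case: pE => -[-> _] /= [] ww; [move: wu|move: wv|move: wv|move: wu]; rewrite ww eqxx.
  apply/negP => /(on_poly E)[o|o|[w' Hw' wk]].
  - by apply: nk; apply: (off_vertex E (x := (pos w).1) (y := (pos w).2)); rewrite ?o // -surjective_pairing vpE.
  - by apply: nk; apply: (off_vertex E (x := (pos w).1) (y := (pos w).2)); rewrite ?o ?orbT // -surjective_pairing vpE.
  - by apply: nk; rewrite (full_inj H (vpE w) Hw').
move=> u v x y /edge_item[k [i [E pE]]] /edge_item[k' [i' [E' pE']]] ne.
have kk : k != k'.
  apply/eqP => kk; apply: ne.
  by case: pE pE' => -[k1 _] [[k2 _]|[k2 _]]; move: kk; rewrite k1 k2 => -[-> ->]; auto.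
split.
  move=> s u' ss uu.
  have [s' [ss' sE]] : exists s', s' \in segments (poly i) /\ forall w, overlap s w = overlap s' w.
    case: pE => -[_ [pE _]]; rewrite pE in ss; first by exists s.
    move: ss; rewrite segments_rev mem_rev => /mapP[s' ss' ->]; exists s'; split=> // w.
    exact: overlap_swapl.
  have [u'' [uu' uE]] : exists u'', u'' \in segments (poly i') /\ forall w, overlap w u' = overlap w u''.
    case: pE' => -[_ [pE' _]]; rewrite pE' in uu; first by exists u'.
    move: uu; rewrite segments_rev mem_rev => /mapP[s0 ss0 ->]; exists s0; split=> // w.
    exact: overlap_swapr.
  by rewrite sE uE; apply: no_overlap E E' kk ss' uu'.
move=> p; have -> : on_polyline p (polyline pos route u v) = on_polyline p (poly i).
  by case: pE => [[_ [-> _]]|[_ [-> _]]]; rewrite ?on_polyline_rev.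
have -> : on_polyline p (polyline pos route x y) = on_polyline p (poly i').
  by case: pE' => [[_ [-> _]]|[_ [-> _]]]; rewrite ?on_polyline_rev.
move=> o1 o2; split=> -[b bb pb]; subst p.
  have bi : b \in bends i by case: pE bb => -[_ [_ ->]]; rewrite ?mem_rev.
  by have := bend_off E E' kk bi; rewrite o2.
have bi : b \in bends i' by case: pE' bb => -[_ [_ ->]]; rewrite ?mem_rev.
by have := bend_off E' E (ltac:(by rewrite eq_sym)) bi; rewrite o1.
Qed.

Lemma i2q_between a b x (N : nat) : 0 <= a < N%:Z -> 0 <= b < N%:Z ->
  i2q (Num.min a b) <= i2q x <= i2q (Num.max a b) -> x \in zrange N.
Proof. by rewrite mem_zrange !i2q_le; clear; lia. Qed.

Lemma on_drawing_range p : on_drawing e pos route p ->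
  (forall x, p.1 = i2q x -> x \in zrange m) /\ (forall y, p.2 = i2q y -> y \in zrange n).
Proof.
have i2qI : injective i2q by move=> a b /eqP; rewrite /i2q eqr_int => /eqP.
case=> [[v ->]|[u [v [euv]]]].
  have /andP[a b] := full_grid H (w := v) (x := (pos v).1) (y := (pos v).2) (ltac:(by rewrite -surjective_pairing vpE)).
  by split=> [x /i2qI <-|y /i2qI <-].
have [k [i [E pE]]] := edge_item euv.
have -> : on_polyline p (polyline pos route u v) = on_polyline p (poly i).
  by case: pE => [[_ [-> _]]|[_ [-> _]]]; rewrite ?on_polyline_rev.
case/hasP=> s ss /andP[o1 o2]; have [s1 s2] := in_segments ss.
have [a1 b1] := poly_coord s1; have [a2 b2] := poly_coord s2.
have cx x : x \in [:: ix i; iX i; jx i] -> 0 <= x < m%:Z.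
  have /and3P[c1 c2 c3] := item_cols H E; rewrite !mem_zrange in c1 c2 c3.
  by rewrite !inE => /or3P[]/eqP->.
have cy y : y \in [:: iy i; ih i; ik i; jy i] -> 0 <= y < n%:Z.
  have /and4P[c1 c2 c3 c4] := item_rows H E; rewrite !mem_zrange in c1 c2 c3 c4.
  by rewrite !inE => /or4P[]/eqP->.
split=> [x xE|y yE].
  by apply: (i2q_between (cx _ a1) (cx _ a2)); rewrite -xE.
by apply: (i2q_between (cy _ b1) (cy _ b2)); rewrite -yE.
Qed.

Lemma uniq_zrange N : uniq (zrange N).
Proof. by rewrite map_inj_uniq ?iota_uniq // => a b []. Qed.

Lemma size_zrange N : size (zrange N) = N.
Proof. by rewrite size_map size_iota. Qed.

Lemma height_width : exists h w, [/\ drawing_height e pos route h, drawing_width e pos route w, (h <= n)%N & (w <= m)%N].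
Proof.
have [y [p [dp py]]|sy [uy ly Py]] := ex_filter (P := fun y => exists p, on_drawing e pos route p /\ p.2 = i2q y) (uniq_zrange n).
  by have [_] := on_drawing_range dp; apply.
have [x [p [dp px]]|sx [ux lx Px]] := ex_filter (P := fun x => exists p, on_drawing e pos route p /\ p.1 = i2q x) (uniq_zrange m).
  by have [+ _] := on_drawing_range dp; apply.
exists (size sy), (size sx); rewrite size_zrange in ly; rewrite size_zrange in lx.
by split=> //; [exists sy|exists sx].
Qed.
End Draw.

(** * Assembly, choice of the pool size and the area estimate *)

Section Main.
Variables (V : finType) (e : rel V).
Hypothesis esym : symmetric e.
Hypothesis eirr : irreflexive e.
Hypothesis e3 : three_connected e.
Hypothesis e4 : max_degree_le e 4.

Lemma conn_compl s0 s1 : conn e (~: (s1 |: [set s0])).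
Proof.
apply/connP => x y; rewrite !in_setC => xS yS.
have := e3.2 s0 s1 x y; rewrite setUC => /(_ xS yS); apply: etrans; apply: eq_connect => a b.
by rewrite /= !in_setC andbA.
Qed.

(** Deleting one vertex [u], written as a pair of equal vertices, leaves two distinct vertices
    joined by a path, and its first step is an edge. *)
Lemma exists_edge : exists s0 s1, e s0 s1.
Proof.
have [V3 cn] := e3.
have [u [x [y [xy xu yu]]]] : exists u x y : V, [/\ x != y, x \notin [set u; u] & y \notin [set u; u]].
  have : (2 < #|V|)%N by apply: ltnW.
  rewrite cardE; have := enum_uniq V; case: (enum V) => [|u [|x [|y l]]] //= /and3P[h1 h2 _] _.
  exists u, x, y; rewrite !inE !negb_or in h1 h2 *.
  by move: h1 h2 => /and3P[a b _] /andP[c _]; rewrite c ![_ == u]eq_sym a b.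
case/connectP: (cn u u x y xu yu) => -[|z p] /=; first by move=> _ yE; rewrite yE eqxx in xy.
by case/andP => /andP[/andP[exz _] _] _ _; exists x, z.
Qed.

(** Of the six fixed rows four come from the first edge and two from the last vertex; the [K + 8]
    fixed columns are the initial ones. The 3 subtracted from the number of vertices stands for the
    two first vertices and [t]. *)
Lemma drawing_exists (K : nat) : exists (pos : V -> pt) (route : V -> V -> seq pt) (h w J : nat),
  [/\ orthogonal_drawing e pos route, drawing_height e pos route h, drawing_width e pos route w,
      (J + 3 <= #|V|)%N /\ (w <= K + 8 + 2 * J)%N &
      (h * K.+1 <= 6 * K.+1 + K.+3 * (#|V| - 3 - J))%N].
Proof.
have [s0 [s1 es]] := exists_edge; have s10 : s1 != s0 by apply: contraTneq es => ->; rewrite eirr.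
have cS : #|~: (s1 |: [set s0])| = (#|V| - 2)%N.
  by rewrite cardsCs setCK cardsU1 inE s10 cards1.
have [V3 _] := e3.
have [t] : exists t, t \in ~: (s1 |: [set s0]).
  by apply/set0Pn; rewrite -card_gt0 cS subn_gt0 ltnW.
rewrite !inE negb_or => /andP[t1 t0].
have tS : t \notin s1 |: [set s0] by rewrite !inE negb_or t1 t0.
have c2 : (1 < #|s1 |: [set s0]|)%N by rewrite cardsU1 inE s10 cards1.
have [L oL] := chain_order_ex esym e3 e4 c2 tS (conn_compl s0 s1).
have out b : ~ mate L s1 b /\ ~ mate L b s1.
  have no c : ~ mate L s1 c by move=> m; have := mate_out oL m; rewrite setU11.
  by split=> [|/mate_sym]; apply: no.
have s0S : s0 \in s1 |: [set s0] by rewrite !inE eqxx orbT.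
rewrite ![t == _]eq_sym in t0 t1.
have D := initial esym eirr e4 K es t0 t1
  (mate_good esym oL (sub0set _) s0S)
  (mate_good esym oL (subsetUr _ _) (setU11 _ _)) out.
have [J [S' [S'E JS D']]] := draw_all esym eirr e4 (leqnn _) oL D.
have [vp [ed [cols [rows [cm cW rB]]]]] := final_vertex esym eirr e4 S'E D'.
have [vp' [ed' cm']] := compress cm.
have [h [w [hh ww hn wm]]] := height_width cm'.
exists (pos vp'), (route ed'), h, w, J; split=> //.
- exact: (drawing cm').
- split; first by move: JS V3; rewrite cS; clear; lia.
  exact: leq_trans wm (leq_trans (size_undup _) cW).
- have hr : (h <= size rows)%N by apply: leq_trans hn (size_undup _).
  apply: leq_trans (leq_mul hr (leqnn _)) (leq_trans rB _); rewrite cS.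
  have -> : ((#|V| - 2).-1 - J = #|V| - 3 - J)%N by clear; lia.
  by rewrite addnAC -mulnDl.
Qed.
End Main.

(** The quadratic part of the product is [2.04 b j], at most [0.51 (b + j)^2] because [(b - j)^2] is
    nonnegative; the generous constant 1000 absorbs the linear terms. *)
Lemma area_bound (F : realFieldType) (x y b j : F) :
  x * 100 * y <= (6 * 100 + 102 * b) * (107 + 2 * j) -> 0 <= b -> 0 <= j ->
  x * y <= 9 / 16 * (b + j + 3) ^+ 2 + 1000 * (b + j + 3).
Proof.
move=> P b0 j0; have Q := sqr_ge0 (b - j); have R := mulr_ge0 b0 b0; have T := mulr_ge0 j0 j0.
rewrite !expr2 in Q *; lra.
Qed.

Theorem theorem2 :
  exists c : rat,
    forall (V : finType) (e : rel V),
      simple_graph e -> three_connected e -> max_degree_le e 4 ->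
      exists (pos : V -> pt) (route : V -> V -> seq pt) (H W : nat),
        [/\ orthogonal_drawing e pos route,
            drawing_height e pos route H,
            drawing_width e pos route W &
            ((H * W)%:R : rat) <= 9%:R / 16%:R * (#|V|%:R) ^+ 2 + c * #|V|%:R].
Proof.
exists 1000%:R => V e [eirr esym] e3 e4.
(* With [K = 99] the factor for rows is 102/100. The leading term fits under 9/16 as soon as [K + 1]
   is at least 16; 99 merely gives round numbers. *)
have [pos [route [h [w [J [dr dh dw [J3 wW] hB]]]]]] := drawing_exists esym eirr e3 e4 99.
exists pos, route, h, w; split; [exact: dr|exact: dh|exact: dw|].
set n := #|V| in J3 hB *.
have [a nE] : exists a, n = (a + J + 3)%N by exists (n - 3 - J)%N; move: J3; clear; lia.
have hB' : (h * 100 <= 6 * 100 + 102 * a)%N.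
  by apply: leq_trans hB _; rewrite leq_add2l leq_mul2l nE; move: (a) (J); clear; lia.
have wW' : (w <= 107 + 2 * J)%N by exact: wW.
have P : (h%:R * 100 * w%:R <= (6 * 100 + 102 * a%:R) * (107 + 2 * J%:R) :> rat).
  have h1 : (h%:R * 100 <= 6 * 100 + 102 * a%:R :> rat).
    by move: hB'; rewrite -(ler_nat rat) natrD !natrM.
  have w1 : (w%:R <= 107 + 2 * J%:R :> rat).
    by move: wW'; rewrite -(ler_nat rat) natrD !natrM.
  by apply: ler_pM h1 w1; rewrite ?ler0n // mulr_ge0 // ler0n.
rewrite nE natrM !natrD; have [x0 z0] := (ler0n rat a, ler0n rat J).
exact: area_bound P x0 z0.
Qed.
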